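(* Fix $\gamma>0$ and let $\psi_\gamma(x)=\frac{\sqrt{\gamma}}{\sqrt{2\pi}}\frac{e^{-\gamma|x|}}{|x|}$ for $x\in\mathbf{R}^3\setminus\{0\}$. Define $$\mathcal{F}:=\{u\in L^2(\mathbf{R}^3,\psi_\gamma^2dx):\nabla u\in L^2(\mathbf{R}^3,\psi_\gamma^2dx)\},\qquad \mathcal{E}(u,v):=\frac12\int_{\mathbf{R}^3}\nabla u(x)\cdot\nabla v(x)\,\psi_\gamma(x)^2dx,\quad u,v\in\mathcal{F},$$ where $\nabla u$ is the gradient in the sense of distributions. Then $(\mathcal{E},\mathcal{F})$ is a regular Dirichlet form on $L^2(\mathbf{R}^3,\psi_\gamma(x)^2dx)$ with core $C_c^\infty(\mathbf{R}^3)$.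
   Context: $C_c^\infty(\mathbf{R}^3)$ is the set of smooth functions with compact support in $\mathbf{R}^3$. That $C_c^\infty(\mathbf{R}^3)$ is a core of the Dirichlet form means that $C_c^\infty(\mathbf{R}^3)$ is contained in $\mathcal{F}$, is dense in $\mathcal{F}$ for the norm $\|u\|_{\mathcal{E}_1^{1/2}}=[\mathcal{E}(u,u)+\int u^2\psi_\gamma^2dx]^{1/2}$, and is dense in $C_c(\mathbf{R}^3)$ for the uniform norm. *)

(* Defs.v *)
From HB Require Import structures.
From mathcomp Require Import all_boot all_order all_algebra.
From mathcomp Require Import all_classical all_reals all_analysis.
From mathcomp Require Import measurable_realfun.

Set Implicit Arguments.
Unset Strict Implicit.
Unset Printing Implicit Defensive.

Import Order.TTheory GRing.Theory Num.Theory.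
Import numFieldNormedType.Exports.

Local Open Scope classical_set_scope.
Local Open Scope ring_scope.

(* The elements of [L^2(m)] are represented by square-integrable measurable
   functions ([Lfun m 2]) rather than by classes: a form is a set [F] of such
   functions with a map [E], and both must be compatible with m-a.e. equality
   ([sf_ae_dom] and [sf_ae]). *)
Section forms.
Context d (T : measurableType d) (R : realType).
Variable m : {measure set T -> \bar R}.
Variables (E : (T -> R) -> (T -> R) -> R) (F : set (T -> R)).

Record sym_form : Prop := SymForm {
  sf_L2 : forall u, F u -> u \in Lfun m 2%:E ;
  sf_ae_dom : forall u v, F u -> v \in Lfun m 2%:E -> u = v %[ae m] -> F v ;
  sf_ae : forall u v w, F u -> F v -> F w -> u = v %[ae m] -> E u w = E v w ;
  sf_zero : F (fun=> 0) ;
  sf_lin : forall a u v, F u -> F v -> F (fun x => a * u x + v x) ;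
  sf_dense : forall f, f \in Lfun m 2%:E -> forall eps : R, 0 < eps ->
    exists2 u, F u & ('N[m]_2%:E[EFin \o (f \- u)%R] < eps%:E)%E ;
  sf_bilin : forall a u v w, F u -> F v -> F w ->
    E (fun x => a * u x + v x) w = a * E u w + E v w ;
  sf_sym : forall u v, F u -> F v -> E u v = E v u ;
  sf_ge0 : forall u, F u -> 0 <= E u u }.

Definition E1norm (u : T -> R) : R :=
  Num.sqrt (E u u + \int[m]_x (u x ^+ 2)).

Definition closed_form : Prop :=
  forall u_ : nat -> T -> R, (forall n, F (u_ n)) ->
  (forall eps : R, 0 < eps -> exists N, forall n k, (N <= n)%N -> (N <= k)%N ->
     E1norm (u_ n \- u_ k) < eps) ->
  exists2 u, F u & E1norm (u_ n \- u) @[n --> \oo] --> 0.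

(* Markov property: the unit contraction [(0 \/ u) /\ 1] operates on [E]. *)
Definition markovian_form : Prop :=
  forall u, F u ->
  let v := fun x => Num.min (Num.max 0 (u x)) 1 in F v /\ E v v <= E u u.

Definition dirichlet_form : Prop :=
  [/\ sym_form, closed_form & markovian_form].

End forms.

Notation R3 R := (R * R * R)%type.

(* The same type, with the Borel structure on which the library defines
   [lebesgue_measure]. *)
Notation mR3 R :=
  (measurableTypeR R * measurableTypeR R * measurableTypeR R)%type.

Section R3.
Context {R : realType}.

Definition e3 (i : 'I_3) : R3 R :=
  ((i == 0%N :> nat)%:R, (i == 1%N :> nat)%:R, (i == 2%N :> nat)%:R).

(* The library norm of a product is the sup norm, which gives the same topology
   as the Euclidean norm. *)
Definition enorm3 (x : R3 R) : R :=
  Num.sqrt (x.1.1 ^+ 2 + x.1.2 ^+ 2 + x.2 ^+ 2).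

Definition leb3 : {measure set (mR3 R) -> \bar R} :=
  ((@lebesgue_measure R \x @lebesgue_measure R) \x @lebesgue_measure R)%E.

Fixpoint Ck (k : nat) (f : R3 R -> R) : Prop :=
  match k with
  | 0 => continuous f
  | k'.+1 => continuous f /\
      forall i, (forall x, derivable f x (e3 i)) /\ Ck k' ('D_(e3 i) f)
  end.

Definition compactly_supported (f : R3 R -> R) : Prop :=
  compact (closure [set x | f x != 0]).

Definition Cc : set (R3 R -> R) :=
  [set f | continuous f /\ compactly_supported f].

Definition Ccoo : set (R3 R -> R) :=
  [set f | (forall k, Ck k f) /\ compactly_supported f].

Definition loc_integrable3 (f : R3 R -> R) : Prop :=
  measurable_fun [set: mR3 R] f /\
  forall K : set (R3 R), compact K -> leb3.-integrable K (EFin \o f).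

(* [g] is the [i]-th partial derivative of [u] in the sense of distributions
   on the whole of R^3. *)
Definition weak_partial (i : 'I_3) (u g : R3 R -> R) : Prop :=
  [/\ loc_integrable3 u, loc_integrable3 g &
    forall phi, Ccoo phi ->
      \int[leb3]_x (u x * 'D_(e3 i) phi x) = - \int[leb3]_x (g x * phi x)].

(* A chosen representative of the distributional derivative (unique up to a null
   set), and [0] if the latter is not a locally integrable function. *)
Definition wgrad (i : 'I_3) (u : R3 R -> R) : R3 R -> R :=
  xget (fun=> 0) [set g | weak_partial i u g].

Section regular.
Variable m : {measure set (mR3 R) -> \bar R}.
Variables (E : (R3 R -> R) -> (R3 R -> R) -> R) (F : set (R3 R -> R)).

Definition is_core (C : set (R3 R -> R)) : Prop :=
  [/\ C `<=` F, C `<=` Cc,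
      forall u, F u -> forall eps : R, 0 < eps ->
        exists2 v, C v & E1norm m E (u \- v) < eps &
      forall f, Cc f -> forall eps : R, 0 < eps ->
        exists2 v, C v & forall x, `|f x - v x| <= eps].

(* Regularity is a notion for Dirichlet forms on [L^2(m)] where [m] is a Radon
   measure with full support. *)
Definition radon_full_support : Prop :=
  (forall K : set (R3 R), compact K -> (m K < +oo)%E) /\
  (forall U : set (R3 R), open U -> U !=set0 -> (0 < m U)%E).

Definition regular_dirichlet_form : Prop :=
  [/\ radon_full_support, dirichlet_form m E F & is_core (F `&` Cc)].

End regular.

Section psi.
Variable gamma : R.

(* At the origin, a null set, the division by [0] yields the value [0]. *)
Definition psi (x : R3 R) : R :=
  Num.sqrt gamma / Num.sqrt (2 * pi) * (expR (- (gamma * enorm3 x)) / enorm3 x).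

Lemma measurable_enorm3 : measurable_fun [set: mR3 R] enorm3.
Proof.
rewrite (_ : enorm3 = (@powR R ^~ 2^-1) \o
    (fun x : R3 R => x.1.1 ^+ 2 + x.1.2 ^+ 2 + x.2 ^+ 2)); last first.
  by apply/funext => x /=; rewrite powR12_sqrt// !addr_ge0// sqr_ge0.
apply: measurableT_comp; first exact: measurable_powR.
apply: measurable_funD; [apply: measurable_funD|]; apply: measurable_funX.
- exact: measurableT_comp measurable_fst measurable_fst.
- exact: measurableT_comp measurable_snd measurable_fst.
- exact: measurable_snd.
Qed.

Lemma measurable_psi : measurable_fun [set: mR3 R] psi.
Proof.
apply: measurable_funM => //; apply: measurable_funM.
  apply: measurableT_comp => //; apply: measurableT_comp => //.
  by apply: measurable_funM => //; exact: measurable_enorm3.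
rewrite (_ : (fun _ => _) = (@powR R ^~ (- 1)) \o enorm3).
  exact: measurableT_comp (measurable_powR _) measurable_enorm3.
by apply/funext => x /=; rewrite powR_inv1// sqrtr_ge0.
Qed.

Definition psi2dx (A : set (mR3 R)) : \bar R :=
  (\int[leb3]_(x in A) (psi x ^+ 2)%:E)%E.

Let psi2dx0 : psi2dx set0 = 0%E.
Proof. by rewrite /psi2dx integral_set0. Qed.

Let psi2dx_ge0 A : (0 <= psi2dx A)%E.
Proof. by apply: integral_ge0 => x _; rewrite lee_fin sqr_ge0. Qed.

Let psi2dx_sigma_additive : semi_sigma_additive psi2dx.
Proof.
move=> A mA tA mUA; rewrite /psi2dx ge0_integral_bigcup//=; last first.
- by move=> x _; rewrite lee_fin sqr_ge0.
- apply/measurable_funTS/measurable_EFinP/measurable_funX.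
  exact: measurable_psi.
apply: is_cvg_ereal_nneg_natsum_cond => n _ _; exact: psi2dx_ge0.
Qed.

HB.instance Definition _ := isMeasure.Build _ _ _ psi2dx
  psi2dx0 psi2dx_ge0 psi2dx_sigma_additive.

Definition F_psi : set (R3 R -> R) :=
  [set u | u \in Lfun psi2dx 2%:E /\
    forall i, exists2 g, weak_partial i u g & g \in Lfun psi2dx 2%:E].

Definition E_psi (u v : R3 R -> R) : R :=
  2^-1 * \int[leb3]_x
    ((\sum_(i < 3) wgrad i u x * wgrad i v x) * psi x ^+ 2).

End psi.
End R3.

(* Main.v *)
(* The weight [psi^2 = c e^(-2 gamma |x|) / |x|^2] is locally integrable, bounded
   below on bounded sets off the origin, and satisfies a Muckenhoupt A_1 condition
   at scales at most 1. The lower bound embeds [L^2(psi^2 dx)] into [L^1_loc], so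
   that distributional gradients pass to [L^2] limits and the form is closed. The
   A_1 condition makes mollification bounded, hence convergent, on
   [L^2(psi^2 dx)]; as it commutes with weak derivatives, mollifying and then
   cutting off gives the density of [C_c^oo] in the form domain. For the Markov
   property, [T o u] with [T] the unit contraction is an [L^2] limit of
   [h_n o v_n], with [v_n] in [C_c^oo] tending to [u] and [h_n] tending to [T], of
   class [C^1] with [|h_n'| <= 1] and [h_n 0 = 0]. The energies of these functions
   are bounded by those of [v_n], and the closed form [E] is lower semicontinuous
   for [L^2] convergence. *)

Require Import Defs.
From HB Require Import structures.
From mathcomp Require Import all_boot all_order all_algebra.
From mathcomp Require Import all_classical all_reals all_analysis.
From mathcomp Require Import measurable_realfun ring lra.
Set Implicit Arguments.
Unset Strict Implicit.
Unset Printing Implicit Defensive.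
Import Order.TTheory GRing.Theory Num.Theory.
Import numFieldNormedType.Exports.
Local Open Scope classical_set_scope.
Local Open Scope ring_scope.
(** * Square-integrable functions *)

(** [E_psi] is computed from a gradient that [wgrad] merely chooses, so its properties depend on
    almost everywhere uniqueness of weak derivatives. This is du Bois-Reymond's lemma, which in turn
    needs indicators approximated by continuous functions. Mollification is endangered only near the
    singularity: for [|y| < 2e] the mass of [psi^2] on a box of size of order [e] is of order [e],
    the mollifier is at most of order [e^-3], and [psi^2] at [y] is at least of order [e^-2],
    exactly the balance that A_1 asks for. The exponential factor has bounded ratio only over
    bounded distances, hence the restriction on the scale. The Markov property is arranged so that
    no chain rule for Lipschitz functions of Sobolev functions occurs: only [C^1] functions of test
    functions are differentiated. Lower semicontinuity is proved for any closed form, with a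
    minimising sequence in place of weak compactness. Squared norms are used throughout;
    [(a + b)^2 <= 2 a^2 + 2 b^2] stands in for the triangle inequality and explains most fractions
    of epsilon. *)

Section square_integrable.
Context d (T : measurableType d) (R : realType).
Variable m : {measure set T -> \bar R}.
Implicit Types f g : T -> R.

(** The squared [L^2] norm, kept in [\bar R]: comparison, Fatou's lemma and Tonelli's theorem then
    apply to every measurable function, and finiteness is a separate condition in [L2]. *)
Definition sqint f : \bar R := (\int[m]_x (f x ^+ 2)%:E)%E.

Definition L2 f : Prop := measurable_fun setT f /\ (sqint f < +oo)%E.

Lemma measurable_sq f : measurable_fun setT f ->
  measurable_fun setT (fun x => (f x ^+ 2)%:E).
Proof. by move=> mf; apply/measurable_EFinP/measurable_funX. Qed.

Lemma sqint_ge0 f : (0 <= sqint f)%E.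
Proof. by apply: integral_ge0 => x _; rewrite lee_fin sqr_ge0. Qed.

Lemma poweR_sqint f : (\int[m]_x `|(EFin \o f) x| `^ 2)%E = sqint f.
Proof.
apply: eq_integral => x _ /=.
by rewrite powR_mulrn// real_normK ?num_real.
Qed.

Lemma Lfun2P f : f \in Lfun m 2%:E <-> L2 f.
Proof.
split.
- move=> fL; have := fL; rewrite inE => /andP[/[!inE]/= mf _]; split => //.
  have /integrableP[_] := Lfun2_integrable_sqr fL.
  apply: le_lt_trans; apply: ge0_le_integral => //.
  + by move=> x _; rewrite lee_fin sqr_ge0.
  + exact: measurable_sq.
  + by apply: measurableT_comp => //; exact: measurable_sq.
  + by move=> x _; rewrite /= ger0_norm ?sqr_ge0.
- move=> [mf ff]; rewrite inE; apply/andP; split; rewrite inE/=//.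
  rewrite /finite_norm unlock /Lnorm.
  by apply: poweR_lty; rewrite poweR_sqint.
Qed.

Lemma Lnorm2_lt f (e : R) : 0 < e -> (sqint f < (e ^+ 2)%:E)%E ->
  ('N[m]_2%:E[EFin \o f] < e%:E)%E.
Proof.
move=> e0 h; rewrite unlock /Lnorm poweR_sqint.
have -> : e%:E = ((e ^+ 2)%:E `^ 2^-1)%E.
  by rewrite poweR_EFin powR12_sqrt ?sqr_ge0// sqrtr_sqr gtr0_norm.
have fin : sqint f \is a fin_num by rewrite ge0_fin_numE ?sqint_ge0// (lt_trans h)// ltey.
rewrite -(fineK fin) !poweR_EFin lte_fin; apply: gt0_ltr_powR.
- by rewrite invr_gt0.
- by rewrite nnegrE fine_ge0// sqint_ge0.
- by rewrite nnegrE sqr_ge0.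
- by rewrite -lte_fin fineK.
Qed.

Lemma sqintZ a f : measurable_fun setT f ->
  sqint (fun x => a * f x) = ((a ^+ 2)%:E * sqint f)%E.
Proof.
move=> mf; rewrite /sqint -ge0_integralZl//=.
- by apply: eq_integral => x _; rewrite exprMn EFinM.
- exact: measurable_sq.
- by move=> x _; rewrite lee_fin sqr_ge0.
- by rewrite lee_fin sqr_ge0.
Qed.

Lemma le_sqint f g : measurable_fun setT f -> measurable_fun setT g ->
  (forall x, `|f x| <= `|g x|) -> (sqint f <= sqint g)%E.
Proof.
move=> mf mg fg; apply: ge0_le_integral => //.
- by move=> x _; rewrite lee_fin sqr_ge0.
- exact: measurable_sq.
- exact: measurable_sq.
- move=> x _; rewrite lee_fin -[f x ^+ 2]real_normK ?num_real//.
  by rewrite -[g x ^+ 2]real_normK ?num_real// lerXn2r ?nnegrE.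
Qed.

Lemma sqintD f g : measurable_fun setT f -> measurable_fun setT g ->
  (sqint (fun x => f x + g x)%R <= 2%:E * sqint f + 2%:E * sqint g)%E.
Proof.
move=> mf mg; rewrite /sqint -!ge0_integralZl//=; last 4 first.
- exact: measurable_sq.
- by move=> x _; rewrite lee_fin sqr_ge0.
- exact: measurable_sq.
- by move=> x _; rewrite lee_fin sqr_ge0.
rewrite -ge0_integralD//=; last 4 first.
- by move=> x _; rewrite lee_fin mulr_ge0// sqr_ge0.
- by apply: measurable_funeM; exact: measurable_sq.
- by move=> x _; rewrite lee_fin mulr_ge0// sqr_ge0.
- by apply: measurable_funeM; exact: measurable_sq.
apply: ge0_le_integral => //=.
- by move=> x _; rewrite lee_fin sqr_ge0.
- by apply: measurable_sq; exact: measurable_funD.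
- apply: emeasurable_funD; apply: measurable_funeM; exact: measurable_sq.
- move=> x _; rewrite -!EFinM -EFinD lee_fin.
  have := sqr_ge0 (f x - g x); nra.
Qed.

Lemma sqintBC f g : sqint (fun x => f x - g x) = sqint (fun x => g x - f x).
Proof. by apply: eq_integral => x _; rewrite -sqrrN opprB. Qed.

Lemma L2Z a f : L2 f -> L2 (fun x => a * f x).
Proof.
move=> [mf ff]; split; first exact: measurable_funM.
by rewrite sqintZ// lte_mul_pinfty// ?lee_fin ?sqr_ge0.
Qed.

Lemma L2D f g : L2 f -> L2 g -> L2 (fun x => f x + g x).
Proof.
move=> [mf ff] [mg gg]; split; first exact: measurable_funD.
apply: le_lt_trans (sqintD mf mg) _.
by rewrite lte_add_pinfty// lte_mul_pinfty.
Qed.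

Lemma L2B f g : L2 f -> L2 g -> L2 (fun x => f x - g x).
Proof.
move=> lf lg; rewrite (_ : (fun _ => _) = (fun x => f x + (-1) * g x)).
  by apply: L2D => //; exact: L2Z.
by apply/funext => x; rewrite mulN1r.
Qed.

Lemma L20 : L2 (fun=> 0).
Proof.
split => //; rewrite /sqint (eq_integral (cst 0%E)) ?integral0// => x _.
by rewrite expr0n.
Qed.

Lemma L2_dominated f g : measurable_fun setT f -> L2 g ->
  (forall x, `|f x| <= `|g x|) -> L2 f.
Proof. by move=> mf [mg gg] fg; split=> //; exact: le_lt_trans (le_sqint _ _ fg) gg. Qed.

Lemma L2_integrable f : L2 f -> m.-integrable setT (fun x => (f x ^+ 2)%:E).
Proof.
move=> [mf ff]; apply/integrableP; split; first exact: measurable_sq.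
by under eq_integral => x _ do rewrite gee0_abs ?lee_fin ?sqr_ge0//.
Qed.

(** Only integrability is asked for, so the crude bound [|f g| <= f^2 + g^2] does the work of
    Cauchy-Schwarz. *)
Lemma L2M f g : L2 f -> L2 g -> m.-integrable setT (fun x => (f x * g x)%:E).
Proof.
move=> lf lg; apply: (@le_integrable _ _ _ _ _ _ _ (fun x => (f x ^+ 2)%:E + (g x ^+ 2)%:E)%E) => //.
- by apply/measurable_EFinP; apply: measurable_funM; [case: lf|case: lg].
- move=> x _; rewrite /= lee_fin normrM [leRHS]ger0_norm ?addr_ge0 ?sqr_ge0//.
  rewrite -[f x ^+ 2]real_normK ?num_real// -[g x ^+ 2]real_normK ?num_real//.
  have := sqr_ge0 (`|f x| - `|g x|); have := normr_ge0 (f x).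
  have := normr_ge0 (g x); nra.
- by apply: integrableD => //; exact: L2_integrable.
Qed.

Lemma sqint_fin f : L2 f -> sqint f \is a fin_num.
Proof. by move=> [_ ?]; rewrite ge0_fin_numE// sqint_ge0. Qed.

Lemma ae_sqint f g : measurable_fun setT f -> measurable_fun setT g ->
  {ae m, forall x, f x = g x} -> sqint f = sqint g.
Proof.
move=> mf mg fg; apply: ge0_ae_eq_integral => //; try exact: measurable_sq.
- by move=> x _; rewrite lee_fin sqr_ge0.
- by move=> x _; rewrite lee_fin sqr_ge0.
- by apply: filterS fg => x /= -> _.
Qed.

End square_integrable.

(** * Completeness of [L^2] *)

Lemma limn_einf_le (R : realType) (u : (\bar R)^nat) (e : \bar R) (N : nat) :
  (forall n, (N <= n)%N -> (u n <= e)%E) -> (limn_einf u <= e)%E.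
Proof.
move=> ue; rewrite limn_einf_lim; apply: lime_le; first exact: is_cvg_einfs.
apply: nearW => n; apply: le_trans (ue (maxn n N) (leq_maxr _ _)).
by apply: ereal_inf_lbound; exists (maxn n N) => //=; exact: leq_maxl.
Qed.

Section riesz_fischer.
Context d (T : measurableType d) (R : realType).
Variable m : {measure set T -> \bar R}.

(* A subsequence with [sqint] increments at most [4^-k / 2] converges
   pointwise wherever [\sum_k 2^k d_k^2] is finite, since
   [|d_k| <= 2^-k + 2^k d_k^2]. *)
Lemma fast_cauchy_ae_cvg (v : nat -> T -> R) :
  (forall k, measurable_fun setT (v k)) ->
  (forall k, (sqint m (fun x => v k.+1 x - v k x)%R <= (1 / (2 ^ (k + k.+1))%:R)%:E)%E) ->
  exists2 A : set T, measurable A /\ {ae m, forall x, A x} &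
    forall x, A x -> cvgn (fun k => v k x).
Proof.
move=> mv vd.
pose t k x : \bar R := ((2 ^+ k) * (v k.+1 x - v k x) ^+ 2)%:E.
have t0 k x : (0 <= t k x)%E.
  by rewrite /t lee_fin; apply: mulr_ge0; [exact: exprn_ge0|exact: sqr_ge0].
have mt k : measurable_fun setT (t k).
  apply/measurable_EFinP; apply: measurable_funM => //.
  by apply: measurable_funX; exact: measurable_funB.
pose S x := (\sum_(0 <= k <oo) t k x)%E.
have S0 x : (0 <= S x)%E by apply: nneseries_ge0 => k _ _; exact: t0.
have mS : measurable_fun setT S by exact: ge0_emeasurable_sum.
have iS : (\int[m]_x S x < +oo)%E.
  rewrite /S integral_nneseries//.
  (* The integral of [t k] is at most [2^k * 2^-(2k+1) = 2^-(k+1)], and these bounds sum to 1. *)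
  have h : (\sum_(0 <= k <oo) (1 / (2 ^ (k + 1))%:R)%:E <= (1 : R)%:E)%E.
    have /cvg_lim := @cvg_geometric_eseries_half R 1 0.
    by rewrite expr0 divr1 => <-//.
  apply: le_lt_trans (ltey 1) => /=; apply: le_trans h.
  apply: lee_nneseries => [k _ _|k _]; first exact: integral_ge0.
  rewrite (_ : \int[m]_x t k x = (2 ^+ k)%:E * sqint m (fun x => v k.+1 x - v k x)%R)%E; last first.
    rewrite /sqint -ge0_integralZl//=.
    - by apply: measurable_sq; exact: measurable_funB.
    - by move=> x _; rewrite lee_fin sqr_ge0.
  apply: (@le_trans _ _ ((2 ^+ k)%:E * (1 / (2 ^ (k + k.+1))%:R)%:E)%E).
    by rewrite lee_pmul2l// lte_fin exprn_gt0.
  rewrite -EFinM lee_fin !div1r addn1 expnD natrM invfM mulrA !natrX.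
  by rewrite mulfV ?mul1r// expf_neq0.
have iS' : m.-integrable setT S.
  by apply/integrableP; split => //; under eq_integral => x _ do rewrite gee0_abs//.
exists [set x | S x \is a fin_num].
  split.
    rewrite -[X in measurable X]setTI.
    by have := emeasurable_fin_num measurableT mS.
  by have := integrable_ae measurableT iS'; apply: filterS => x /= /(_ I).
move=> x /= Sx.
have /cvg_ex[l vl] : cvgn (series (fun k => v k.+1 x - v k x)).
  apply: normed_cvg; apply: nondecreasing_is_cvgn.
    by apply: nondecreasing_series => k _ _; exact: normr_ge0.
  (* The 2 bounds the partial sums of [2^-k], and [fine (S x)] those of [2^k d_k^2]. *)
  exists (2 + fine (S x)) => _ [n _ <-] /=.
  rewrite /series/=.
  apply: (@le_trans _ _ (\sum_(0 <= k < n) (2^-1 ^+ k + 2 ^+ k * (v k.+1 x - v k x) ^+ 2))).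
    apply: ler_sum => k _.
    have p0 : (0 : R) < 2 ^+ k by rewrite exprn_gt0.
    set e := v k.+1 x - v k x.
    rewrite -[e ^+ 2]real_normK ?num_real//; have := normr_ge0 e.
    move: (`|e|) => a a0; rewrite exprVn.
    case: (leP a (2 ^+ k)^-1) => h.
      by rewrite ler_wpDr// mulr_ge0 ?sqr_ge0// ltW.
    rewrite ler_wpDl// ?invr_ge0 ?(ltW p0)// expr2 mulrA ler_peMl//.
    by rewrite mulrC -ler_pdivrMr// div1r ltW.
  rewrite big_split/=; apply: lerD.
    have -> : \sum_(0 <= k < n) 2^-1 ^+ k = (2 - 2 * 2^-1 ^+ n : R).
      elim: n => [|n IH]; first by rewrite big_nil expr0 mulr1 subrr.
      by rewrite big_nat_recr//= IH exprS mulrA mulfV ?mul1r//; ring.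
    by rewrite lerBlDr lerDl mulr_ge0// exprn_ge0// invr_ge0.
  rewrite -lee_fin fineK// -sumEFin.
  by apply: nneseries_lim_ge => k _ _; exact: t0.
apply/cvg_ex; exists (l + v 0%N x).
have -> : (fun k => v k x) = (fun k => series (fun k => v k.+1 x - v k x) k + v 0%N x).
  apply/funext => k; rewrite (_ : series _ k = v k x - v 0%N x) ?subrK//.
  by have := telescopeK (fun k => v k x) => /(congr1 (@^~ k)).
by apply: cvgD => //; exact: cvg_cst.
Qed.

(** A fast subsequence converges almost everywhere. Fatou's lemma, applied for fixed [n] to
    [(u n - u (s j))^2] as [j] grows, then turns the Cauchy bound into convergence of the whole
    sequence. *)
Lemma riesz_fischer (u : nat -> T -> R) :
  (forall n, L2 m (u n)) ->
  (forall e : R, 0 < e -> exists N, forall n k, (N <= n)%N -> (N <= k)%N ->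
     (sqint m (fun x => u n x - u k x)%R < e%:E)%E) ->
  exists2 f, L2 m f & forall e : R, 0 < e -> exists N, forall n, (N <= n)%N ->
     (sqint m (fun x => u n x - f x)%R <= e%:E)%E.
Proof.
move=> uL uC.
have mu n : measurable_fun setT (u n) by case: (uL n).
have e0 k : (0 : R) < 1 / (2 ^ (k + k.+1))%:R by rewrite divr_gt0// ltr0n expn_gt0.
pose N k := sval (cid (uC _ (e0 k))).
have NP k n p : (N k <= n)%N -> (N k <= p)%N ->
    (sqint m (fun x => u n x - u p x)%R < (1 / (2 ^ (k + k.+1))%:R)%:E)%E.
  by rewrite /N; case: cid => /= ? h; exact: h.
(* Summing the thresholds makes [s] monotone with [N k <= s k]; the extra summand [k] makes it tend
   to infinity. *)
pose s k := (k + \sum_(j < k.+1) N j)%N.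
have Ns k : (N k <= s k)%N by rewrite /s big_ord_recr/= addnA leq_addl.
have ss k : (s k <= s k.+1)%N.
  by rewrite /s [X in (_ <= _ + X)%N]big_ord_recr/= leq_add// leq_addr.
have ks k : (k <= s k)%N by rewrite /s leq_addr.
have [A [mA aeA] cA] := @fast_cauchy_ae_cvg (fun k => u (s k)) (fun k => mu (s k))
  (fun k => ltW (NP k _ _ (leq_trans (Ns k) (ss k)) (Ns k))).
(* Off the convergence set the sequence is replaced by 0, so that it converges everywhere and its
   limit is measurable; almost everywhere nothing changes. *)
pose w k x := \1_A x * u (s k) x.
have mw k : measurable_fun setT (w k) by apply: measurable_funM => //; exact: measurable_indic.
have wc x : cvgn (fun k => w k x).
  case: (pselect (A x)) => Ax.
    have -> : w ^~ x = (fun k => u (s k) x).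
      by apply/funext => k; rewrite /w indicE mem_set// mul1r.
    exact: cA.
  have -> : w ^~ x = (fun=> 0).
    by apply/funext => k; rewrite /w indicE memNset// mul0r.
  exact: is_cvg_cst.
pose f x := limn (w ^~ x).
have wf x : w k x @[k --> \oo] --> f x by exact: wc.
have mf : measurable_fun setT f by apply: measurable_fun_cvg mw _ => x _; exact: wf.
have key (e : R) : 0 < e -> exists N0, forall n, (N0 <= n)%N ->
     (sqint m (fun x => u n x - f x)%R <= e%:E)%E.
  move=> e_gt0; have [N0 N0P] := uC _ e_gt0; exists N0 => n N0n.
  have mg j : measurable_fun setT (fun x => ((u n x - w j x) ^+ 2)%:E).
    by apply: measurable_sq; exact: measurable_funB.
  have := @fatou _ _ _ m _ measurableT _ mg (fun j x _ => _).
  move=> /(_ (fun j x => (sqr_ge0 _))) fa.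
  have -> : sqint m (fun x => u n x - f x) =
      (\int[m]_x limn_einf (fun j => ((u n x - w j x) ^+ 2)%:E))%E.
    apply: eq_integral => x _.
    apply/esym; apply: (fst (cvg_limn_einf_sup _)).
    apply: cvg_EFin; first by apply: nearW.
    rewrite expr2; under eq_fun do rewrite /= expr2.
    have c : (u n x - w j x) @[j --> \oo] --> u n x - f x.
      by apply: cvgB; [exact: cvg_cst|exact: wf].
    exact: cvgM.
  apply: le_trans fa _; apply: (@limn_einf_le _ _ _ N0) => j N0j.
  rewrite (_ : integral _ _ _ = sqint m (fun x => u n x - u (s j) x)).
    by apply/ltW/N0P => //; exact: leq_trans (ks _).
  apply: ae_sqint => //; [exact: measurable_funB|exact: measurable_funB|].
  by apply: filterS aeA => x Ax; rewrite /w indicE mem_set// mul1r.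
exists f => //.
have [N0 /(_ N0 (leqnn _)) h] := key _ ltr01.
(* [f] is recovered as [u N0 - (u N0 - f)], a difference of two functions in [L2]. *)
have dL : L2 m (fun x => u N0 x - f x).
  by split; [exact: measurable_funB|exact: le_lt_trans h (ltey _)].
have := L2B (uL N0) dL; congr (L2 _ _); apply/funext => x.
by rewrite opprB addrC subrK.
Qed.

End riesz_fischer.

(** * Integration against a measure with a density *)

Section density.
Context d (T : measurableType d) (R : realType).
Variables (mu nu : {measure set T -> \bar R}) (h : T -> R).
Hypotheses (h0 : forall x, 0 <= h x) (mh : measurable_fun setT h).
Hypothesis nuE : forall A, measurable A -> nu A = (\int[mu]_(x in A) (h x)%:E)%E.
Local Open Scope ereal_scope.
Import HBNNSimple.

Let meh : measurable_fun setT (EFin \o h).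
Proof. exact/measurable_EFinP. Qed.

Let integral_density_nnsfun (g : {nnsfun T >-> R}) :
  \int[nu]_x (g x)%:E = \int[mu]_x ((g x)%:E * (h x)%:E).
Proof.
under [LHS]eq_integral do rewrite fimfunE -fsumEFin//.
rewrite [LHS]ge0_integral_fsum//; last 2 first.
  - by move=> r; exact/measurable_EFinP/measurableT_comp.
  - by move=> n x _; rewrite EFinM nnfun_muleindic_ge0.
transitivity (\int[mu]_x \sum_(k \in range g) ((k * \1_(g @^-1` [set k]) x)%:E * (h x)%:E)).
  rewrite ge0_integral_fsum//; last 2 first.
  - move=> r; apply: emeasurable_funM => //.
    by apply/measurable_EFinP; apply/measurableT_comp.
  - by move=> n x _; rewrite mule_ge0 ?lee_fin// -lee_fin EFinM nnfun_muleindic_ge0.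
  apply: eq_fsbigr => r rg.
  have r0 : (0 <= r)%R by move: rg; rewrite inE => -[x _ <-].
  have mr : measurable (g @^-1` [set r]) by [].
  under eq_integral do rewrite EFinM.
  rewrite ge0_integralZl//=; last exact/measurable_EFinP/measurable_indic.
  rewrite integral_indic// setIT nuE//.
  rewrite integral_mkcond -ge0_integralZl//; last 2 first.
  - apply/(measurable_restrictT _ mr); exact: measurable_funTS.
  - by move=> x _; rewrite erestrict_ge0// => y _; rewrite lee_fin.
  - apply: eq_integral => x _; rewrite EFinM -muleA; congr (_ * _).
    by rewrite patchE indicE; case: ifPn => _; rewrite ?mul1e ?mul0e.
apply: eq_integral => x _; rewrite fimfunE -fsumEFin// ge0_mule_fsuml// => k.
by rewrite EFinM nnfun_muleindic_ge0.
Qed.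

(** Simple functions first, then monotone convergence along [nnsfun_approx]. For [psi2dx] the
    hypothesis [nuE] is the definition of the measure. *)
Lemma ge0_integral_density (f : T -> \bar R) : measurable_fun setT f ->
  (forall x, 0 <= f x) -> \int[nu]_x f x = \int[mu]_x (f x * (h x)%:E).
Proof.
move=> mf f0; pose f_ := nnsfun_approx measurableT mf.
have mfn n : measurable_fun setT (EFin \o f_ n) by exact/measurable_EFinP/measurable_funTS.
transitivity (limn (fun n => \int[nu]_x (f_ n x)%:E)).
  rewrite -monotone_convergence//=.
  - by apply: eq_integral => x _; apply/esym/cvg_lim => //=; exact: cvg_nnsfun_approx.
  - by move=> n x _; rewrite lee_fin.
  - by move=> x _ a b ab; rewrite lee_fin//; exact/lefP/nd_nnsfun_approx.
rewrite (_ : (fun n => _) = fun n => \int[mu]_x ((f_ n x)%:E * (h x)%:E)); last first.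
  by apply/funext => n; exact: integral_density_nnsfun.
rewrite -monotone_convergence//=.
- apply: eq_integral => x _; apply/cvg_lim => //.
  by apply: cvgeZr => //; exact: cvg_nnsfun_approx.
- by move=> n; apply: emeasurable_funM => //; exact: mfn.
- by move=> n x _; rewrite mule_ge0// lee_fin.
- move=> x _ a b ab; rewrite lee_wpmul2r// lee_fin//.
  exact/lefP/nd_nnsfun_approx.
Qed.

(** As [h >= 0], multiplication by [h] commutes with positive and negative parts, and the
    nonnegative case applies to each. *)
Lemma integral_density (f : T -> R) : measurable_fun setT f ->
  \int[nu]_x (f x)%:E = \int[mu]_x (f x * h x)%:E.
Proof.
move=> mf; rewrite integralE [RHS]integralE.
have mef : measurable_fun setT (EFin \o f) by exact/measurable_EFinP.
rewrite !ge0_integral_density//; [|exact: measurable_funeneg|exact: measurable_funepos].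
congr (_ - _); apply: eq_integral => x _.
- by rewrite !funeposE -EFin_max -EFinM maxr_pMl// mul0r EFin_max.
- by rewrite !funenegE -!EFinN -!EFin_max -EFinM maxr_pMl// mul0r mulNr.
Qed.

End density.
(** * Compactly supported functions and Borel sets of [R^3] *)

Section R3_topology.
Context {R : realType}.
Implicit Types (x y : R3 R) (f : R3 R -> R) (N e : R).

Lemma norm3_le x N : (`|x| <= N) = [&& `|x.1.1| <= N, `|x.1.2| <= N & `|x.2| <= N].
Proof. by rewrite prod_normE ge_max prod_normE ge_max andbA. Qed.

Lemma norm3_lt x N : (`|x| < N) = [&& `|x.1.1| < N, `|x.1.2| < N & `|x.2| < N].
Proof. by rewrite prod_normE gt_max prod_normE gt_max andbA. Qed.

Definition box N : set (R3 R) := [set x | `|x| <= N].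

Lemma boxE N : box N = (`[- N, N] `*` `[- N, N]) `*` `[- N, N].
Proof.
apply/seteqP; split => x /=; rewrite /box/= norm3_le !ler_norml !in_itv/=.
  by move=> /and3P[-> -> ->].
by move=> [[-> ->] ->].
Qed.

Lemma compact_box N : compact (box N).
Proof.
rewrite boxE; apply: compact_setX; last exact: segment_compact.
by apply: compact_setX; exact: segment_compact.
Qed.

Lemma closed_box N : closed (box N).
Proof. by apply: compact_closed (@compact_box N); exact: norm_hausdorff. Qed.

Lemma compact_sub_box (K : set (R3 R)) : compact K ->
  exists2 N, 0 < N & K `<=` box N.
Proof.
move=> /compact_bounded[M [_ h]]; exists (`|M| + 1).
  by rewrite ltr_wpDl.
by move=> x Kx; apply: h => //; rewrite (le_lt_trans (ler_norm _))// ltrDl.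
Qed.

(** Compact support with an explicit radius in the sup norm. Supports are tracked in this form
    because radii add under convolution and integrals reduce to a [box]. *)
Definition vanish N f := forall x, N < `|x| -> f x = 0.

Lemma vanish_compact N f : vanish N f -> compactly_supported f.
Proof.
move=> fN; rewrite /compactly_supported.
apply: (subclosed_compact _ (@compact_box N)); first exact: closed_closure.
apply: (subset_trans (closure_subset _)) (_ : closure (box N) `<=` _).
  by move=> x /= fx; rewrite /box/= leNgt; apply/negP => /fN /eqP; apply/negP.
by rewrite -(closure_id _).1//; exact: closed_box.
Qed.

Lemma compact_vanish f : compactly_supported f -> exists2 N, 0 < N & vanish N f.
Proof.
move=> /compact_sub_box[N N0 h]; exists N => // x Nx.
apply/eqP/negPn/negP => fx; move: Nx; rewrite ltNge => /negP; apply.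
by apply: h; apply: subset_closure.
Qed.

Lemma continuous_bounded_box f N : continuous f ->
  exists2 M, 0 < M & forall x, `|x| <= N -> `|f x| <= M.
Proof.
move=> cf.
have : compact (f @` box N).
  by apply: continuous_compact (@compact_box N); exact: continuous_subspaceT.
move=> /compact_bounded[M [_ h]]; exists (`|M| + 1); first by rewrite ltr_wpDl.
move=> x xN; apply: h; first by rewrite (le_lt_trans (ler_norm _))// ltrDl.
by exists x.
Qed.

Lemma continuous_vanish_bounded f N : continuous f -> vanish N f ->
  exists2 M, 0 < M & forall x, `|f x| <= M.
Proof.
move=> cf fN; have [M M0 h] := continuous_bounded_box N cf.
exists M => // x; case: (lerP `|x| N) => xN; first exact: h.
by rewrite fN// normr0 ltW.
Qed.

Lemma vanish_unif_continuous f N : continuous f -> vanish N f ->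
  forall e, 0 < e -> exists2 d, 0 < d & forall x y, `|x - y| < d -> `|f x - f y| < e.
Proof.
move=> cf fN e e0.
have /compact_near_coveringP := @compact_box N.
(* The covering form of compactness, applied to the filter of small [d > 0], extracts one [d] valid
   at all points of the box. *)
move=> /(_ R (0^'+) (fun d x => forall y, `|x - y| < d -> `|f x - f y| < e)).
move=> /(_ _)[|d0 /= d00 hd0].
  move=> x _; have /cvgrPdist_lt/(_ (e / 2) (divr_gt0 e0 (ltr0n _ 2))) := cf x.
  move=> /nbhs_ballP[r /= r0 hr].
  (* If [z] is within [r / 2] of [x] and [y] within [d < r / 2] of [z], both lie in the ball of
     radius [r] around [x]. *)
  exists (ball x (r / 2), [set d | 0 < d < r / 2]) => /=.
    split; first by apply: nbhsx_ballx; rewrite divr_gt0.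
    exists (r / 2) => /=; first by rewrite divr_gt0.
    by move=> d /=; rewrite sub0r normrN => + d1; rewrite gtr0_norm// d1.
  move=> [z d] /= [+ /andP[d1 dr]] y zy; rewrite -ball_normE/= => xz.
  have -> : f z - f y = - (f x - f z) + (f x - f y) by rewrite opprB addrA subrK.
  rewrite (le_lt_trans (ler_normD _ _))// normrN (splitr e) ltrD//; apply: hr.
    by rewrite -ball_normE/= (lt_trans xz)// ltr_pdivrMr// ltr_pMr// ltr1n.
  rewrite -ball_normE/= -[x](subrK z) -addrA (le_lt_trans (ler_normD _ _))//.
  by rewrite (splitr r) ltrD// (lt_trans zy).
have d02 : 0 < d0 / 2 by rewrite divr_gt0.
exists (d0 / 2) => // x y xy.
have key : box N `<=` [set x | forall y, `|x - y| < d0 / 2 -> `|f x - f y| < e].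
  apply: hd0 => //=.
  by rewrite sub0r normrN gtr0_norm// ltr_pdivrMr// ltr_pMr// ltr1n.
case: (lerP `|x| N) => xN; first exact: key.
case: (lerP `|y| N) => yN; first by rewrite distrC; apply: key => //; rewrite distrC.
by rewrite !fN// subrr normr0.
Qed.

(** The topology is a product topology and the sigma-algebra a product of Borel ones. They meet
    because [U] is a countable union of cubes with rational centres and radii [1 / (n + 1)], and
    such cubes are measurable rectangles. *)
Lemma open_measurable3 (U : set (R3 R)) : open U -> measurable (U : set (mR3 R)).
Proof.
move=> oU.
pose B (q : rat * rat * rat * nat) : set (mR3 R) :=
  [set x | `|((ratr q.1.1.1, ratr q.1.1.2), ratr q.1.2) - x| < q.2.+1%:R^-1].
pose F q : set (mR3 R) := if `[< B q `<=` U >] then B q else set0.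
have -> : U = \bigcup_q F q.
  apply/seteqP; split => [x Ux|x [q _]]; last first.
    by rewrite /F; case: asboolP => // h; exact: h.
  have /nbhs_ballP[e /= e0 eU] : nbhs x U by apply: open_nbhs_nbhs.
  (* The radius [1 / (n + 1)] is below [e / 2], so a cube of this size containing [x] stays within
     [e] of [x]. *)
  pose n := Num.truncn (2 * e^-1).
  have ne : n.+1%:R^-1 < e / 2.
    rewrite -[e / 2]invrK ltf_pV2 ?posrE ?invr_gt0 ?divr_gt0// invfM invrK mulrC.
    by rewrite truncnS_gt// mulr_ge0// invr_ge0 ltW.
  have n0 : (0 : R) < n.+1%:R^-1 by rewrite invr_gt0.
  have rt (a : R) : exists q, `|ratr q - a| < n.+1%:R^-1.
    have [|q] := @rat_in_itvoo R a (a + n.+1%:R^-1); first by rewrite ltrDl.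
    rewrite in_itv/= => /andP[q1 q2]; exists q.
    by rewrite gtr0_norm ?subr_gt0// ltrBlDl.
  have [[q1 h1] [[q2 h2] [q3 h3]]] := (rt x.1.1, (rt x.1.2, rt x.2)).
  exists (q1, q2, q3, n) => //.
  have Bx : B (q1, q2, q3, n) x by rewrite /B/= norm3_lt/= h1 h2 h3.
  rewrite /F asboolT// => y By; apply: eU.
  rewrite -ball_normE/=.
  have -> : x - y = - ((ratr q1, ratr q2, ratr q3) - x) + ((ratr q1, ratr q2, ratr q3) - y).
    by rewrite opprB addrA subrK.
  rewrite (le_lt_trans (ler_normD _ _))// normrN (splitr e) ltrD//.
    by apply: lt_trans ne; exact: Bx.
  by apply: lt_trans ne; exact: By.
apply: countable_bigcupT_measurable => // q.
rewrite /F; case: ifPn => _ //.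
have -> : B q = (ball (ratr q.1.1.1 : R) q.2.+1%:R^-1 `*` ball (ratr q.1.1.2 : R) q.2.+1%:R^-1)
    `*` ball (ratr q.1.2 : R) q.2.+1%:R^-1.
  rewrite -!ball_normE; apply/seteqP; split => x /=; rewrite /B/= norm3_lt/=.
    by move=> /and3P[-> -> ->].
  by move=> [[-> ->] ->].
by apply: measurableX; [apply: measurableX|]; exact: measurable_ball.
Qed.

Lemma closed_measurable3 (U : set (R3 R)) : closed U -> measurable (U : set (mR3 R)).
Proof.
move=> cU; rewrite -[U]setCK; apply: measurableC.
by apply: open_measurable3; rewrite openC.
Qed.

Lemma continuous_measurable3 f : continuous f -> measurable_fun [set: mR3 R] f.
Proof.
move=> /continuousP cf; apply: (measurability _ (RGenOpens.measurableE R)).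
move=> _ [_ [a [b ->]] <-]; rewrite setTI; apply: open_measurable3.
by apply: cf; exact: interval_open.
Qed.

Lemma measurable_box N : measurable (box N : set (mR3 R)).
Proof. by apply: closed_measurable3; exact: closed_box. Qed.

Lemma leb3_box N : 0 <= N -> leb3 (box N) = ((2 * N) ^+ 3)%:E.
Proof.
move=> N0; have l1 : lebesgue_measure (`[- N, N] : set R) = (2 * N)%:E.
  rewrite lebesgue_measure_itv/= lte_fin.
  by case: ltP => h; rewrite -?EFinB; congr EFin; lra.
rewrite boxE /leb3.
rewrite [LHS]product_measure1E//; last by apply: measurableX.
rewrite -[X in (X * _)%E]/((@lebesgue_measure R \x @lebesgue_measure R)%E (`[- N, N] `*` `[- N, N])).
rewrite product_measure1E//= l1 -!EFinM; congr EFin; ring.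
Qed.

End R3_topology.

(** * Approximation of indicators by continuous functions *)

Lemma distr_max (R : realDomainType) (a b c d : R) :
  `|Num.max a b - Num.max c d| <= `|a - c| + `|b - d|.
Proof.
have h (u v : R) : u - v <= `|u - v| by exact: ler_norm.
have h' (u v : R) : v - u <= `|u - v| by rewrite distrC.
move: (h a c) (h' a c) (h b d) (h' b d) (normr_ge0 (a - c)) (normr_ge0 (b - d)).
move: (`|a - c|) (`|b - d|) => p q.
by rewrite ler_norml; case: (leP a b) => ?; case: (leP c d) => *; apply/andP; split; lra.
Qed.

Section indicator_approximation.
Context {R : realType}.
Variables (mu : {measure set (mR3 R) -> \bar R}) (w : R3 R -> R).
Hypotheses (w0 : forall x, 0 <= w x) (iw : mu.-integrable setT (EFin \o w)).

Let mw : measurable_fun [set: mR3 R] w.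
Proof. by case/integrableP: iw => /measurable_EFinP. Qed.

(** The [L^1] distance of the finite measure [w dmu]. It is used with [w = |g| chi] for the
    uniqueness of weak derivatives and with [w = chi psi^2] for the density of [Cc], where [chi] is
    a cutoff. *)
Definition wdist (f g : R3 R -> R) : \bar R := (\int[mu]_x (`|f x - g x| * w x)%:E)%E.

Let mwd (f g : R3 R -> R) : measurable_fun [set: mR3 R] f -> measurable_fun [set: mR3 R] g ->
  measurable_fun [set: mR3 R] (fun x => (`|f x - g x| * w x)%:E).
Proof.
move=> mf mg; apply/measurable_EFinP; apply: measurable_funM => //.
by apply: measurableT_comp => //; exact: measurable_funB.
Qed.

Lemma wdist_triangle (f g h : R3 R -> R) : measurable_fun [set: mR3 R] f ->
  measurable_fun [set: mR3 R] g -> measurable_fun [set: mR3 R] h ->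
  (wdist f h <= wdist f g + wdist g h)%E.
Proof.
move=> mf mg mh; rewrite -ge0_integralD//=; last 4 first.
- by move=> x _; rewrite lee_fin mulr_ge0.
- exact: mwd.
- by move=> x _; rewrite lee_fin mulr_ge0.
- exact: mwd.
apply: ge0_le_integral => //=.
- by move=> x _; rewrite lee_fin mulr_ge0.
- exact: mwd.
- by apply: emeasurable_funD; exact: mwd.
- by move=> x _; rewrite -EFinD lee_fin -mulrDl ler_wpM2r// ler_distD.
Qed.

Lemma wdist_dominated (h : nat -> R3 R -> R) (f : R3 R -> R) :
  (forall n, measurable_fun [set: mR3 R] (h n)) -> measurable_fun [set: mR3 R] f ->
  (forall n x, `|h n x - f x| <= 1) ->
  (forall x, h n x @[n --> \oo] --> f x) ->
  forall e : R, 0 < e -> exists n, (wdist (h n) f < e%:E)%E.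
Proof.
move=> mh mf h1 hf e e0.
pose g n (x : mR3 R) := (`|h n x - f x| * w x)%:E.
have gc (x : mR3 R) : g n x @[n --> \oo] --> 0%E.
  apply: cvg_EFin; first exact: nearW.
  rewrite /= -(mul0r (w x)); apply: cvgMl.
  rewrite -(normr0 R) -(subrr (f x)); apply: cvg_norm; apply: cvgB => //.
  exact: cvg_cst.
have [_ _ gg] : [/\ mu.-integrable setT (cst 0%E), [sequence (\int[mu]_x `|g n x - cst 0 x|)%E]_n @ \oo --> 0%E
    & [sequence (\int[mu]_x g n x)%E]_n @ \oo --> (\int[mu]_x cst 0 x)%E].
  apply: (dominated_convergence measurableT) iw _ => //.
  - by move=> n; exact: mwd.
  - by apply/aeW => x _; exact: gc.
  - apply/aeW => x n _ /=; rewrite lee_fin ger0_norm ?mulr_ge0//.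
    by rewrite ler_piMl.
rewrite integral0 in gg.
have /fine_cvgP[] := gg.
move=> fin /cvgrPdist_lt/(_ _ e0) lt.
near \oo => n; exists n.
have fn : (wdist (h n) f) \is a fin_num by near: n.
rewrite -(fineK fn) lte_fin.
have : `|0 - fine (wdist (h n) f)| < e by near: n.
rewrite sub0r normrN; apply: le_lt_trans; exact: ler_norm.
Unshelve. all: by end_near.
Qed.

Definition approximable (A : set (mR3 R)) := measurable A /\
  forall e : R, 0 < e -> exists f : R3 R -> R, [/\ continuous f,
    forall x, 0 <= f x <= 1 & (wdist \1_A f < e%:E)%E].

Lemma approximableC A : approximable A -> approximable (~` A).
Proof.
move=> [mA h]; split; first exact: measurableC.
move=> e /h[f [cf f01 fe]]; exists (fun x => 1 - f x); split.
- by move=> x; apply: cvgB; [exact: cvg_cst|exact: cf].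
- by move=> x; have /andP[] := f01 x => *; apply/andP; split; lra.
- rewrite (_ : wdist _ _ = wdist \1_A f)//; apply: eq_integral => x _.
  rewrite distrC !indicE in_setC; congr EFin; congr (_ * _).
  by case: (x \in A) => /=; congr `|_|; lra.
Qed.

Lemma approximableU A B : approximable A -> approximable B -> approximable (A `|` B).
Proof.
move=> [mA hA] [mB hB]; split; first exact: measurableU.
move=> e e0; have e2 : 0 < e / 2 by rewrite divr_gt0.
have [f [cf f01 fe]] := hA _ e2; have [g [cg g01 ge]] := hB _ e2.
exists (fun x => Num.max (f x) (g x)); split.
- by move=> x; apply: continuous_max; [exact: cf|exact: cg].
- move=> x; have /andP[? ?] := f01 x; have /andP[? ?] := g01 x.
  by rewrite le_max ge_max; do !(apply/andP; split) => //; apply/orP; left.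
- rewrite (splitr e) EFinD; apply: le_lt_trans (lteD fe ge).
  have mf := continuous_measurable3 cf; have mg := continuous_measurable3 cg.
  rewrite -ge0_integralD//=; last 4 first.
  + by move=> x _; rewrite lee_fin mulr_ge0.
  + by apply: mwd => //; exact: measurable_indic.
  + by move=> x _; rewrite lee_fin mulr_ge0.
  + by apply: mwd => //; exact: measurable_indic.
  apply: ge0_le_integral => //=.
  + by move=> x _; rewrite lee_fin mulr_ge0.
  + apply: mwd => //; first by apply: measurable_indic; exact: measurableU.
    exact: measurable_maxr.
  + by apply: emeasurable_funD; apply: mwd => //; exact: measurable_indic.
  + move=> x _; rewrite -EFinD lee_fin -mulrDl ler_wpM2r//.
    have /andP[? ?] := f01 x; have /andP[? ?] := g01 x.
    rewrite !indicE in_setU.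
    set a : R := (x \in A)%:R; set b : R := (x \in B)%:R.
    have -> : ((x \in A) || (x \in B))%:R = Num.max a b.
      rewrite /a /b; case: (x \in A); case: (x \in B); rewrite /= ?maxxx//.
        by rewrite max_l.
      by rewrite max_r.
    exact: distr_max.
Qed.

(** The finite unions increase to the whole one, so by dominated convergence, with [w] as the bound,
    one of them is within [e / 2]; finite unions are handled by maxima. *)
Lemma approximable_bigcup (F : nat -> set (mR3 R)) :
  (forall n, approximable (F n)) -> approximable (\bigcup_n F n).
Proof.
move=> hF; split; first by apply: bigcup_measurable => n _; case: (hF n).
move=> e e0; have e2 : 0 < e / 2 by rewrite divr_gt0.
pose U n := \big[setU/set0]_(i < n.+1) F i.
have hU n : approximable (U n).
  rewrite /U; elim: n => [|n IH]; first by rewrite big_ord_recl big_ord0 setU0.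
  by rewrite big_ord_recr/=; apply: approximableU.
have mU n : measurable (U n) by case: (hU n).
have mUF : measurable (\bigcup_n F n) by apply: bigcup_measurable => n _; case: (hF n).
have [n nP] : exists n, (wdist \1_(U n) \1_(\bigcup_n F n) < (e / 2)%:E)%E.
  apply: wdist_dominated => //.
  - by move=> n x; rewrite !indicE; do 2 case: (_ \in _); rewrite ?subrr ?subr0 ?sub0r ?normrN ?normr1 ?normr0.
  - move=> x; case: (pselect ((\bigcup_n F n) x)) => [Fx|nFx].
      have [k _ Fkx] := Fx.
      apply: cvg_near_cst; exists k => //= n kn; rewrite !indicE !mem_set//.
      by rewrite /U -bigcup_mkord; exists k.
    apply: cvg_near_cst; apply: nearW => n; rewrite !indicE !memNset//.
    by rewrite /U -bigcup_mkord => -[k _ Fk]; apply: nFx; exists k.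
have [f [cf f01 fe]] := (hU n).2 _ e2.
exists f; split => //; rewrite (splitr e) EFinD.
apply: le_lt_trans (lteD nP fe).
have -> : wdist \1_(U n) \1_(\bigcup_n F n) = wdist \1_(\bigcup_n F n) \1_(U n).
  by apply: eq_integral => x _; rewrite distrC.
by apply: wdist_triangle => //; exact: continuous_measurable3.
Qed.

Lemma approximable_halfspace (p : R3 R -> R) (a : R) : continuous p ->
  approximable [set x | a < p x].
Proof.
move=> cp.
have mp := continuous_measurable3 cp.
have mA : measurable ([set x | a < p x] : set (mR3 R)).
  have := mp measurableT _ (measurable_itv `]a, +oo[); rewrite setTI.
  by congr measurable; apply/seteqP; split => x /=; rewrite in_itv/= andbT.
pose A : set (mR3 R) := [set x | a < p x].
split => // e e0.
(* A ramp of slope [n] in [p]: it tends to 1 where [a < p x] and is 0 elsewhere. *)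
pose h (n : nat) (x : R3 R) := Num.min 1 (Num.max 0 (n%:R * (p x - a))).
have ch n : continuous (h n).
  move=> x; apply: (@continuous_min _ _ (fun=> 1) (fun x => Num.max 0 (n%:R * (p x - a)))).
    exact: cst_continuous.
  apply: (@continuous_max _ _ (fun=> 0) (fun x => n%:R * (p x - a))).
    exact: cst_continuous.
  by apply: cvgM; [exact: cvg_cst|apply: cvgB; [exact: cp|exact: cvg_cst]].
have h01 n x : 0 <= h n x <= 1.
  by rewrite /h le_min ge_min le_max lexx ler01/= lexx.
have [n nP] : exists n, (wdist (h n) \1_A < e%:E)%E.
  apply: wdist_dominated => //.
  - by move=> n; exact: continuous_measurable3.
  - move=> n x; have /andP[? ?] := h01 n x; rewrite indicE.
    by case: (_ \in _); case: ler0P => ? /=; lra.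
  - move=> x; case: (ltP a (p x)) => pa.
      rewrite indicE mem_set//; apply: cvg_near_cst.
      have pa0 : 0 < p x - a by rewrite subr_gt0.
      near=> n; rewrite /h; apply/eqP; rewrite eq_le ge_min lexx/= le_min lexx/= le_max.
      apply/orP; right; rewrite -ler_pdivrMr// div1r.
      by near: n; exact: nbhs_infty_ger.
    rewrite indicE memNset//=; last by rewrite /A/=; apply/negP; rewrite -leNgt.
    apply: cvg_near_cst; apply: nearW => n; rewrite /h max_l ?min_r//.
    by rewrite mulr_ge0_le0// subr_le0.
exists (h n); split => //.
rewrite (_ : wdist _ _ = wdist (h n) \1_A)//.
by apply: eq_integral => x _; rewrite distrC.
Unshelve. all: by end_near.
Qed.

(** The approximable sets form a sigma-algebra that contains the open half-spaces of the three
    coordinates, and these generate the measurable sets. *)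
Lemma measurable_approximable (A : set (mR3 R)) : measurable A -> approximable A.
Proof.
have sC : sigma_algebra setT approximable.
  split.
  - split => // e e0; exists (fun=> 0); split.
    + exact: cst_continuous.
    + by move=> x; rewrite lexx ler01.
    + rewrite /wdist; under eq_integral => x _ do rewrite indic0 subrr normr0 mul0r.
      by rewrite integral0 lte_fin.
  - by move=> B ?; rewrite setTD; exact: approximableC.
  - exact: approximable_bigcup.
(* Give the source the sigma-algebra of approximable sets. The identity into [mR3 R] is measurable
   because its coordinates are, so [A], its own preimage, is approximable. *)
pose S := g_sigma_algebraType (approximable : set (set (mR3 R))).
have coord (p : S -> measurableTypeR R) : continuous (p : R3 R -> R) -> measurable_fun [set: S] p.
  move=> cp; apply: (measurability _ (RGenOInfty.measurableE R)).
  move=> _ [_ [a ->] <-]; rewrite setTI; apply: sub_sigma_algebra.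
  have := approximable_halfspace a cp.
  by congr approximable; apply/seteqP; split => x /=; rewrite in_itv/= andbT.
have mid : measurable_fun [set: S] (id : S -> mR3 R).
  apply/measurable_fun_pairP; split.
    apply/measurable_fun_pairP; split; apply: coord => x.
      by apply: continuous_comp; exact: cvg_fst.
    by apply: continuous_comp; [exact: cvg_fst|exact: cvg_snd].
  by apply: coord => x; exact: cvg_snd.
move=> mA; rewrite -(sigma_algebra_id sC) -[A]setTI.
exact: mid.
Qed.

End indicator_approximation.
(** * Smooth functions and mollifiers *)

Section derivatives.
Context {R : realType}.

(** Both difference quotients are the same function of [h]. One-variable results such as the chain
    rule and the mean value theorem thus apply to partial derivatives. *)
Lemma is_derive_line (f : R3 R -> R) (x v : R3 R) (t l : R) :
  is_derive (t *: v + x) v f l <-> is_derive t 1 (fun h : R => f (h *: v + x)) l.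
Proof.
have E : (fun h : R => h^-1 *: ((f \o shift (t *: v + x)) (h *: v) - f (t *: v + x))) =
  (fun h : R => h^-1 *: (((fun h : R => f (h *: v + x)) \o shift t) (h *: 1) - f (t *: v + x))).
  apply/funext => h /=; congr (_ *: (f _ - _)).
  by rewrite /shift/= -[h *: 1]/(h * 1) mulr1 scalerDl addrA.
split => -[/= d <-]; apply: DeriveDef.
- by move: d; rewrite /derivable E.
- by rewrite /derive E.
- by rewrite /derivable E.
- by rewrite /derive E.
Qed.

(** Meant for points where the usual rules fail: [flat k] at 0 and, through its Taylor remainder,
    [sqpos]. *)
Lemma is_derive0_sq (f : R -> R) (C : R) : (forall h, `|f h| <= C * h ^+ 2) ->
  is_derive (0 : R) (1 : R) f 0.
Proof.
move=> fC.
have f0 : f 0 = 0.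
  by apply/eqP; rewrite -normr_le0; have := fC 0; rewrite expr0n/= mulr0.
have C0 : 0 <= C.
  by have := fC 1; rewrite expr1n mulr1; apply: le_trans.
have lim0 : h^-1 *: ((f \o shift 0) (h *: (1 : R)) - f 0) @[h --> (0 : R)^'] --> (0 : R).
  apply/cvgr0Pnorm_lt => e e0.
  have eC : 0 < e / (C + 1) by rewrite divr_gt0// ltr_wpDl.
  near=> h => /=.
  have h0 : h != 0 by near: h; exact: nbhs_dnbhs_neq.
  have he : `|h| < e / (C + 1).
    by near: h; apply: dnbhs0_lt.
  rewrite f0 subr0 /shift/= addr0 -[h *: 1]/(h * 1) mulr1 normrM normfV.
  rewrite mulrC ltr_pdivrMr ?normr_gt0//.
  apply: (le_lt_trans (fC h)); rewrite -[h ^+ 2]real_normK ?num_real// expr2 mulrA.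
  rewrite ltr_pM2r ?normr_gt0//.
  apply: (@le_lt_trans _ _ ((C + 1) * `|h|)); first by rewrite ler_wpM2r// lerDl.
  by rewrite mulrC -ltr_pdivlMr// ltr_wpDl.
by apply: DeriveDef; [apply/cvg_ex; exists 0|exact: cvg_lim lim0].
Unshelve. all: by end_near. Qed.

Lemma is_derive1_continuous (f : R -> R) (x l : R) :
  is_derive x 1 f l -> {for x, continuous f}.
Proof. by move=> [df _]; apply: differentiable_continuous; exact/derivable1_diffP. Qed.

(** The exponent [k] makes the family [s^-k exp(-1/s)] closed under differentiation up to linear
    combinations, so that [flat_coord_Ck] is an induction on the order with [k] arbitrary. *)
Definition flat (k : nat) (s : R) : R :=
  if 0 < s then s^-1 ^+ k * expR (- s^-1) else 0.

Lemma flat_ge0 k s : 0 <= flat k s.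
Proof.
rewrite /flat; case: ifPn => // s0.
by rewrite mulr_ge0 ?expR_ge0// exprn_ge0// invr_ge0 ltW.
Qed.

Lemma flat_le_sq k s : flat k s <= k.+2`!%:R * s ^+ 2.
Proof.
rewrite /flat; case: ifPn => [s0|_]; last by rewrite mulr_ge0// sqr_ge0.
have y0 : 0 < s^-1 by rewrite invr_gt0.
rewrite -[X in _ * X ^+ 2]invrK; move: (s^-1) y0 => y y0.
(* With [y = 1 / s], a single term of the exponential series gives [y^(k+2) / (k+2)! <= exp y]. *)
have /le_trans h := expR_ge1Dxn k.+1 (ltW y0).
rewrite expRN ler_pdivrMr ?expR_gt0//.
have {h} : y ^+ k.+2 / k.+2`!%:R <= expR y.
  by apply: le_trans (h _ (lexx _)); rewrite lerDr.
rewrite ler_pdivrMr ?ltr0n ?fact_gt0// => h.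
have -> : y ^+ k = y^-1 ^+ 2 * y ^+ k.+2.
  by rewrite -(addn2 k) exprD mulrCA -exprMn mulVf ?expr1n ?mulr1// gt_eqF.
rewrite [leRHS](_ : _ = y^-1 ^+ 2 * (expR y * k.+2`!%:R)); last by ring.
by rewrite ler_wpM2l// sqr_ge0.
Qed.

Lemma flat_is_derive k (s : R) :
  is_derive s 1 (flat k) (flat k.+2 s - k%:R * flat k.+1 s).
Proof.
case: (ltgtP 0 s) => [s0|s0|s0].
- apply: (@near_eq_is_derive _ _ _ ((fun x => x^-1) ^+ k * (expR \o (fun x => - x^-1)))).
    near=> x; rewrite /flat; have -> : 0 < x by near: x; exact: lt_nbhsr.
    by rewrite /= -[(_ * _) x]/(_ * _); congr (_ * _); rewrite fctE.
  have dV : is_derive s 1 (fun x : R => x^-1) (- s ^- 2 *: 1).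
    by apply: is_deriveV; rewrite gt_eqF.
  have dNV : is_derive s 1 (fun x : R => - x^-1) (- (- s ^- 2 *: 1)) by exact: is_deriveN.
  have dE := @is_derive1_comp R expR (fun x => - x^-1) s _ _ (is_derive_expR _) dNV.
  have D := is_deriveM (is_deriveX k dV) dE.
  apply: (is_derive_eq D).
  rewrite /flat s0 /= -![_ *: _]/(_ * _) !mulr1 fctE.
  rewrite -exprVn; move: (s^-1) (expR _) => y E {D}.
  by case: k => [|k] /=; rewrite ?exprS ?expr0; ring.
- apply: (@near_eq_is_derive _ _ _ (cst 0)).
    near=> x; rewrite /flat; have x0 : x < 0 by near: x; exact: lt_nbhsl.
    by rewrite ltNge ltW.
  by rewrite /flat !ltNge ltW// mulr0 subr0; exact: is_derive_cst.
- rewrite -s0 /flat ltxx mulr0 subr0; apply: (@is_derive0_sq _ (k.+2)`!%:R) => h.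
  by rewrite ger0_norm ?flat_ge0//; exact: flat_le_sq.
Unshelve. all: by end_near. Qed.

End derivatives.
Section Ck_functions.
Context {R : realType}.
Implicit Types (f g : R3 R -> R) (k n : nat) (x : R3 R).

Lemma Ck_continuous k f : Ck k f -> continuous f.
Proof. by case: k => [//|k] []. Qed.

Lemma CkS k f : Ck k.+1 f -> Ck k f.
Proof.
elim: k f => [|k IH] f [cf df]; first exact: cf.
by split => // i; have [? ?] := df i; split => //; exact: IH.
Qed.

Lemma CkS_derivable k f i : Ck k.+1 f -> forall x, derivable f x (e3 i).
Proof. by case=> _ /(_ i)[]. Qed.

Lemma CkS_derive k f i : Ck k.+1 f -> Ck k ('D_(e3 i) f).
Proof. by case=> _ /(_ i)[]. Qed.

Lemma Ck_is_derive k f (df : 'I_3 -> R3 R -> R) : continuous f ->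
  (forall i x, is_derive x (e3 i) f (df i x)) -> (forall i, Ck k (df i)) -> Ck k.+1 f.
Proof.
move=> cf h Cdf; split => // i; split; first by move=> x; case: (h i x).
rewrite (_ : 'D_(e3 i) f = df i); first exact: Cdf.
by apply/funext => x; case: (h i x).
Qed.

Lemma Ck_cst k (c : R) : Ck k (fun=> c).
Proof.
elim: k c => [|k IH] c; first exact: cst_continuous.
apply: (Ck_is_derive (df := fun _ _ => 0))  => //; exact: cst_continuous.
Qed.

Lemma CkD k f g : Ck k f -> Ck k g -> Ck k (fun x => f x + g x).
Proof.
elim: k f g => [|k IH] f g Cf Cg; first by move=> x; apply: cvgD; [exact: Cf|exact: Cg].
apply: (Ck_is_derive (df := fun i x => 'D_(e3 i) f x + 'D_(e3 i) g x)).
- by move=> x; apply: cvgD; [exact: Ck_continuous Cf _|exact: Ck_continuous Cg _].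
- move=> i x; apply: (@is_deriveD _ _ _ f g); apply: derivableP.
    exact: CkS_derivable Cf _.
  exact: CkS_derivable Cg _.
- by move=> i; apply: IH; [exact: CkS_derive Cf|exact: CkS_derive Cg].
Qed.

Lemma CkM k f g : Ck k f -> Ck k g -> Ck k (fun x => f x * g x).
Proof.
elim: k f g => [|k IH] f g Cf Cg; first by move=> x; apply: cvgM; [exact: Cf|exact: Cg].
apply: (Ck_is_derive (df := fun i x => f x * 'D_(e3 i) g x + g x * 'D_(e3 i) f x)).
- by move=> x; apply: cvgM; [exact: Ck_continuous Cf _|exact: Ck_continuous Cg _].
- move=> i x; apply: (@is_deriveM _ _ f g); apply: derivableP.
    exact: CkS_derivable Cf _.
  exact: CkS_derivable Cg _.
- move=> i; apply: CkD; apply: IH; first exact: CkS.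
  + exact: CkS_derive Cg.
  + exact: CkS.
  + exact: CkS_derive Cf.
Qed.

Lemma CkZ k (c : R) f : Ck k f -> Ck k (fun x => c * f x).
Proof. by move=> Cf; apply: CkM => //; exact: Ck_cst. Qed.

Definition coord (i : 'I_3) x : R := [:: x.1.1; x.1.2; x.2]`_i.

Lemma coord_continuous i : continuous (coord i).
Proof.
move=> x; case: i => [[|[|[|//]]] i3].
- by apply: (@continuous_comp _ _ _ fst fst); exact: cvg_fst.
- by apply: (@continuous_comp _ _ _ fst snd); [exact: cvg_fst|exact: cvg_snd].
- exact: cvg_snd.
Qed.

Lemma coord_e3 i j : coord j (e3 i : R3 R) = (i == j)%:R.
Proof. by case: i => [[|[|[|//]]] i3]; case: j => [[|[|[|//]]] j3]. Qed.

Lemma coordD i x y : coord i (x + y) = coord i x + coord i y.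
Proof. by case: i => [[|[|[|//]]] i3]. Qed.

Lemma coordZ i (a : R) x : coord i (a *: x) = a * coord i x.
Proof. by case: i => [[|[|[|//]]] i3]. Qed.

Lemma coord_norm i x : `|coord i x| <= `|x|.
Proof.
have := lexx `|x|; rewrite norm3_le => /and3P[? ? ?].
by case: i => [[|[|[|//]]] i3].
Qed.

Lemma is_derive_coord_comp (g : R -> R) (s b l : R) i j x :
  is_derive (s * coord j x + b) 1 g l ->
  is_derive x (e3 i) (fun x => g (s * coord j x + b)) ((i == j)%:R * s * l).
Proof.
move=> dg; rewrite -[x in is_derive x]add0r -[X in is_derive (X + _)](scale0r (e3 i)).
apply/is_derive_line.
have -> : (fun h : R => g (s * coord j (h *: e3 i + x) + b)) =
    g \o (fun h : R => (i == j)%:R * s * h + (s * coord j x + b)).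
  by apply/funext => h /=; rewrite coordD coordZ coord_e3; congr g; ring.
rewrite [_ * l]mulrC; apply: is_derive1_comp; rewrite ?mulr0 ?add0r//.
have H : is_derive (0 : R) 1 ((i == j)%:R * s \*: (@id R) + cst (s * coord j x + b))
    ((i == j)%:R * s *: 1 + 0) by exact: is_deriveD.
by apply: (is_derive_eq H); rewrite addr0 -[_ *: 1]/(_ * 1) mulr1.
Qed.

Lemma flat_coord_Ck n k (s b : R) j : Ck n (fun x => flat k (s * coord j x + b)).
Proof.
elim: n k => [|n IH] k.
  have cflat : continuous (@flat R k).
    by move=> t; exact: is_derive1_continuous (flat_is_derive k t).
  move=> x; apply: (@continuous_comp _ _ _ (fun x => s * coord j x + b)); last exact: cflat.
  by apply: cvgD; [apply: cvgMr; exact: coord_continuous|exact: cvg_cst].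
apply: (Ck_is_derive (df := fun i x => ((i == j)%:R * s) *
   (flat k.+2 (s * coord j x + b) + (- k%:R) * flat k.+1 (s * coord j x + b)))).
- exact: Ck_continuous (IH k).
- move=> i x; rewrite mulNr; apply: is_derive_coord_comp; exact: flat_is_derive.
- by move=> i; apply: CkZ; apply: CkD => //; apply: CkZ.
Qed.

End Ck_functions.

(** * Sigma-finiteness and Tonelli's theorem on [R^3] *)

Section product_sigma_finite.
Context d1 d2 (T1 : measurableType d1) (T2 : measurableType d2) (R : realType).
Variable m1 : {sigma_finite_measure set T1 -> \bar R}.
Variable m2 : {sigma_finite_measure set T2 -> \bar R}.

Lemma sigma_finite_prod : sigma_finite setT (m1 \x m2)%E.
Proof.
have [F TF Foo] := sigma_finiteT m1; have [G TG Goo] := sigma_finiteT m2.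
exists (fun n => let nk := odflt (0, 0)%N (unpickle n) in F nk.1 `*` G nk.2).
  apply/esym/seteqP; split => // -[x y] _.
  have [n _ Fn] : (\bigcup_n F n) x by rewrite -TF.
  have [k _ Gk] : (\bigcup_n G n) y by rewrite -TG.
  by exists (pickle (n, k)) => //=; rewrite pickleK.
move=> n /=; set nk := odflt _ _.
have [mF Fy] := Foo nk.1; have [mG Gy] := Goo nk.2.
split; first exact: measurableX.
by rewrite product_measure1E// lte_mul_pinfty// ge0_fin_numE.
Qed.

(* A copy of the product measure that carries the sigma-finite structure required
   by Tonelli's theorem on [R^3]. *)
Definition prod_sf : set (T1 * T2) -> \bar R := (m1 \x m2)%E.
HB.instance Definition _ := Measure.on prod_sf.
HB.instance Definition _ := Measure_isSigmaFinite.Build _ _ _ prod_sf sigma_finite_prod.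

End product_sigma_finite.

Section leb3_sigma_finite.
Context {R : realType}.
Notation leb := (@lebesgue_measure R).

Definition leb2s : {sigma_finite_measure set (measurableTypeR R * measurableTypeR R)%type -> \bar R} :=
  prod_sf leb leb.

Definition leb3s : {sigma_finite_measure set (mR3 R) -> \bar R} := prod_sf leb2s leb.

Lemma leb3E : leb3s = leb3 :> (set (mR3 R) -> \bar R).
Proof. by []. Qed.

End leb3_sigma_finite.
Section leb3_product.
Context {R : realType}.
Local Open Scope ereal_scope.
Notation leb := (@lebesgue_measure R).

Lemma integral_leb3_prod (a b c : R -> R) :
  measurable_fun setT a -> measurable_fun setT b -> measurable_fun setT c ->
  (forall t, 0 <= a t)%R -> (forall t, 0 <= b t)%R -> (forall t, 0 <= c t)%R ->
  \int[leb3]_x (a x.1.1 * b x.1.2 * c x.2)%:E =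
  (\int[leb]_t (a t)%:E) * (\int[leb]_t (b t)%:E) * (\int[leb]_t (c t)%:E).
Proof.
move=> ma mb mc a0 b0 c0.
have mab : measurable_fun [set: measurableTypeR R * measurableTypeR R] (fun x => (a x.1 * b x.2)%R).
  apply: measurable_funM; first exact: measurableT_comp ma measurable_fst.
  exact: measurableT_comp mb measurable_snd.
rewrite -leb3E [LHS](@fubini_tonelli1 _ _ _ _ _ leb2s leb); last 2 first.
- apply/measurable_EFinP; apply: measurable_funM.
    exact: measurableT_comp mab measurable_fst.
  exact: measurableT_comp mc measurable_snd.
- by move=> x; rewrite lee_fin !mulr_ge0.
rewrite /fubini_F /=.
under eq_integral => x _.
  under eq_integral => y _ do rewrite EFinM.
  rewrite ge0_integralZl//=; last 3 first.
  - exact/measurable_EFinP.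
  - by move=> y _; rewrite lee_fin.
  - by rewrite lee_fin mulr_ge0.
  over.
rewrite ge0_integralZr//=; last 3 first.
- exact/measurable_EFinP.
- by move=> y _; rewrite lee_fin mulr_ge0.
- by apply: integral_ge0 => y _; rewrite lee_fin.
congr (_ * _).
rewrite [LHS](@fubini_tonelli1 _ _ _ _ _ leb leb); last 2 first.
- exact/measurable_EFinP.
- by move=> x; rewrite lee_fin !mulr_ge0.
rewrite /fubini_F /=.
under eq_integral => x _.
  under eq_integral => y _ do rewrite EFinM.
  rewrite ge0_integralZl//=; last 3 first.
  - exact/measurable_EFinP.
  - by move=> y _; rewrite lee_fin.
  - by rewrite lee_fin.
  over.
rewrite ge0_integralZr//=.
- exact/measurable_EFinP.
- by move=> y _; rewrite lee_fin.
- by apply: integral_ge0 => y _; rewrite lee_fin.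
Qed.

End leb3_product.

(** * The mollifier *)

Section mollifier.
Context {R : realType}.
Notation leb := (@lebesgue_measure R).

(** This is [exp(- 1/(1-t) - 1/(1+t))] on the open interval from -1 to 1 and 0 elsewhere; the
    factorisation reduces its smoothness to that of [flat 0]. *)
Definition bump (t : R) : R := flat 0 (1 - t) * flat 0 (1 + t).

Lemma bump_ge0 t : 0 <= bump t.
Proof. by rewrite mulr_ge0 ?flat_ge0. Qed.

Lemma bump_even t : bump (- t) = bump t.
Proof. by rewrite /bump opprK mulrC. Qed.

Lemma bump_eq0 t : 1 <= `|t| -> bump t = 0.
Proof.
rewrite ler_normr /bump /flat => /orP[t1|t1].
  by rewrite ltNge subr_le0 t1 mul0r.
have -> : 0 < 1 + t = false by apply/negbTE; rewrite -leNgt; lra.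
by rewrite mulr0.
Qed.

Lemma flat0_le1 s : flat 0 s <= 1 :> R.
Proof.
rewrite /flat; case: ifPn => // s0; rewrite expr0 mul1r -expR0 ler_expR.
by rewrite oppr_le0 invr_ge0 ltW.
Qed.

Lemma bump_le1 t : bump t <= 1.
Proof. by rewrite mulr_ile1 ?flat_ge0 ?flat0_le1. Qed.

Lemma flat0_ge (s : R) : 2^-1 <= s -> expR (- 2) <= flat 0 s.
Proof.
move=> s2; have s0 : 0 < s by apply: lt_le_trans s2; rewrite invr_gt0.
rewrite /flat s0 expr0 mul1r ler_expR lerN2 -[leRHS]invrK lef_pV2 ?posrE ?invr_gt0//.
Qed.

Lemma bump_ge t : `|t| <= 2^-1 -> expR (- 2) ^+ 2 <= bump t.
Proof.
rewrite ler_norml => /andP[t1 t2]; rewrite expr2.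
by rewrite ler_pM ?expR_ge0// flat0_ge//; lra.
Qed.

Lemma bump_continuous : continuous bump.
Proof.
have cflat : continuous (@flat R 0).
  by move=> t; exact: is_derive1_continuous (flat_is_derive 0 t).
have h1 : continuous (fun t : R => 1 - t).
  by move=> t; apply: cvgB; [exact: cvg_cst|exact: cvg_id].
have h2 : continuous (fun t : R => 1 + t).
  by move=> t; apply: cvgD; [exact: cvg_cst|exact: cvg_id].
move=> t; apply: cvgM.
  exact: (continuous_comp (h1 t) (cflat _)).
exact: (continuous_comp (h2 t) (cflat _)).
Qed.

Lemma bump_scale_continuous (e x : R) : continuous (fun t => bump (e^-1 * (t - x))).
Proof.
have h : continuous (fun t : R => e^-1 * (t - x)).
  by move=> t; apply: cvgMr; apply: cvgB; [exact: cvg_id|exact: cvg_cst].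
move=> t; exact: (continuous_comp (h t) (@bump_continuous _)).
Qed.

Definition bump_int (e : R) : R := \int[leb]_t bump (e^-1 * t).

Lemma bump_int_translate (e x : R) :
  (\int[leb]_t (bump (e^-1 * (t - x)))%:E = \int[leb]_t (bump (e^-1 * t))%:E)%E.
Proof.
have dF (t : R) : is_derive t 1 (fun s : R => s - x) 1.
  have H : is_derive t 1 ((@id R) - cst x) (1 - 0) by exact: is_deriveB.
  by apply: (is_derive_eq H); rewrite subr0.
have F1 : (fun s : R => s - x)^`()%classic = cst 1.
  by apply/funext => t; rewrite derive1E; case: (dF t).
have := @increasing_ge0_integration_by_substitutionT R (fun s => s - x) (fun t => bump (e^-1 * t)).
rewrite F1 => ->//.
- by apply: eq_integral => t _ /=; rewrite fctE mulr1.
- by move=> a b ab; rewrite ltrD2r.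
- by move=> t; exact: cst_continuous.
- exact: is_cvg_cst.
- exact: is_cvg_cst.
- apply/cvgrNyPle => A; near=> t; rewrite lerBlDr; near: t; exact: (nbhs_ninfty_le (num_real _)).
- apply/cvgryPge => A; near=> t; rewrite lerBrDr; near: t; exact: (nbhs_pinfty_ge (num_real _)).
- move=> t; have := @bump_scale_continuous e 0 t; under eq_fun do rewrite subr0; exact.
- by move=> t; exact: bump_ge0.
Unshelve. all: by end_near. Qed.

(** The integrand is at least [expR (- 2) ^+ 2] where [|t| <= e / 2], an interval of length [e], and
    at most 1 on its support, of length [2 e]. The lower bound controls the normalisation in
    [moll_le]. *)
Lemma bump_int_bounds (e : R) : 0 < e ->
  ((e * expR (- 2) ^+ 2)%:E <= \int[leb]_t (bump (e^-1 * t))%:E <= (2 * e)%:E)%E.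
Proof.
move=> e0.
have mb : measurable_fun setT (fun t => (bump (e^-1 * t))%:E).
  apply/measurable_EFinP; apply: continuous_measurable_fun => t.
  have := @bump_scale_continuous e 0 t; under eq_fun do rewrite subr0; exact.
have itv (a c : R) : 0 <= a -> 0 <= c ->
    (\int[leb]_(t in `[(- a)%R, a]) c%:E = (2 * a * c)%:E)%E.
  move=> a0 c0; rewrite integral_cst//= lebesgue_measure_itv/= lte_fin.
  by case: ltP => h; rewrite -?EFinB -EFinM; congr EFin; nra.
apply/andP; split.
  rewrite (_ : e * _ = 2 * (e / 2) * expR (- 2) ^+ 2); last by field.
  rewrite -itv ?sqr_ge0 ?divr_ge0 ?(ltW e0)// integral_mkcond.
  apply: ge0_le_integral => //.
  - by move=> t _; apply: erestrict_ge0 => *; rewrite lee_fin sqr_ge0.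
  - by apply/(measurable_restrictT _ _).1 => //; exact: measurable_cst.
  - move=> t _; rewrite patchE; case: ifPn => [|_]; last by rewrite lee_fin bump_ge0.
    rewrite inE/= in_itv/= lee_fin => /andP[t1 t2]; apply: bump_ge.
    by rewrite normrM normfV (gtr0_norm e0) ler_pdivrMl// ler_norml; apply/andP; split; lra.
rewrite -[2 * e]mulr1 -itv ?(ltW e0)// integral_mkcond [leRHS]integral_mkcond.
apply: ge0_le_integral => //.
- by move=> t _; apply: erestrict_ge0 => *; rewrite lee_fin bump_ge0.
- by apply/(measurable_restrictT _ _).1 => //; exact: measurable_funTS.
- by apply/(measurable_restrictT _ _).1 => //; exact: measurable_cst.
- move=> t _; rewrite !patchE in_setT; case: ifPn => [_|]; first by rewrite lee_fin bump_le1.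
  rewrite notin_setE/= in_itv/= => /negP h.
  rewrite bump_eq0// normrM normfV (gtr0_norm e0) ler_pdivlMl// mulr1.
  by rewrite leNgt; apply/negP => te; apply: (negP h);
  move: te; rewrite ltr_norml => /andP[? ?]; apply/andP; split; lra.
Qed.

Lemma bump_intE (e : R) : 0 < e ->
  (\int[leb]_t (bump (e^-1 * t))%:E = (bump_int e)%:E)%E.
Proof.
move=> e0; have /andP[l u] := bump_int_bounds e0.
by rewrite /bump_int /Rintegral fineK// fin_numE gt_eqF ?lt_eqF ?(le_lt_trans u) ?ltey// (lt_le_trans _ l)// ltNye.
Qed.

Lemma bump_int_ge (e : R) : 0 < e -> e * expR (- 2) ^+ 2 <= bump_int e.
Proof. by move=> e0; rewrite -lee_fin -bump_intE//; case/andP: (bump_int_bounds e0). Qed.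

Lemma bump_int_gt0 (e : R) : 0 < e -> 0 < bump_int e.
Proof. by move=> e0; apply: lt_le_trans (bump_int_ge e0); rewrite mulr_gt0// exprn_gt0// expR_gt0. Qed.

(** A tensor product rather than a radial function: its support is a cube, that is a ball of the sup
    norm, and its integral is a product of three one-dimensional ones. *)
Definition moll (e : R) (x : R3 R) : R :=
  bump (e^-1 * x.1.1) * bump (e^-1 * x.1.2) * bump (e^-1 * x.2) / bump_int e ^+ 3.

Lemma moll_ge0 e x : 0 < e -> 0 <= moll e x.
Proof.
move=> e0; rewrite divr_ge0 ?exprn_ge0 ?(ltW (bump_int_gt0 e0))//.
by apply: mulr_ge0; [apply: mulr_ge0|]; exact: bump_ge0.
Qed.

Lemma moll_eq0 e x : 0 < e -> e <= `|x| -> moll e x = 0.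
Proof.
move=> e0 ex; rewrite /moll.
have h t : e <= `|t| -> bump (e^-1 * t) = 0.
  by move=> et; rewrite bump_eq0// normrM normfV (gtr0_norm e0) ler_pdivlMl// mulr1.
have : e <= `|x.1.1| \/ e <= `|x.1.2| \/ e <= `|x.2|.
  move: ex; rewrite leNgt norm3_lt !negb_and -!leNgt => /or3P[]; tauto.
by case=> [|[]] => /h ->; rewrite ?mul0r ?mulr0 ?mul0r.
Qed.

Lemma moll_even e x y : moll e (x - y) = moll e (y - x).
Proof.
rewrite /moll/=.
have h (s t : R) : bump (e^-1 * (s - t)) = bump (e^-1 * (t - s)).
  by rewrite -bump_even -mulrN opprB.
by rewrite (h x.1.1) (h x.1.2) (h x.2).
Qed.

(** The order [e^-3], with a constant free of [e], feeds the estimate near the origin in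
    [psi2_A1]. *)
Lemma moll_le e x : 0 < e -> moll e x <= (expR (- 2) ^+ 2) ^- 3 * e ^- 3.
Proof.
move=> e0; have I0 := bump_int_gt0 e0; rewrite /moll -invfM -exprMn.
rewrite ler_pdivrMr ?exprn_gt0//.
apply: (@le_trans _ _ 1).
  have h t : 0 <= bump t <= 1 by rewrite bump_ge0 bump_le1.
  have /andP[? ?] := h (e^-1 * x.1.1); have /andP[? ?] := h (e^-1 * x.1.2).
  have /andP[? ?] := h (e^-1 * x.2).
  by apply: mulr_ile1 => //; [exact: mulr_ge0|exact: mulr_ile1].
rewrite ler_pdivlMl ?exprn_gt0 ?mulr_gt0 ?exprn_gt0 ?expR_gt0// mulr1.
by rewrite lerXn2r ?nnegrE ?mulr_ge0 ?sqr_ge0 ?(ltW I0) ?(ltW e0)// mulrC; exact: bump_int_ge.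
Qed.

Lemma moll_Ck e k : Ck k (moll e).
Proof.
have h (i : 'I_3) : Ck k (fun x : R3 R => bump (e^-1 * coord i x)).
  rewrite (_ : (fun _ => _) = fun x => flat 0 (- e^-1 * coord i x + 1) * flat 0 (e^-1 * coord i x + 1)); last first.
    by apply/funext => x; rewrite /bump addrC mulNr [1 + _]addrC.
  by apply: CkM; exact: flat_coord_Ck.
apply: CkM; last exact: Ck_cst.
by apply: CkM; [apply: CkM; [exact: (h (@Ordinal 3 0 isT))|exact: (h (@Ordinal 3 1 isT))]|exact: (h (@Ordinal 3 2 isT))].
Qed.

Lemma moll_int (e : R) (x : R3 R) : 0 < e ->
  (\int[leb3]_y (moll e (x - y))%:E = 1%:E)%E.
Proof.
move=> e0; have I0 := bump_int_gt0 e0.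
have mb (t : R) : measurable_fun setT (fun s : R => bump (e^-1 * (s - t))).
  by apply: continuous_measurable_fun; exact: bump_scale_continuous.
rewrite (eq_integral (fun y : mR3 R => (bump (e^-1 * (y.1.1 - x.1.1)) / bump_int e
    * (bump (e^-1 * (y.1.2 - x.1.2)) / bump_int e) * (bump (e^-1 * (y.2 - x.2)) / bump_int e))%:E)); last first.
  move=> y _; rewrite moll_even /moll/=; congr EFin; field; exact: lt0r_neq0.
rewrite (@integral_leb3_prod _ (fun t => bump (e^-1 * (t - x.1.1)) / bump_int e)
  (fun t => bump (e^-1 * (t - x.1.2)) / bump_int e) (fun t => bump (e^-1 * (t - x.2)) / bump_int e)); last 6 first.
- by apply: measurable_funM.
- by apply: measurable_funM.
- by apply: measurable_funM.
- by move=> t; rewrite divr_ge0 ?bump_ge0// ltW.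
- by move=> t; rewrite divr_ge0 ?bump_ge0// ltW.
- by move=> t; rewrite divr_ge0 ?bump_ge0// ltW.
have one (t : R) : (\int[leb]_s (bump (e^-1 * (s - t)) / bump_int e)%:E = 1%:E)%E.
  under eq_integral => s _ do rewrite EFinM.
  rewrite ge0_integralZr//=.
  - by rewrite bump_int_translate bump_intE// -EFinM mulfV// lt0r_neq0.
  - by apply/measurable_EFinP; exact: mb.
  - by move=> s _; rewrite lee_fin bump_ge0.
  - by rewrite lee_fin invr_ge0 ltW.
by rewrite !one !mul1e.
Qed.

End mollifier.
(** * Convolution and weak derivatives *)

Section integration_by_parts.
Context {R : realType}.
Notation leb := (@lebesgue_measure R).
Implicit Types (f u w : R3 R -> R) (N M : R).

Lemma integral_derive_vanish (g dg : R -> R) N :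
  (forall t : R, is_derive t (1 : R) g (dg t)) -> continuous dg ->
  (forall t, N < `|t| -> g t = 0) -> (forall t, N < `|t| -> dg t = 0) ->
  (\int[leb]_t (dg t)%:E = 0)%E.
Proof.
(* [M] exceeds [N] strictly, so that [g] vanishes at both endpoints. *)
move=> gd cdg g0 dg0; pose M := `|N| + 1.
have M0 : 0 < M by rewrite ltr_wpDl.
have NM t : M <= `|t| -> N < `|t|.
  by apply: lt_le_trans; rewrite (le_lt_trans (ler_norm N))// ltrDl.
have cg : continuous g by move=> t; exact: is_derive1_continuous (gd t).
have -> : (\int[leb]_t (dg t)%:E = \int[leb]_(t in `[(- M)%R, M]) (dg t)%:E)%E.
  rewrite [RHS]integral_mkcond; apply: eq_integral => t _; rewrite patchE.
  case: ifPn => //; rewrite notin_setE/= in_itv/= => /negP h.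
  rewrite dg0//; apply: NM; rewrite leNgt; apply/negP => tM; apply: (negP h).
  by rewrite -ler_norml ltW.
rewrite (@continuous_FTC2 _ dg g); last 4 first.
- by rewrite gtrN.
- exact: continuous_subspaceT.
- split; first by move=> t _; case: (gd t).
  + by apply: cvg_at_right_filter; exact: cg.
  + by apply: cvg_at_left_filter; exact: cg.
- by move=> t _; rewrite derive1E; case: (gd t).
by rewrite !g0 ?subee// NM// ?normrN (gtr0_norm M0).
Qed.

Lemma bounded_vanish_integrable f N M : measurable_fun [set: mR3 R] f ->
  (forall x, `|f x| <= M) -> vanish N f -> leb3.-integrable setT (EFin \o f).
Proof.
move=> mf fM fN; have M0 : 0 <= M by apply: le_trans (fM 0).
apply/integrableP; split; first exact/measurable_EFinP.
apply: (@le_lt_trans _ _ (\int[leb3]_(x in box `|N|) M%:E)%E).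
  rewrite [leRHS]integral_mkcond; apply: ge0_le_integral => //.
  - by apply: measurableT_comp => //; exact/measurable_EFinP.
  - apply/(measurable_restrictT _ _).1; first exact: measurable_box.
    exact: measurable_cst.
  - move=> x _; rewrite patchE /=; case: ifPn => [_|]; first by rewrite lee_fin fM.
    rewrite notin_setE /box/= => /negP; rewrite -ltNge => xN.
    by rewrite fN ?normr0// (le_lt_trans (ler_norm N)).
rewrite integral_cst; last exact: measurable_box.
by rewrite /= leb3_box// -EFinM ltry.
Qed.

Lemma continuous_vanish_integrable f N : continuous f -> vanish N f ->
  leb3.-integrable setT (EFin \o f).
Proof.
move=> cf fN; have [M M0 fM] := continuous_vanish_bounded cf fN.
exact: bounded_vanish_integrable (continuous_measurable3 cf) fM fN.
Qed.

Lemma vanish_derive w N i : vanish N w -> vanish N ('D_(e3 i) w).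
Proof.
move=> wN x Nx; rewrite (@near_eq_derive _ _ _ w (cst 0)).
  by rewrite derive_val.
near=> y; rewrite wN//=.
near: y; have : open [set y : R3 R | N < `|y|].
  by apply: (open_comp _ (@open_gt _ N)) => y _; exact: norm_continuous.
by move=> o; apply: open_nbhs_nbhs.
Unshelve. all: by end_near. Qed.

(** As [coord i x = 0], the parameter [t] is the [i]-th coordinate along the line, and [|t| > N]
    puts the point outside the support. *)
Lemma integral_derive_line w N i (x : R3 R) : Ck 1 w -> vanish N w -> coord i x = 0 ->
  (\int[leb]_t ('D_(e3 i) w (t *: e3 i + x))%:E = 0)%E.
Proof.
move=> Cw wN xi.
have cl : continuous (fun t : R => t *: e3 i + x : R3 R).
  by move=> t; apply: cvgD; [exact: scalel_continuous|exact: cvg_cst].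
have cdw : continuous (fun t : R => 'D_(e3 i) w (t *: e3 i + x)).
  have cD : continuous ('D_(e3 i) w) := Ck_continuous (CkS_derive i Cw).
  by move=> t; exact: (@continuous_comp R (R3 R) R _ ('D_(e3 i) w) t (cl t) (cD _)).
apply: (@integral_derive_vanish (fun t : R => w (t *: e3 i + x))
  (fun t : R => 'D_(e3 i) w (t *: e3 i + x)) N) => //.
- move=> t; apply/is_derive_line; apply: derivableP; exact: CkS_derivable Cw _.
- move=> t Nt; apply: wN; apply: lt_le_trans Nt _.
  by apply: le_trans (coord_norm i _); rewrite coordD coordZ coord_e3 eqxx mulr1 xi addr0.
- move=> t Nt; apply: (@vanish_derive w N i wN); apply: lt_le_trans Nt _.
  by apply: le_trans (coord_norm i _); rewrite coordD coordZ coord_e3 eqxx mulr1 xi addr0.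
Qed.

Lemma slice_integrable f N (z : R) : continuous f -> vanish N f ->
  (@leb2s R).-integrable setT (fun xy => (f (xy, z))%:E).
Proof.
move=> cf fN; have [M M0 fM] := continuous_vanish_bounded cf fN.
have mf := continuous_measurable3 cf.
have mfz : measurable_fun [set: measurableTypeR R * measurableTypeR R] (fun xy => f (xy, z)).
  exact: (measurable_fun_pair1 z mf).
apply/integrableP; split; first exact/measurable_EFinP.
pose I : set R := [set` `[- `|N|, `|N|]].
pose B : set (measurableTypeR R * measurableTypeR R) := I `*` I.
have mB : measurable B by apply: measurableX; exact: measurable_itv.
apply: (@le_lt_trans _ _ (\int[@leb2s R]_(x in B) M%:E)%E).
  rewrite [leRHS]integral_mkcond; apply: ge0_le_integral => //.
  - by apply: measurableT_comp => //; exact/measurable_EFinP.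
  - by apply/(measurable_restrictT _ _).1 => //; exact: measurable_cst.
  - move=> x _; rewrite patchE /=; case: ifPn => [_|]; first by rewrite lee_fin fM.
    rewrite notin_setE => xB; rewrite fN ?normr0 ?lexx//.
    apply: (le_lt_trans (ler_norm N)); rewrite ltNge; apply/negP.
    rewrite norm3_le/= => /and3P[x1 x2 _]; apply: xB.
    by rewrite /B/I/= !in_itv/= -!ler_norml x1 x2.
rewrite integral_cst//.
suff: (leb2s B < +oo)%E by move=> h; rewrite lte_mul_pinfty// lee_fin ltW.
rewrite [X in (X < _)%E](_ : _ = leb I * leb I)%E; last by apply: product_measure1E; exact: measurable_itv.
rewrite /I lebesgue_measure_itv/=; case: ifPn => _; last by rewrite mule0 ltry.
by rewrite -EFinB -!EFinM ltry.
Qed.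

Lemma integral_derive3 w N i : Ck 1 w -> vanish N w ->
  (\int[leb3]_x ('D_(e3 i) w x)%:E = 0)%E.
Proof.
move=> Cw wN; have cf := Ck_continuous (CkS_derive i Cw).
have fN := @vanish_derive _ _ i wN.
have int := continuous_vanish_integrable cf fN.
have line := @integral_derive_line w N i _ Cw wN.
move: cf fN int line; set f := 'D_(e3 i) w => cf fN int line.
have e0 (z : R) (i3 : (0 < 3)%N) y : z *: e3 (Ordinal i3) + ((0, y.1), y.2) = ((z, y.1), y.2).
  by rewrite /e3/= -[_ *: _]/((z * 1, z * 0), z * 0) !mulr0 mulr1 -[LHS]/((z + 0, 0 + y.1), 0 + y.2) !add0r addr0.
have e1 (z : R) (i3 : (1 < 3)%N) y : z *: e3 (Ordinal i3) + ((y.1, 0), y.2) = ((y.1, z), y.2).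
  by rewrite /e3/= -[_ *: _]/((z * 0, z * 1), z * 0) !mulr0 mulr1 -[LHS]/((0 + y.1, z + 0), 0 + y.2) !add0r addr0.
have e2 (z : R) (i3 : (2 < 3)%N) y : z *: e3 (Ordinal i3) + ((y.1, y.2), 0) = ((y.1, y.2), z).
  by rewrite /e3/= -[_ *: _]/((z * 0, z * 0), z * 1) !mulr0 mulr1 -[LHS]/((0 + y.1, 0 + y.2), z + 0) !add0r addr0.
(* In each of the three cases Fubini's theorem is used in the order that makes the [i]-th variable
   innermost. *)
rewrite -leb3E; case: i @f cf fN int line => [[|[|[|//]]] i3] f cf fN int line.
- rewrite -(@integral21_prod_meas1 _ _ _ _ _ leb2s leb (EFin \o f))//.
  rewrite /fubini_G integral0_eq// => z _ /=.
  rewrite -(@integral21_prod_meas1 _ _ _ _ _ leb leb (fun xy => (f (xy, z))%:E)); last exact: slice_integrable fN.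
  rewrite /fubini_G integral0_eq// => y _ /=.
  have := line ((0, y), z) erefl; apply: eq_trans; apply: eq_integral => x _.
  by rewrite (e0 x i3 (y, z)).
- rewrite -(@integral21_prod_meas1 _ _ _ _ _ leb2s leb (EFin \o f))//.
  rewrite /fubini_G integral0_eq// => z _ /=.
  rewrite -(@integral12_prod_meas1 _ _ _ _ _ leb leb (fun xy => (f (xy, z))%:E)); last exact: slice_integrable fN.
  rewrite /fubini_F integral0_eq// => x _ /=.
  have := line ((x, 0), z) erefl; apply: eq_trans; apply: eq_integral => y _.
  by rewrite (e1 y i3 (x, z)).
- rewrite -(@integral12_prod_meas1 _ _ _ _ _ leb2s leb (EFin \o f))//.
  rewrite /fubini_F integral0_eq// => -[x y] _ /=.
  have := line ((x, y), 0) erefl; apply: eq_trans; apply: eq_integral => z _.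
  by rewrite (e2 z i3 (x, y)).
Qed.

Lemma loc_integrable_mul u f N : loc_integrable3 u -> continuous f -> vanish N f ->
  leb3.-integrable setT (fun x => (u x * f x)%:E).
Proof.
move=> [mu iu] cf fN; have [M M0 fM] := continuous_vanish_bounded cf fN.
have mf := continuous_measurable3 cf.
have /integrableP[_ ib] := iu _ (@compact_box _ N).
apply/integrableP; split; first by apply/measurable_EFinP; exact: measurable_funM.
apply: (@le_lt_trans _ _ (\int[leb3]_(x in box N) (M%:E * `|(u x)%:E|))%E).
  rewrite [leRHS]integral_mkcond; apply: ge0_le_integral => //.
  - by apply: measurableT_comp => //; apply/measurable_EFinP; exact: measurable_funM.
  - apply/(measurable_restrictT _ _).1; first exact: measurable_box.
    apply: measurable_funTS; apply: measurable_funeM; apply: measurableT_comp => //.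
    exact/measurable_EFinP.
  - move=> x _; rewrite patchE /=; case: ifPn => [_|].
      by rewrite lee_fin normrM mulrC ler_wpM2r.
    rewrite notin_setE /box/= => /negP; rewrite -ltNge => xN.
    by rewrite fN// mulr0 normr0.
rewrite ge0_integralZl//.
- by rewrite lte_mul_pinfty// lee_fin ltW.
- exact: measurable_box.
- apply: measurable_funTS; apply: measurableT_comp => //; exact/measurable_EFinP.
- by rewrite lee_fin ltW.
Qed.

Lemma loc_integrable_box u : measurable_fun [set: mR3 R] u ->
  (forall N, 0 < N -> (\int[leb3]_(x in box N) `|(u x)%:E| < +oo)%E) ->
  loc_integrable3 u.
Proof.
move=> mu h; split => // K cK; have [N N0 KN] := compact_sub_box cK.
have mK : measurable (K : set (mR3 R)).
  by apply: closed_measurable3; apply: compact_closed cK; exact: norm_hausdorff.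
apply: (integrableS (measurable_box N) mK KN).
apply/integrableP; split; last exact: h.
by apply: measurable_funTS; exact/measurable_EFinP.
Qed.

Lemma continuous_loc_integrable f : continuous f -> loc_integrable3 f.
Proof.
move=> cf; have mf := continuous_measurable3 cf.
apply: loc_integrable_box => // N N0.
have [M M0 fM] := continuous_bounded_box N cf.
apply: (@le_lt_trans _ _ (\int[leb3]_(x in box N) M%:E)%E).
  apply: ge0_le_integral => //.
  - exact: measurable_box.
  - by apply: measurable_funTS; apply: measurableT_comp => //; exact/measurable_EFinP.
rewrite integral_cst; last exact: measurable_box.
by rewrite /= leb3_box ?(ltW N0)// -EFinM ltry.
Qed.

(** The product rule reduces this to [integral_derive3]. The level [C^1] matters: in the Markov
    property it is applied to the composition of [soft_unit e] with a test function, which is in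
    general no smoother. *)
Lemma C1_weak_partial i (v : R3 R -> R) : Ck 1 v -> weak_partial i v ('D_(e3 i) v).
Proof.
move=> Cv.
have cv := Ck_continuous Cv; have cdv := Ck_continuous (CkS_derive i Cv).
split; [exact: continuous_loc_integrable|exact: continuous_loc_integrable|].
move=> phi [Cphi /compact_vanish[N N0 phiN]].
have Cp := Cphi 1%N.
have cp := Ck_continuous Cp; have cdp := Ck_continuous (CkS_derive i Cp).
have dpN := @vanish_derive _ _ i phiN.
have i1 := loc_integrable_mul (continuous_loc_integrable cv) cdp dpN.
have i2 := loc_integrable_mul (continuous_loc_integrable cdv) cp phiN.
apply/eqP; rewrite -subr_eq0 opprK -RintegralD//.
have Cvp := CkM Cv Cp.
have vN : vanish N (fun x => v x * phi x) by move=> x xN; rewrite phiN ?mulr0.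
have := integral_derive3 i Cvp vN.
move=> h; apply/eqP; rewrite /Rintegral (_ : integral _ _ _ = 0%E)//.
rewrite -h; apply: eq_integral => x _; congr EFin.
rewrite (@deriveM _ _ v phi); last 2 first.
- exact: CkS_derivable Cv _.
- exact: CkS_derivable Cp _.
by rewrite -![_ *: _]/(_ * _) [phi x * _]mulrC.
Qed.

End integration_by_parts.

(** * Convolution and its derivatives *)

Section convolution.
Context {R : realType}.
Implicit Types (f u g phi a b : R3 R -> R) (N M : R) (x y : R3 R).

(** Pairing with [u] is Lipschitz for the uniform norm on continuous functions supported in one box.
    Continuity and differentiability of [conv], and the passage from [Ccoo] to [Cc] as test
    functions, rest on this. *)
Lemma integral_test_dist u a b M e : loc_integrable3 u -> continuous a -> continuous b ->
  vanish M a -> vanish M b -> (forall y, `|a y - b y| <= e) ->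
  `|\int[leb3]_y (u y * a y) - \int[leb3]_y (u y * b y)| <=
    e * \int[leb3]_(y in box M) `|u y|.
Proof.
move=> lu ca cb aM bM abe.
have e0 : 0 <= e by apply: le_trans (abe 0).
have mu := lu.1.
have ia := loc_integrable_mul lu ca aM; have ib := loc_integrable_mul lu cb bM.
have iu : leb3.-integrable (box M) (EFin \o u) by apply: lu.2; exact: compact_box.
have mB := @measurable_box R M.
rewrite -RintegralB//.
have iab : leb3.-integrable setT (EFin \o (fun y => u y * a y - u y * b y)).
  by have := integrableB measurableT ia ib; apply: eq_integrable.
apply: (le_trans (le_normr_Rintegral measurableT iab)).
have ieu : leb3.-integrable (box M) (EFin \o (fun y => e * `|u y|)).
  by apply: (integrableZl mB e (integrable_abse iu)).
rewrite -RintegralZl//; last exact: integrable_abse iu.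
rewrite [leRHS]Rintegral_mkcond; apply: le_Rintegral => //.
- exact: integrable_abse iab.
- have /(integrable_mkcond _ mB) := ieu.
  by apply: eq_integrable => // y _; rewrite /= !patchE; case: ifP.
- move=> y _; rewrite patchE; case: ifPn => [_|].
    by rewrite -mulrBr normrM mulrC ler_wpM2r.
  rewrite notin_setE /box/= => /negP; rewrite -ltNge => yM.
  by rewrite aM// bM// subrr normr0.
Qed.

Definition conv u phi x := \int[leb3]_y (u y * phi (x - y)).

Lemma reflect_continuous phi x : continuous phi -> continuous (fun y => phi (x - y)).
Proof.
move=> cp y.
have c : {for y, continuous (fun y => x - y : R3 R)}.
  by apply: cvgB; [exact: cvg_cst|exact: cvg_id].
exact: (continuous_comp c (cp _)).
Qed.

Lemma reflect_vanish phi N M x : vanish N phi -> `|x| <= M -> vanish (N + M) (fun y => phi (x - y)).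
Proof.
move=> pN xM y yN; apply: pN.
have : `|y| <= `|x - y| + `|x|.
  by rewrite addrC; have := ler_normB x (x - y); rewrite subKr.
by lra.
Qed.

Lemma conv_integrable u phi N x : loc_integrable3 u -> continuous phi -> vanish N phi ->
  leb3.-integrable setT (fun y => (u y * phi (x - y))%:E).
Proof.
move=> lu cp pN; apply: loc_integrable_mul lu _ _; first exact: reflect_continuous.
exact: reflect_vanish pN (lexx `|x|).
Qed.

Lemma conv_continuous u phi N : loc_integrable3 u -> continuous phi -> vanish N phi ->
  continuous (conv u phi).
Proof.
move=> lu cp pN x; apply/cvgrPdist_lt => e e0.
(* For every [x'] within 1 of [x] the kernel [phi (x' - y)] vanishes outside this one box. *)
set I := \int[leb3]_(y in box (N + (`|x| + 1))) `|u y|.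
have I0 : 0 <= I by apply: Rintegral_ge0.
have eI : 0 < e / (I + 1) by rewrite divr_gt0// ltr_wpDl.
have [d d0 dP] := vanish_unif_continuous cp pN eI.
near=> x'.
have xx' : `|x - x'| < Num.min d 1.
  near: x'; apply: (@cvgr_dist_lt _ _ _ _ _ id); first exact: cvg_id.
  by rewrite lt_min d0 ltr01.
move: xx'; rewrite lt_min => /andP[xd x1].
have x'1 : `|x'| <= `|x| + 1.
  by rewrite -[x'](subKr x) (le_trans (ler_normB _ _))// lerD2l ltW.
apply: (@le_lt_trans _ _ (e / (I + 1) * I)).
  apply: integral_test_dist => //; try exact: reflect_continuous.
  - by apply: reflect_vanish => //; rewrite lerDl.
  - exact: reflect_vanish.
  - by move=> y; apply/ltW/dP; rewrite opprB addrA subrK.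
by rewrite mulrAC ltr_pdivrMr ?ltr_wpDl// ltr_pM2l// ltrDl.
Unshelve. all: by end_near. Qed.

Lemma norm_Ze3 (h : R) i : `|h *: e3 i : R3 R| = `|h|.
Proof.
rewrite normrZ; suff -> : `|e3 i : R3 R| = 1 by rewrite mulr1.
case: i => [[|[|[|//]]] i3]; rewrite /e3 !prod_normE/= ?normr0 ?normr1.
- by rewrite max_l// max_l.
- by rewrite max_l// max_r.
- by rewrite max_r// max_l.
Qed.

(** By the mean value theorem the quotient is a value of the partial derivative at distance at most
    [|h|] from [z], and that derivative is uniformly continuous. *)
Lemma quotient_unif phi N i : Ck 1 phi -> vanish N phi -> forall e, 0 < e ->
  exists2 d, 0 < d & forall h z, h != 0 -> `|h| < d ->
    `|h^-1 * (phi (h *: e3 i + z) - phi z) - 'D_(e3 i) phi z| <= e.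
Proof.
move=> Cp pN e e0.
have [d d0 dP] := vanish_unif_continuous (Ck_continuous (CkS_derive i Cp)) (@vanish_derive _ _ _ i pN) e0.
exists d => // h z h0 hd.
have der (t : R) : is_derive t (1 : R) (fun t : R => phi (t *: e3 i + z)) ('D_(e3 i) phi (t *: e3 i + z)).
  by apply/is_derive_line; apply: derivableP; exact: CkS_derivable Cp _.
have cont : continuous (fun t : R => phi (t *: e3 i + z)).
  by move=> t; exact: is_derive1_continuous (der t).
have [c ch cE] : exists2 c, `|c| <= `|h| & phi (h *: e3 i + z) - phi z = 'D_(e3 i) phi (c *: e3 i + z) * h.
  have [h1|h1] := ltP 0 h.
    have [c] := @MVT_segment R _ _ 0 h (ltW h1) (fun t _ => der t) (continuous_subspaceT cont).
    rewrite in_itv/= => /andP[c0 c1]; rewrite scale0r add0r subr0 => E.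
    by exists c => //; rewrite !ger0_norm// ltW.
  have [c] := @MVT_segment R _ _ h 0 h1 (fun t _ => der t) (continuous_subspaceT cont).
  rewrite in_itv/= => /andP[c0 c1]; rewrite scale0r add0r sub0r mulrN => E.
  exists c; first by rewrite !ler0_norm// lerN2.
  by rewrite -[LHS]opprB E opprK.
rewrite cE mulrCA mulVf// mulr1; apply/ltW/dP.
by rewrite addrK norm_Ze3 (le_lt_trans ch).
Qed.

Lemma conv_is_derive u phi N i x : loc_integrable3 u -> Ck 1 phi -> vanish N phi ->
  is_derive x (e3 i) (conv u phi) (conv u ('D_(e3 i) phi) x).
Proof.
move=> lu Cp pN.
have cp := Ck_continuous Cp; have cdp := Ck_continuous (CkS_derive i Cp).
have dpN := @vanish_derive _ _ _ i pN.
set M := N + (`|x| + 1).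
set I := \int[leb3]_(y in box M) `|u y|.
have I0 : 0 <= I by apply: Rintegral_ge0.
suff lim : h^-1 *: ((conv u phi \o shift x) (h *: e3 i) - conv u phi x) @[h --> (0 : R)^']
    --> conv u ('D_(e3 i) phi) x.
  by apply: DeriveDef; [apply/cvg_ex; exists (conv u ('D_(e3 i) phi) x)|exact: cvg_lim lim].
apply/cvgrPdist_lt => e e0.
have eI : 0 < e / (I + 1) by rewrite divr_gt0// ltr_wpDl.
have [d d0 dP] := quotient_unif i Cp pN eI.
near=> h => /=.
have h0 : h != 0 by near: h; exact: nbhs_dnbhs_neq.
have : `|h| < Num.min d 1.
  by near: h; apply: dnbhs0_lt; rewrite lt_min d0 ltr01.
rewrite lt_min => /andP[hd h1].
have x'1 : `|h *: e3 i + x| <= `|x| + 1.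
  by rewrite addrC (le_trans (ler_normD _ _))// lerD2l norm_Ze3 ltW.
have v1 : vanish M (fun y => phi (h *: e3 i + x - y)) by exact: reflect_vanish pN x'1.
have v2 : vanish M (fun y => phi (x - y)) by apply: reflect_vanish pN _; rewrite lerDl.
have -> : h^-1 *: (conv u phi (shift x (h *: e3 i)) - conv u phi x) =
   \int[leb3]_y (u y * (h^-1 * (phi (h *: e3 i + x - y) - phi (x - y)))).
  rewrite -[_ *: _]/(_ * _) /conv /shift/= -RintegralB//; last 2 first.
  - exact: conv_integrable pN.
  - exact: conv_integrable pN.
  rewrite -RintegralZl//.
  - by apply: eq_Rintegral => y _; ring.
  - have := integrableB measurableT (conv_integrable (h *: e3 i + x) lu cp pN) (conv_integrable x lu cp pN).
    by apply: eq_integrable.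
apply: (@le_lt_trans _ _ (e / (I + 1) * I)).
  apply: (@integral_test_dist u (fun y => 'D_(e3 i) phi (x - y))
    (fun y => h^-1 * (phi (h *: e3 i + x - y) - phi (x - y))) M) => //.
  - exact: (@reflect_continuous ('D_(e3 i) phi)).
  - by move=> y; apply: cvgMr; apply: cvgB; exact: reflect_continuous.
  - by apply: reflect_vanish dpN _; rewrite lerDl.
  - by move=> y yM; rewrite v1// v2// subrr mulr0.
  - by move=> y; rewrite distrC -addrA; exact: dP.
by rewrite mulrAC ltr_pdivrMr ?ltr_wpDl// ltr_pM2l// ltrDl.
Unshelve. all: by end_near. Qed.

Lemma derive_conv u phi N i : loc_integrable3 u -> Ck 1 phi -> vanish N phi ->
  'D_(e3 i) (conv u phi) = conv u ('D_(e3 i) phi).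
Proof. by move=> lu Cp pN; apply/funext => x; case: (conv_is_derive i x lu Cp pN). Qed.

Lemma Ck_C1 k phi : Ck k.+1 phi -> Ck 1 phi.
Proof. by elim: k => // k IH Cp; apply: IH; exact: CkS. Qed.

Lemma conv_Ck k u phi N : loc_integrable3 u -> Ck k phi -> vanish N phi -> Ck k (conv u phi).
Proof.
move=> lu; elim: k phi => [|k IH] phi Cp pN; first exact: conv_continuous pN.
apply: (Ck_is_derive (df := fun i => conv u ('D_(e3 i) phi))).
- by apply: (conv_continuous lu _ pN); exact: Ck_continuous Cp.
- move=> i x; apply: conv_is_derive pN => //.
  exact: Ck_C1 Cp.
- by move=> i; apply: IH; [exact: CkS_derive|exact: vanish_derive].
Qed.

Lemma reflect_is_derive phi i x y : Ck 1 phi ->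
  is_derive y (e3 i) (fun y => phi (x - y)) (- 'D_(e3 i) phi (x - y)).
Proof.
move=> Cp; rewrite -[y in is_derive y]add0r -[X in is_derive (X + _)](scale0r (e3 i)).
apply/is_derive_line.
have -> : (fun h : R => phi (x - (h *: e3 i + y))) =
    (fun t : R => phi (t *: e3 i + (x - y))) \o -%R.
  by apply/funext => h /=; rewrite scaleNr opprD addrCA.
have D : is_derive (- 0 : R) (1 : R) (fun t : R => phi (t *: e3 i + (x - y))) ('D_(e3 i) phi (x - y)).
  by apply/is_derive_line; rewrite oppr0 scale0r add0r; apply: derivableP; exact: CkS_derivable Cp _.
have H := @is_derive1_comp R _ -%R 0 _ (- 1) D _.
by apply: is_derive_eq (H _) _; rewrite ?mulrN1.
Qed.

Lemma reflect_Ck k phi x : Ck k phi -> Ck k (fun y => phi (x - y)).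
Proof.
elim: k phi => [|k IH] phi Cp; first exact: reflect_continuous.
apply: (Ck_is_derive (df := fun i y => -1 * 'D_(e3 i) phi (x - y))).
- by apply: reflect_continuous; exact: Ck_continuous Cp.
- move=> i y; rewrite mulN1r; apply: reflect_is_derive.
  exact: Ck_C1 Cp.
- by move=> i; apply: CkZ; exact: (IH _ (CkS_derive i Cp)).
Qed.

(** The test function is [phi (x - y)] in the variable [y]; the sign from the reflection cancels the
    sign in [weak_partial]. *)
Lemma conv_weak_partial u g phi i : weak_partial i u g -> Ccoo phi ->
  conv u ('D_(e3 i) phi) = conv g phi.
Proof.
move=> [lu lg h] [Cp /compact_vanish[N N0 pN]]; apply/funext => x.
have tphi : Ccoo (fun y => phi (x - y)).
  split; first by move=> k; exact: reflect_Ck.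
  exact: vanish_compact (reflect_vanish pN (lexx `|x|)).
have := h _ tphi; rewrite -/(conv g phi x) => /(congr1 -%R); rewrite opprK => <-.
have -> : (fun y => u y * 'D_(e3 i) (fun y => phi (x - y)) y) = (fun y => -1 * (u y * 'D_(e3 i) phi (x - y))).
  by apply/funext => y; case: (reflect_is_derive i x y (Cp 1%N)) => _ ->; ring.
rewrite RintegralZl//; first by rewrite mulN1r opprK.
exact: (conv_integrable x lu (Ck_continuous (CkS_derive i (Cp 1%N))) (@vanish_derive _ _ _ i pN)).
Qed.

Lemma conv_vanish u phi M N : vanish M u -> vanish N phi -> vanish (M + N) (conv u phi).
Proof.
move=> uM pN x xMN; rewrite /conv (_ : (fun y => _) = cst 0).
  by rewrite Rintegral_cst// mul0r.
apply/funext => y /=; have [yM|yM] := ltP M `|y|; first by rewrite uM// mul0r.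
rewrite pN ?mulr0//; have := lerB_dist x y; lra.
Qed.

Lemma moll_vanish (e : R) : 0 < e -> vanish e (moll e).
Proof. by move=> e0 x ex; rewrite moll_eq0// ltW. Qed.

Lemma moll_Ccoo (e : R) : 0 < e -> Ccoo (moll e).
Proof.
move=> e0; split; first by move=> k; exact: moll_Ck.
exact: vanish_compact (moll_vanish e0).
Qed.

Lemma moll_Rint e x : 0 < e -> \int[leb3]_y moll e (x - y) = 1.
Proof. by move=> e0; rewrite /Rintegral moll_int. Qed.

Lemma moll_continuous (e : R) : continuous (moll e).
Proof. exact: Ck_continuous (moll_Ck e 0). Qed.

(** [moll e] is a probability density, so [f x] can be brought under the integral, and only points
    within [e] of [x] contribute. *)
Lemma conv_moll_dist f d e : continuous f -> 0 < e ->
  forall x, (forall y, `|x - y| < e -> `|f y - f x| <= d) -> `|conv f (moll e) x - f x| <= d.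
Proof.
move=> cf e0 x h.
have cm := @moll_continuous e; have mv := moll_vanish e0.
have i1 := conv_integrable x (continuous_loc_integrable cf) cm mv.
have i2 : leb3.-integrable setT (EFin \o (fun y => moll e (x - y))).
  exact: (continuous_vanish_integrable (@reflect_continuous _ x cm) (reflect_vanish mv (lexx `|x|))).
have i3 (c : R) : leb3.-integrable setT (EFin \o (fun y => c * moll e (x - y))).
  by apply: (integrableZl measurableT c i2).
have -> : f x = \int[leb3]_y (f x * moll e (x - y)) by rewrite RintegralZl// moll_Rint// mulr1.
rewrite /conv -(RintegralB measurableT i1 (i3 (f x))).
have i4 : leb3.-integrable setT (EFin \o (fun y => f y * moll e (x - y) - f x * moll e (x - y))).
  by have := integrableB measurableT i1 (i3 (f x)); apply: eq_integrable.
apply: (le_trans (le_normr_Rintegral measurableT i4)).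
have -> : d = \int[leb3]_y (d * moll e (x - y)) by rewrite RintegralZl// moll_Rint// mulr1.
apply: le_Rintegral => //; first exact: integrable_abse i4.
move=> y _; rewrite -mulrBl normrM (ger0_norm (moll_ge0 _ e0)).
have [xy|xy] := ltP `|x - y| e; first by rewrite ler_wpM2r ?moll_ge0// h.
by rewrite moll_eq0// !mulr0.
Qed.

Lemma Cc_moll_unif f : Cc f -> forall d, 0 < d -> exists2 e0, 0 < e0 &
  forall e, 0 < e < e0 -> forall x, `|conv f (moll e) x - f x| <= d.
Proof.
move=> [cf /compact_vanish[N N0 fN]] d d0.
have [r r0 rP] := vanish_unif_continuous cf fN d0.
exists r => // e /andP[e0 er] x; apply: conv_moll_dist => // y xy.
by rewrite distrC; apply/ltW/rP; apply: lt_trans er.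
Qed.

Lemma conv_Ccoo f e : Cc f -> 0 < e -> Ccoo (conv f (moll e)).
Proof.
move=> [cf /compact_vanish[N N0 fN]] e0; split.
  by move=> k; apply: (conv_Ck (continuous_loc_integrable cf) (moll_Ck e k) (moll_vanish e0)).
exact: vanish_compact (conv_vanish fN (moll_vanish e0)).
Qed.

End convolution.

(** * Uniqueness of weak derivatives *)

Section du_bois_reymond.
Context {R : realType}.
Implicit Types (f g u v h phi : R3 R -> R) (N M : R) (x y : R3 R).

Lemma loc_integrableD f g : loc_integrable3 f -> loc_integrable3 g ->
  loc_integrable3 (fun x => f x + g x).
Proof.
move=> [mf hf] [mg hg]; split; first exact: measurable_funD.
move=> K cK.
have mK : measurable (K : set (mR3 R)).
  by apply: closed_measurable3; apply: compact_closed cK; exact: norm_hausdorff.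
by have := integrableD mK (hf _ cK) (hg _ cK); apply: eq_integrable.
Qed.

Lemma loc_integrableZ (a : R) f : loc_integrable3 f -> loc_integrable3 (fun x => a * f x).
Proof.
move=> [mf hf]; split; first exact: measurable_funM.
move=> K cK.
have mK : measurable (K : set (mR3 R)).
  by apply: closed_measurable3; apply: compact_closed cK; exact: norm_hausdorff.
by have := integrableZl mK a (hf _ cK); apply: eq_integrable.
Qed.

Lemma test_integrable f phi : loc_integrable3 f -> Cc phi ->
  leb3.-integrable setT (fun x => (f x * phi x)%:E).
Proof.
by move=> lf [cp /compact_vanish[N N0 pN]]; exact: loc_integrable_mul lf cp pN.
Qed.

Lemma Ccoo_Cc phi : Ccoo phi -> Cc phi.
Proof. by move=> [h c]; split => //; exact: (h 0%N). Qed.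

Lemma Ccoo_derive phi i : Ccoo phi -> Ccoo ('D_(e3 i) phi).
Proof.
move=> [Cp /compact_vanish[N N0 pN]]; split.
  by move=> k; apply: CkS_derive; exact: (Cp k.+1).
exact: vanish_compact (@vanish_derive _ _ _ i pN).
Qed.

Lemma weak_partial_lin i (a : R) u v g h : weak_partial i u g -> weak_partial i v h ->
  weak_partial i (fun x => a * u x + v x) (fun x => a * g x + h x).
Proof.
move=> [lu lg ug] [lv lh vh]; split.
- by apply: loc_integrableD => //; exact: loc_integrableZ.
- by apply: loc_integrableD => //; exact: loc_integrableZ.
move=> phi Cp.
have E (f k b : R3 R -> R) : loc_integrable3 f -> loc_integrable3 k -> Cc b ->
    \int[leb3]_x ((a * f x + k x) * b x) = a * \int[leb3]_x (f x * b x) + \int[leb3]_x (k x * b x).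
  move=> lf lk Cb; have i1 := test_integrable lf Cb; have i2 := test_integrable lk Cb.
  rewrite -RintegralZl// -RintegralD//.
    by apply: eq_Rintegral => x _; ring.
  by have := integrableZl measurableT a i1; apply: eq_integrable.
have Cp' := Ccoo_Cc Cp; have Cdp := Ccoo_Cc (Ccoo_derive i Cp).
by rewrite !E// ug// vh// mulrN opprD.
Qed.

Lemma integral_Cc_eq0 g : loc_integrable3 g ->
  (forall phi, Ccoo phi -> \int[leb3]_x (g x * phi x) = 0) ->
  forall f, Cc f -> \int[leb3]_x (g x * f x) = 0.
Proof.
move=> lg h f Cf; have [cf /compact_vanish[N N0 fN]] := Cf.
set I := \int[leb3]_(y in box (N + 1)) `|g y|.
have I0 : 0 <= I by apply: Rintegral_ge0.
apply/eqP; rewrite -normr_le0; apply/ler_addgt0Pl => d d0; rewrite addr0.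
have dI : 0 < d / (I + 1) by rewrite divr_gt0// ltr_wpDl.
have [e0 e00 P] := Cc_moll_unif Cf dI.
(* The bound 1 keeps the mollified function supported in the box of radius [N + 1] over which [I] is
   taken. *)
pose e := Num.min (e0 / 2) 1.
have e_gt0 : 0 < e by rewrite lt_min ltr01 divr_gt0.
have ee0 : e < e0 by rewrite gt_min ltr_pdivrMr// ltr_pMr// ltr1n.
have Cfe := conv_Ccoo Cf e_gt0.
rewrite -[X in `|X|]subr0 -(h _ Cfe).
apply: (@le_trans _ _ (d / (I + 1) * I)).
  apply: integral_test_dist => //.
  - exact: (Ccoo_Cc Cfe).1.
  - by move=> y yN; rewrite fN//; lra.
  - move=> y yN; apply: (conv_vanish fN (moll_vanish e_gt0)).
    by apply: le_lt_trans yN; rewrite lerD2l ge_min lexx orbT.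
  - by move=> y; rewrite distrC; apply: P; rewrite e_gt0.
by rewrite mulrAC ler_pdivrMr ?ltr_wpDl// ler_wpM2l// ?lerDl// ltW.
Qed.

Definition cutoff0 M x : R := Num.max 0 (Num.min 1 (M + 1 - `|x|)).

Lemma cutoff0_Cc M : Cc (cutoff0 M).
Proof.
split.
  have cn : continuous (fun x : R3 R => M + 1 - `|x|).
    by move=> x; apply: cvgB; [exact: cvg_cst|exact: norm_continuous].
  move=> x; apply: (@continuous_max _ _ (fun=> 0) (fun x => Num.min 1 (M + 1 - `|x|))).
    exact: cst_continuous.
  by apply: (@continuous_min _ _ (fun=> 1) (fun x => M + 1 - `|x|)); [exact: cst_continuous|exact: cn].
apply: (@vanish_compact _ (M + 1)) => x xM.
by rewrite /cutoff0 max_l// ge_min; apply/orP; right; rewrite subr_le0 ltW.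
Qed.

Lemma cutoff0_ge0 M x : 0 <= cutoff0 M x.
Proof. by rewrite /cutoff0 le_max lexx. Qed.

Lemma cutoff0_eq1 M x : `|x| <= M -> cutoff0 M x = 1.
Proof. by move=> xM; rewrite /cutoff0 min_l ?max_r//; lra. Qed.

Lemma CcM f g : Cc f -> continuous g -> Cc (fun x => f x * g x).
Proof.
move=> [cf /compact_vanish[N N0 fN]] cg; split.
  by move=> x; apply: cvgM; [exact: cf|exact: cg].
by apply: (@vanish_compact _ N) => x xN; rewrite fN// mul0r.
Qed.

(** Let [f] be a continuous approximation of the indicator of [g >= 0] and [chi] a cutoff. Then
    [chi (2 f - 1)] is in [Cc] and close to [chi] times the sign of [g], so that the integral of
    [|g| chi] is arbitrarily small. *)
Lemma du_bois_reymond g : loc_integrable3 g ->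
  (forall phi, Ccoo phi -> \int[leb3]_x (g x * phi x) = 0) ->
  {ae leb3, forall x : mR3 R, g x = 0}.
Proof.
move=> lg h.
have mg : measurable_fun [set: mR3 R] g := lg.1.
have key (n : nat) : {ae leb3, forall x : mR3 R, `|x : R3 R| <= n%:R -> g x = 0}.
  pose chi := @cutoff0 n%:R.
  have Cchi : Cc chi by exact: cutoff0_Cc.
  have igc := test_integrable lg Cchi.
  pose w x := `|g x| * chi x.
  have w0 x : 0 <= w x by rewrite mulr_ge0 ?cutoff0_ge0.
  have iw : leb3.-integrable setT (EFin \o w).
    have := integrable_abse igc; apply: eq_integrable => // x _ /=.
    by rewrite normrM [`|chi x|]ger0_norm ?cutoff0_ge0.
  have mw : measurable_fun [set: mR3 R] (EFin \o w) by case/integrableP: iw.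
  pose A : set (mR3 R) := [set x | 0 <= g x].
  have mA : measurable A.
    have := mg measurableT _ (measurable_itv `[0, +oo[); rewrite setTI.
    by congr measurable; apply/seteqP; split => x /=; rewrite in_itv/= andbT.
  have w_eq0 : \int[leb3]_x w x = 0.
    apply/eqP; rewrite eq_le; apply/andP; split; last by apply: Rintegral_ge0.
    apply/ler_addgt0Pl => e e0; rewrite addr0.
    have [_ /(_ (e / 2) (divr_gt0 e0 (ltr0n _ 2)))[f [cf f01 fe]]] :=
      measurable_approximable w0 iw mA.
    have Cf : Cc (fun x => chi x * (2 * f x - 1)).
      apply: CcM => // x; apply: cvgB; last exact: cvg_cst.
      by apply: cvgM; [exact: cvg_cst|exact: cf].
    have zero := integral_Cc_eq0 lg h Cf.
    have if2 := test_integrable lg Cf.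
    have mf := continuous_measurable3 cf.
    have md : measurable_fun [set: mR3 R] (fun x => `|\1_A x - f x| * w x).
      apply: measurable_funM; last exact/measurable_EFinP.
      by apply: measurableT_comp => //; apply: measurable_funB => //; exact: measurable_indic.
    have id : leb3.-integrable setT (EFin \o (fun x => `|\1_A x - f x| * w x)).
      apply: le_integrable iw => //; first exact/measurable_EFinP.
      move=> x _; rewrite /= lee_fin normrM normr_id [leRHS]ger0_norm//.
      rewrite [`|w x|]ger0_norm// ler_piMl// indicE ler_norml.
      by have /andP[? ?] := f01 x; case: (_ \in _); apply/andP; split => /=; lra.
    have id2 : leb3.-integrable setT (EFin \o (fun x => 2 * (`|\1_A x - f x| * w x))).
      by have := integrableZl measurableT 2 id; apply: eq_integrable.
    rewrite -[leLHS]subr0 -zero -RintegralB//.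
    apply: (@le_trans _ _ (\int[leb3]_x (2 * (`|\1_A x - f x| * w x)))).
      apply: le_Rintegral => //.
        by have := integrableB measurableT iw if2; apply: eq_integrable.
      move=> x _; rewrite /w.
      (* Both signs of [g] are covered by [|g| = g (2 \1_A - 1)]. *)
      have -> : `|g x| * chi x - g x * (chi x * (2 * f x - 1)) = 2 * ((\1_A x - f x) * g x * chi x).
        rewrite indicE; have [g0|g0] := leP 0 (g x).
          by rewrite mem_set// ger0_norm// mulr1n; ring.
        rewrite memNset; last by rewrite /A/=; apply/negP; rewrite -ltNge.
        by rewrite ltr0_norm// mulr0n; ring.
      rewrite ler_wpM2l// mulrA ler_wpM2r ?cutoff0_ge0//.
      by rewrite (le_trans (ler_norm _))// normrM.
    rewrite RintegralZl// -ler_pdivlMl// mulrC.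
    rewrite -lee_fin /Rintegral fineK; first exact: ltW.
    by rewrite ge0_fin_numE; [exact: lt_trans fe (ltey _)|apply: integral_ge0 => x _; rewrite lee_fin mulr_ge0].
  have : (\int[leb3]_x `|(EFin \o w) x|)%E = 0%E.
    have := w_eq0; rewrite /Rintegral => w_eq0'.
    transitivity (\int[leb3]_x (w x)%:E)%E.
      by apply: eq_integral => x _; rewrite /= ger0_norm.
    by rewrite -[LHS]fineK ?w_eq0'//; exact: integrable_fin_num.
  move=> /(ae_eq_integral_abs _ measurableT mw); apply: filterS => x /= /(_ I) [].
  move=> wx xn; move: wx; rewrite /w /chi cutoff0_eq1// mulr1 => /eqP.
  by rewrite normr_eq0 => /eqP.
have := ae_foralln key; apply: filterS => x hx.
by apply: (hx (Num.truncn `|x : R3 R|).+1); rewrite ltW// truncnS_gt.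
Qed.

Lemma weak_partial_unique i u g h : weak_partial i u g -> weak_partial i u h ->
  {ae leb3, forall x : mR3 R, g x = h x}.
Proof.
move=> [lu lg ug] [_ lh uh].
have /du_bois_reymond : loc_integrable3 (fun x => -1 * h x + g x).
  by apply: loc_integrableD => //; exact: loc_integrableZ.
have H phi : Ccoo phi -> \int[leb3]_x ((-1 * h x + g x) * phi x) = 0.
  move=> Cp; have Cp' := Ccoo_Cc Cp.
  have i1 := test_integrable lg Cp'; have i2 := test_integrable lh Cp'.
  have -> : (fun x => (-1 * h x + g x) * phi x) = (fun x => g x * phi x - h x * phi x).
    by apply/funext => x; ring.
  by rewrite RintegralB//; apply/eqP; rewrite subr_eq0 -eqr_opp -ug// -uh.
move=> /(_ H); apply: filterS => x /eqP.
by rewrite mulN1r addrC subr_eq0 => /eqP.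
Qed.

Lemma wgradP i u g : weak_partial i u g -> weak_partial i u (wgrad i u).
Proof. by move=> ug; exact: (xgetPex (fun=> 0) (ex_intro _ g ug)). Qed.

Lemma wgrad_ae i u g : weak_partial i u g -> {ae leb3, forall x : mR3 R, wgrad i u x = g x}.
Proof. by move=> ug; exact: weak_partial_unique (wgradP ug) ug. Qed.

Lemma ae_loc_integrable u v : loc_integrable3 u -> measurable_fun [set: mR3 R] v ->
  {ae leb3, forall x : mR3 R, u x = v x} -> loc_integrable3 v.
Proof.
move=> [mu hu] mv uv; apply: loc_integrable_box => // N N0.
have /integrableP[_] := hu _ (@compact_box _ N).
apply: le_lt_trans; rewrite le_eqVlt; apply/orP; left; apply/eqP.
apply: ae_eq_integral.
- exact: measurable_box.
- by apply: measurable_funTS; apply: measurableT_comp => //; exact/measurable_EFinP.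
- by apply: measurable_funTS; apply: measurableT_comp => //; exact/measurable_EFinP.
- by apply: filterS uv => x /= -> _.
Qed.

Lemma ae_weak_partial i u v g : measurable_fun [set: mR3 R] v ->
  {ae leb3, forall x : mR3 R, u x = v x} -> weak_partial i u g -> weak_partial i v g.
Proof.
move=> mv uv [lu lg ug]; have lv := ae_loc_integrable lu mv uv.
split => // phi Cp; rewrite -ug//.
have /measurable_EFinP mdp := continuous_measurable3 (Ccoo_Cc (Ccoo_derive i Cp)).1.
rewrite /Rintegral; congr fine; apply: ae_eq_integral => //.
- by apply/measurable_EFinP; apply: measurable_funM => //; exact/measurable_EFinP.
- by apply/measurable_EFinP; apply: measurable_funM; [exact: lu.1|exact/measurable_EFinP].
- by apply: filterS uv => x /= -> _.
Qed.

End du_bois_reymond.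
(** * The weight [psi^2] *)

Section weight.
Context {R : realType}.
Implicit Types (x y z : R3 R) (N e a : R).

Lemma enorm3_ge0 x : 0 <= enorm3 x.
Proof. exact: sqrtr_ge0. Qed.

Lemma enorm3_sqr x : enorm3 x ^+ 2 = x.1.1 ^+ 2 + x.1.2 ^+ 2 + x.2 ^+ 2.
Proof. by rewrite sqr_sqrtr// !addr_ge0// sqr_ge0. Qed.

Lemma le_norm_enorm3 x : `|x| <= enorm3 x.
Proof.
have E := enorm3_sqr x; have h := enorm3_ge0 x.
have le (t : R) : t ^+ 2 <= enorm3 x ^+ 2 -> `|t| <= enorm3 x.
  by move=> t2; rewrite -(ger0_norm h) -ler_sqr ?nnegrE// !real_normK ?num_real.
have := sqr_ge0 x.1.1; have := sqr_ge0 x.1.2; have := sqr_ge0 x.2 => *.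
by rewrite norm3_le; apply/and3P; split; apply: le; rewrite E; lra.
Qed.

Lemma enorm3_le x : enorm3 x <= 2 * `|x|.
Proof.
have := lexx `|x|; rewrite norm3_le => /and3P[h1 h2 h3].
have le (t : R) : `|t| <= `|x| -> t ^+ 2 <= `|x| ^+ 2.
  by move=> h; rewrite -[t ^+ 2]real_normK ?num_real// lerXn2r ?nnegrE.
rewrite -ler_sqr ?nnegrE ?enorm3_ge0 ?mulr_ge0// enorm3_sqr.
have := le _ h1; have := le _ h2; have := le _ h3; have := sqr_ge0 `|x|; nra.
Qed.

Lemma enorm3_eq0 x : (enorm3 x == 0) = (x == 0).
Proof.
apply/idP/eqP => [/eqP h|->].
  by apply/eqP; rewrite -normr_le0; have := le_norm_enorm3 x; rewrite h.
by apply/eqP/le_anti; rewrite enorm3_ge0 andbT; have := enorm3_le 0; rewrite normr0 mulr0.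
Qed.

Lemma enorm3_gt0 x : x != 0 -> 0 < enorm3 x.
Proof. by move=> x0; rewrite lt_neqAle enorm3_ge0 eq_sym enorm3_eq0 x0. Qed.

Lemma enorm3D x y : enorm3 (x + y) <= enorm3 x + enorm3 y.
Proof.
have hx := enorm3_ge0 x; have hy := enorm3_ge0 y.
rewrite -ler_sqr ?nnegrE ?enorm3_ge0 ?addr_ge0// sqrrD !enorm3_sqr.
suff h : x.1.1 * y.1.1 + x.1.2 * y.1.2 + x.2 * y.2 <= enorm3 x * enorm3 y.
  have -> : (x + y).1.1 = x.1.1 + y.1.1 by [].
  have -> : (x + y).1.2 = x.1.2 + y.1.2 by [].
  have -> : (x + y).2 = x.2 + y.2 by [].
  move: h; move: (enorm3 x) (enorm3 y) x.1.1 x.1.2 x.2 y.1.1 y.1.2 y.2 => p q a b c a' b' c'.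
  by rewrite -mulr_natr => h; lra.
apply: le_trans (ler_norm _) _; rewrite -ler_sqr ?nnegrE ?mulr_ge0//.
rewrite real_normK ?num_real// exprMn !enorm3_sqr.
move: x.1.1 x.1.2 x.2 y.1.1 y.1.2 y.2 => a b c a' b' c'.
have := sqr_ge0 (a * b' - b * a'); have := sqr_ge0 (a * c' - c * a').
have := sqr_ge0 (b * c' - c * b') => h1 h2 h3.
(* Lagrange's identity, which gives Cauchy-Schwarz in [R^3]. *)
rewrite -subr_ge0 (_ : _ - _ = (a * b' - b * a') ^+ 2 + (a * c' - c * a') ^+ 2 + (b * c' - c * b') ^+ 2).
  by rewrite !addr_ge0.
by ring.
Qed.

(* Dyadic shells: on [2^-(k+1) a < |x| <= 2^-k a] one has
   [|x|^-2 <= 4^(k+1) / a^2], and the shell has volume at most [8 (2^-k a)^3]. *)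
Lemma integral_box_norm_sqV a : 0 < a ->
  (\int[leb3]_(x in box a) (`|x : R3 R| ^- 2)%:E <= (64 * a)%:E)%E.
Proof.
move=> a0.
pose t (k : nat) (x : mR3 R) : \bar R := ((4 ^+ k.+1 / a ^+ 2) * \1_(box (2 ^- k * a)) x)%:E.
have r0 (k : nat) : 0 < 2 ^- k * a by rewrite mulr_gt0// invr_gt0 exprn_gt0.
have c0 (k : nat) : (0 : R) <= 4 ^+ k.+1 / a ^+ 2 by rewrite divr_ge0 ?sqr_ge0// exprn_ge0.
have mt k : measurable_fun [set: mR3 R] (t k).
  apply/measurable_EFinP; apply: measurable_funM => //.
  by apply: measurable_indic; exact: measurable_box.
have t0 k x : (0 <= t k x)%E by rewrite lee_fin; apply: mulr_ge0.
have mn : measurable_fun [set: mR3 R] (fun x => (`|x : R3 R| ^- 2)%:E).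
  apply/measurable_EFinP.
  rewrite (_ : (fun _ => _) = (@powR R ^~ (- 2)) \o (fun x : R3 R => `|x|)).
    apply: measurableT_comp; first exact: measurable_powR.
    by apply: continuous_measurable3; exact: norm_continuous.
  by apply/funext => x /=; rewrite powRN powR_mulrn.
apply: (@le_trans _ _ (\int[leb3]_x \sum_(0 <= k <oo) t k x)%E).
  rewrite integral_mkcond; apply: ge0_le_integral => //.
  - by move=> x _; apply: erestrict_ge0 => y _; rewrite lee_fin invr_ge0 exprn_ge0.
  - apply/(measurable_restrictT _ _).1; first exact: measurable_box.
    exact: measurable_funTS.
  - by apply: ge0_emeasurable_sum.
  - move=> x _; rewrite patchE; case: ifPn => [|_]; last by apply: nneseries_ge0.
    rewrite inE /box/= => xa.
    (* The inverse of 0 is 0, so the integrand vanishes at the origin. *)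
    have [x0|x0] := eqVneq (x : R3 R) 0.
      by rewrite x0 normr0 expr0n/= invr0; apply: nneseries_ge0.
    have nx0 : 0 < `|x : R3 R| by rewrite normr_gt0.
    have ex : exists k, 2 ^- k * a < `|x : R3 R|.
      exists (Num.truncn (a / `|x : R3 R|)).+1.
      rewrite mulrC ltr_pdivrMr ?exprn_gt0// mulrC -ltr_pdivrMr//.
      apply: (@lt_le_trans _ _ (Num.truncn (a / `|x : R3 R|)).+1%:R); first exact: truncnS_gt.
      by rewrite -natrX ler_nat ltnW// ltn_expl.
    (* The least such index is positive because [|x| <= a]; its predecessor names the shell of
       [x]. *)
    case: (ex_minnP ex) => -[|k] h1 h2.
      by move: h1; rewrite expr0 invr1 mul1r ltNge xa.
    have h3 : `|x : R3 R| <= 2 ^- k * a.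
      by rewrite leNgt; apply/negP => /h2; rewrite ltnn.
    apply: (@le_trans _ _ (t k x)); last first.
      have := @nneseries_lim_ge _ (fun k => t k x) xpredT 0 k.+1 (fun n _ _ => t0 n x).
      apply: le_trans; rewrite big_nat_recr//= leeDr//.
      by apply: sume_ge0.
    rewrite /t lee_fin indicE mem_set// mulr1.
    have -> : (4 ^+ k.+1 / a ^+ 2 : R) = (2 ^- k.+1 * a) ^- 2.
      have -> : (4 : R) = 2 * 2 by rewrite -natrM.
      have p0 : (2 : R) ^+ k.+1 != 0 by rewrite expf_neq0.
      rewrite exprMn; move: (2 ^+ k.+1) p0 => p p0; field.
      by rewrite p0 lt0r_neq0.
    by rewrite ler_pV2 ?inE ?unitfE ?lt0r_neq0 ?exprn_gt0 ?r0//= lerXn2r ?nnegrE ?(ltW (r0 _)) ?ltW.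
rewrite integral_nneseries//.
(* The [k]-th term is [4^(k+1) / a^2] times the volume [8 (2^-k a)^3], that is [64 a / 2^(k+1)]. *)
have -> : (64 * a)%:E = (\sum_(0 <= k <oo) ((64 * a) / (2 ^ (k + 1))%:R)%:E)%E.
  have /cvg_lim := @cvg_geometric_eseries_half R (64 * a) 0.
  by rewrite expr0 divr1 => ->.
apply: lee_nneseries => [k _ _|k _]; first exact: integral_ge0.
rewrite /t; under eq_integral do rewrite EFinM.
rewrite ge0_integralZl//; last 2 first.
- by apply/measurable_EFinP/measurable_indic; exact: measurable_box.
- by rewrite lee_fin; exact: c0.
rewrite integral_indic ?setIT//; last exact: measurable_box.
rewrite [X in (_ * X)%E]leb3_box ?(ltW (r0 k))// -EFinM lee_fin.
rewrite le_eqVlt; apply/orP; left; apply/eqP.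
rewrite addn1 natrX !exprS expr0 -!exprVn.
have -> : (4 : R) = 2 * 2 by rewrite -natrM.
rewrite exprMn.
have : (2 : R) ^+ k != 0 by rewrite expf_neq0.
rewrite !exprVn; move: (2 ^+ k) => p p0; field.
by rewrite p0 lt0r_neq0.
Qed.

End weight.
Section psi_weight.
Context {R : realType}.
Variable gamma : R.
Hypothesis gamma0 : 0 < gamma.
Implicit Types (x y z : R3 R) (N e a : R) (u : R3 R -> R).

Local Notation m := (psi2dx gamma).
Local Notation kappa := (gamma / (2 * pi)).

Lemma psi_const_gt0 : 0 < kappa.
Proof. by rewrite divr_gt0// mulr_gt0// pi_gt0. Qed.

Definition psi2 x : R := psi gamma x ^+ 2.

(** At the origin both sides are 0, since the inverse of 0 is 0. *)
Lemma psi2E x : psi2 x = kappa * expR (- (2 * gamma * enorm3 x)) * enorm3 x ^- 2.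
Proof.
have h1 : Num.sqrt gamma ^+ 2 = gamma by rewrite sqr_sqrtr// ltW.
have h2 : Num.sqrt (2 * pi) ^+ 2 = 2 * pi :> R.
  by rewrite sqr_sqrtr// mulr_ge0// pi_ge0.
rewrite /psi2 /psi !exprMn !exprVn h1 h2 -[RHS]mulrA; congr (_ * (_ * _)).
by rewrite expr2 -expRD; congr expR; ring.
Qed.

Lemma psi2_ge0 x : 0 <= psi2 x.
Proof. exact: sqr_ge0. Qed.

Lemma psi2_le x : psi2 x <= kappa * `|x| ^- 2.
Proof.
rewrite psi2E; have k0 := psi_const_gt0.
have [->|x0] := eqVneq x 0.
  have /eqP -> : enorm3 (0 : R3 R) == 0 by rewrite enorm3_eq0.
  by rewrite expr0n/= invr0 mulr0 normr0 expr0n/= invr0 mulr0.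
have n0 : 0 < `|x| by rewrite normr_gt0.
have e0 := enorm3_gt0 x0.
apply: ler_pM.
- by rewrite mulr_ge0 ?expR_ge0// ltW.
- by rewrite invr_ge0 sqr_ge0.
- have h : expR (- (2 * gamma * enorm3 x)) <= 1.
    by rewrite -[leRHS]expR0 ler_expR oppr_le0 !mulr_ge0 ?enorm3_ge0// ltW.
  by rewrite ler_piMr// ltW.
- rewrite lef_pV2 ?posrE ?exprn_gt0//.
  by apply: lerXn2r (le_norm_enorm3 x); rewrite nnegrE ltW.
Qed.

(** The formula of [psi2E] decreases in the Euclidean norm, which is at most [2 N] on the box. The
    origin is excluded because [psi] has the value 0 there. *)
Lemma psi2_ge N x : x != 0 -> `|x| <= N ->
  kappa * expR (- (4 * gamma * N)) * (2 * N) ^- 2 <= psi2 x.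
Proof.
move=> x0 xN; rewrite psi2E; have k0 := psi_const_gt0.
have e0 := enorm3_gt0 x0.
have N0 : 0 < N by apply: lt_le_trans xN; rewrite normr_gt0.
have eN : enorm3 x <= 2 * N by apply: le_trans (enorm3_le x) _; rewrite ler_pM2l.
apply: ler_pM.
- by rewrite mulr_ge0 ?expR_ge0// ltW.
- by rewrite invr_ge0 sqr_ge0.
- rewrite ler_pM2l// ler_expR lerN2.
  by rewrite (_ : 4 * gamma * N = 2 * gamma * (2 * N)); [rewrite ler_pM2l// mulr_gt0|ring].
- have N2 : 0 < 2 * N by rewrite mulr_gt0.
  rewrite lef_pV2 ?posrE ?exprn_gt0//.
  by apply: lerXn2r eN; rewrite nnegrE ltW.
Qed.

Lemma psi2_gt0 x : x != 0 -> 0 < psi2 x.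
Proof.
move=> x0; rewrite psi2E; have e0 := enorm3_gt0 x0; have k0 := psi_const_gt0.
apply: mulr_gt0; first by apply: mulr_gt0 => //; exact: expR_gt0.
by rewrite invr_gt0 exprn_gt0.
Qed.

Lemma measurable_psi2 : measurable_fun [set: mR3 R] psi2.
Proof. by apply: measurable_funX; exact: measurable_psi. Qed.

Lemma integral_psi2dx (f : mR3 R -> \bar R) : measurable_fun setT f ->
  (forall x, 0 <= f x)%E -> (\int[m]_x f x = \int[leb3]_x (f x * (psi2 x)%:E))%E.
Proof.
by move=> mf f0; apply: ge0_integral_density => //; [exact: psi2_ge0|exact: measurable_psi2].
Qed.

Lemma integral_box_psi2 a : 0 < a ->
  (\int[leb3]_(x in box a) (psi2 x)%:E <= (64 * kappa * a)%:E)%E.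
Proof.
move=> a0; have k0 := psi_const_gt0.
have mn : measurable_fun [set: mR3 R] (fun x => (`|x : R3 R| ^- 2)%:E).
  apply/measurable_EFinP.
  rewrite (_ : (fun _ => _) = (@powR R ^~ (- 2)) \o (fun x : R3 R => `|x|)).
    apply: measurableT_comp; first exact: measurable_powR.
    by apply: continuous_measurable3; exact: norm_continuous.
  by apply/funext => x /=; rewrite powRN powR_mulrn.
apply: (@le_trans _ _ (\int[leb3]_(x in box a) (kappa%:E * (`|x : R3 R| ^- 2)%:E))%E).
  apply: ge0_le_integral.
  - exact: measurable_box.
  - by move=> x _; rewrite lee_fin psi2_ge0.
  - by apply: measurable_funTS; apply/measurable_EFinP; exact: measurable_psi2.
  - by apply: measurable_funTS; apply: measurable_funeM.
  - by move=> x _; rewrite -EFinM lee_fin psi2_le.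
rewrite ge0_integralZl//.
- rewrite (_ : 64 * kappa * a = kappa * (64 * a)); last by ring.
  rewrite [leRHS]EFinM; apply: lee_wpmul2l; first by rewrite lee_fin ltW.
  exact: integral_box_norm_sqV.
- exact: measurable_box.
- exact: measurable_funTS.
- by rewrite lee_fin ltW.
Qed.

Lemma psi2dx_box_lty a : 0 < a -> (m (box a) < +oo)%E.
Proof. by move=> a0; apply: le_lt_trans (integral_box_psi2 a0) (ltry _). Qed.

Lemma leb3_ball_gt0 x e : 0 < e -> (0 < leb3 (ball x e : set (mR3 R)))%E.
Proof.
move=> e0.
have -> : (ball x e : set (mR3 R)) = (ball x.1.1 e `*` ball x.1.2 e) `*` ball x.2 e.
  rewrite -!ball_normE; apply/seteqP; split => y /=; rewrite norm3_lt/=.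
    by move=> /and3P[-> -> ->].
  by move=> [[-> ->] ->].
have p (t : R) : (0 < @lebesgue_measure R (ball t e))%E.
  by rewrite lebesgue_measure_ball ?ltW// lte_fin mulrn_wgt0.
have mb (t : R) : measurable (ball t e : set (measurableTypeR R)) by exact: measurable_ball.
rewrite [X in (_ < X)%E](_ : _ = @leb2s R (ball x.1.1 e `*` ball x.1.2 e) * @lebesgue_measure R (ball x.2 e))%E; last first.
  by apply: product_measure1E => //; exact: measurableX.
rewrite mule_gt0//.
rewrite [X in (_ < X)%E](_ : _ = @lebesgue_measure R (ball x.1.1 e) * @lebesgue_measure R (ball x.1.2 e))%E.
  by rewrite mule_gt0.
exact: product_measure1E.
Qed.

Lemma leb3_set10 : leb3 [set (0 : R3 R)] = 0%E.
Proof.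
apply/eqP; rewrite eq_le measure_ge0 andbT; apply/lee_addgt0Pr => e e0.
rewrite add0e.
have m1 : measurable ([set (0 : R3 R)] : set (mR3 R)).
  by apply: closed_measurable3; apply: accessible_closed_set1; apply: hausdorff_accessible; exact: norm_hausdorff.
pose d := Num.min 1 (e / 8).
have d0 : 0 < d by rewrite lt_min ltr01 divr_gt0.
apply: (@le_trans _ _ (leb3 (box d))).
  apply: le_measure; rewrite ?inE//; first exact: measurable_box.
  by move=> x ->; rewrite /box/= normr0 ltW.
rewrite [leLHS]leb3_box ?(ltW d0)// lee_fin.
have d1 : d <= 1 by rewrite ge_min lexx.
have d2 : d <= e / 8 by rewrite ge_min lexx orbT.
have d3 : d ^+ 3 <= d by rewrite -[leRHS]expr1 ler_wiXn2l// ltW.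
rewrite exprMn; have -> : (2 : R) ^+ 3 = 8 by rewrite -natrX.
lra.
Qed.

Lemma ae_neq0 : {ae leb3, forall x : mR3 R, (x : R3 R) != 0}.
Proof.
exists [set (0 : R3 R)]; split.
- by apply: closed_measurable3; apply: accessible_closed_set1; apply: hausdorff_accessible; exact: norm_hausdorff.
- exact: leb3_set10.
- by move=> x /= /negP; rewrite negbK => /eqP.
Qed.

(** The density vanishes only at the origin, a Lebesgue-null set, so the two measures have the same
    null sets. This links weak derivatives, defined with [leb3], to classes in [L^2(psi^2 dx)]. *)
Lemma psi2dx_ae (P : mR3 R -> Prop) : {ae m, forall x, P x} <-> {ae leb3, forall x, P x}.
Proof.
have mw (A : set (mR3 R)) : measurable_fun A (fun x => (psi2 x)%:E).
  by apply: measurable_funTS; apply/measurable_EFinP; exact: measurable_psi2.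
split=> -[A [mA A0 PA]]; last first.
  exists A; split => //.
  rewrite -[LHS]/(\int[leb3]_(x in A) (psi2 x)%:E)%E.
  by apply: null_set_integral.
have : (\int[leb3]_(x in A) `|(psi2 x)%:E| = 0)%E.
  rewrite -[RHS]A0; apply: eq_integral => x _.
  by rewrite gee0_abs// lee_fin psi2_ge0.
move=> /(ae_eq_integral_abs _ mA (mw A)) h.
have : {ae leb3, forall x : mR3 R, ~ A x}.
  apply: filterS2 h ae_neq0 => x h x0 Ax; have [] := h Ax.
  by move=> w0; have := psi2_gt0 x0; rewrite w0 ltxx.
apply: filterS => x nAx; apply: contrapT => nPx; apply: nAx; exact: PA.
Qed.

Lemma psi2dx_radon : radon_full_support m.
Proof.
split=> [K cK|U oU [x0 Ux0]].
  have [N N0 KN] := compact_sub_box cK.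
  apply: le_lt_trans (psi2dx_box_lty N0).
  apply: le_measure => //; rewrite inE; last exact: measurable_box.
  by apply: closed_measurable3; apply: compact_closed cK; exact: norm_hausdorff.
rewrite lt_neqAle measure_ge0 andbT; apply/eqP => mU0.
have mU := open_measurable3 oU.
have : {ae m, forall x : mR3 R, ~ U x}.
  by exists U; split => // x /= /contrapT.
move=> /psi2dx_ae[A [mA A0 UA]].
have /nbhs_ballP[e /= e0 eU] : nbhs x0 U by apply: open_nbhs_nbhs.
have := leb3_ball_gt0 x0 e0; rewrite lt_neqAle => /andP[+ _] => /negP; apply.
rewrite eq_le measure_ge0/= -A0; apply: le_measure; rewrite ?inE//.
  by apply: open_measurable3; exact: ball_open.
by move=> x xe; apply: UA => /=; apply; exact: eU.
Qed.

(* [|u| <= d + u^2 / d], and [psi^2 >= c] on the box off the origin. *)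
Lemma L2_integral_box N : 0 < N -> exists2 c, 0 < c & forall u d,
  measurable_fun [set: mR3 R] u -> 0 < d ->
  (\int[leb3]_(x in box N) `|(u x)%:E| <= (d * (2 * N) ^+ 3)%:E + (d * c)^-1%:E * sqint m u)%E.
Proof.
move=> N0; have k0 := psi_const_gt0.
have c0 : 0 < kappa * expR (- (4 * gamma * N)) * (2 * N) ^- 2.
  apply: mulr_gt0; first by apply: mulr_gt0 => //; exact: expR_gt0.
  by rewrite invr_gt0 exprn_gt0// mulr_gt0.
exists (kappa * expR (- (4 * gamma * N)) * (2 * N) ^- 2).
  exact: c0.
move=> u d mu d0; set c := _ * _ ^- 2 in c0 *.
have dc0 : 0 < (d * c)^-1 by rewrite invr_gt0 mulr_gt0.
have mu2 := measurable_sq mu.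
have mw : measurable_fun [set: mR3 R] (fun x => (psi2 x)%:E).
  by apply/measurable_EFinP; exact: measurable_psi2.
have m2 : measurable_fun [set: mR3 R] (fun x => (u x ^+ 2)%:E * (psi2 x)%:E)%E.
  exact: emeasurable_funM.
have mB := @measurable_box R N.
apply: (@le_trans _ _ (\int[leb3]_(x in box N) (d%:E + (d * c)^-1%:E * ((u x ^+ 2)%:E * (psi2 x)%:E)))%E).
  apply: ae_ge0_le_integral => //.
  - by apply: measurable_funTS; apply: measurableT_comp => //; exact/measurable_EFinP.
  - move=> x _; rewrite -!EFinM -EFinD lee_fin addr_ge0 ?(ltW d0)//.
    by rewrite mulr_ge0 ?(ltW dc0)// mulr_ge0 ?sqr_ge0 ?psi2_ge0.
  - by apply: measurable_funTS; apply: emeasurable_funD => //; exact: measurable_funeM.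
  - apply: filterS ae_neq0 => x x0 xN.
    rewrite -!EFinM -EFinD lee_fin.
    have := psi2_ge x0 xN; rewrite -/c => cw.
    apply: (@le_trans _ _ (d + d^-1 * u x ^+ 2)).
      rewrite -[u x ^+ 2]real_normK ?num_real//; move: `|u x| (normr_ge0 (u x)) => t t0.
      have [td|td] := leP t d; first by rewrite ler_wpDr// mulr_ge0 ?sqr_ge0// invr_ge0 ltW.
      rewrite ler_wpDl ?(ltW d0)// expr2 mulrA ler_peMl// mulrC -ler_pdivrMr ?invr_gt0//.
      by rewrite invrK mul1r ltW.
    rewrite lerD2l invfM -mulrA ler_pM2l ?invr_gt0// mulrCA ler_peMr ?sqr_ge0//.
    by rewrite mulrC ler_pdivlMr// mul1r.
rewrite ge0_integralD//; last 3 first.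
- by move=> x _; rewrite lee_fin ltW.
- by move=> x _; rewrite -!EFinM lee_fin mulr_ge0 ?(ltW dc0)// mulr_ge0 ?sqr_ge0 ?psi2_ge0.
- by apply: measurable_funTS; apply: measurable_funeM.
rewrite integral_cst// [leb3 _]leb3_box ?(ltW N0)// -EFinM leeD2l//.
rewrite ge0_integralZl//; last 3 first.
- exact: measurable_funTS.
- by move=> x _; rewrite -EFinM lee_fin mulr_ge0 ?sqr_ge0 ?psi2_ge0.
- by rewrite lee_fin ltW.
rewrite lee_pmul2l ?lte_fin// /sqint integral_psi2dx//; last by move=> x; rewrite lee_fin sqr_ge0.
apply: ge0_subset_integral => //.
by move=> x _; rewrite -EFinM lee_fin mulr_ge0 ?sqr_ge0 ?psi2_ge0.
Qed.

Lemma L2_loc_integrable u : L2 m u -> loc_integrable3 u.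
Proof.
move=> [mu fu]; apply: loc_integrable_box => // N N0.
have [c c0 h] := L2_integral_box N0.
apply: le_lt_trans (h u 1 mu ltr01) _.
by rewrite lte_add_pinfty ?ltry// lte_mul_pinfty// lee_fin invr_ge0 mulr_ge0// ltW.
Qed.

End psi_weight.

(** * The A_1 condition and boundedness of mollification *)

Section mollification_L2.
Context {R : realType}.
Variable gamma : R.
Hypothesis gamma0 : 0 < gamma.
Implicit Types (x y z : R3 R) (N e a : R) (u f g : R3 R -> R).

Local Notation m := (psi2dx gamma).
Local Notation kappa := (gamma / (2 * pi)).
Local Notation w := (psi2 gamma).

(** The Euclidean norm of [y] is at most 4 times that of [x], whence 16 from the inverse square. It
    exceeds that of [x] by at most 2, whence [expR (4 * gamma)]. *)
Lemma psi2_near x y : `|y| <= 2 * `|x| -> enorm3 (y - x) <= 2 -> y != 0 ->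
  w x <= 16 * expR (4 * gamma) * w y.
Proof.
move=> yx yx2 y0; rewrite !psi2E//; have k0 := psi_const_gt0 gamma0.
have ey := enorm3_gt0 y0.
have exy : enorm3 y <= 4 * enorm3 x.
  have := enorm3_le y; have := le_norm_enorm3 x; lra.
have ex : 0 < enorm3 x by lra.
have tri : enorm3 y <= enorm3 x + 2.
  have := enorm3D x (y - x); rewrite addrC subrK; lra.
rewrite (_ : 16 * _ * _ = kappa * (expR (4 * gamma) * expR (- (2 * gamma * enorm3 y))) * (16 * enorm3 y ^- 2)); last by ring.
have h1 : expR (- (2 * gamma * enorm3 x)) <= expR (4 * gamma) * expR (- (2 * gamma * enorm3 y)).
  rewrite -expRD ler_expR -subr_ge0 (_ : _ - _ = 2 * gamma * (enorm3 x + 2 - enorm3 y)); last by ring.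
  by rewrite !mulr_ge0 ?subr_ge0// ltW.
have h2 : enorm3 x ^- 2 <= 16 * enorm3 y ^- 2.
  rewrite ler_pdivlMr ?exprn_gt0// mulrC ler_pdivrMr ?exprn_gt0//.
  by rewrite (_ : 16 * _ = (4 * enorm3 x) ^+ 2); [apply: lerXn2r exy; rewrite nnegrE; lra|ring].
apply: ler_pM h2.
- by apply: mulr_ge0; [exact: ltW|exact: expR_ge0].
- by rewrite invr_ge0 sqr_ge0.
- by rewrite ler_pM2l.
Qed.

(* [psi^2] is a Muckenhoupt A_1 weight, uniformly on scales at most 1. *)
Lemma psi2_A1 : exists2 K, 0 < K & forall e y, 0 < e <= 1 -> y != 0 ->
  (\int[leb3]_x (w x * moll e (x - y))%:E <= (K * w y)%:E)%E.
Proof.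
have k0 := psi_const_gt0 gamma0.
pose C : R := (expR (- 2) ^+ 2) ^- 3.
have C0 : 0 < C by rewrite invr_gt0 !exprn_gt0// expR_gt0.
pose A : R := 16 * expR (4 * gamma).
have A0 : 0 < A by rewrite mulr_gt0// expR_gt0.
(* For the case [|y| < 2e]: [64 * 3] comes from the mass of [psi^2] on [box (3 * e)], [C] from
   [moll_le], and 16 with [expR (8 * gamma)] from the lower bound [kappa exp(- 8 gamma) (4e)^-2] for
   the weight at [y], valid as [e <= 1]. *)
pose B : R := (64 * 3 * 16) * C * expR (8 * gamma).
have B0 : 0 < B by apply: mulr_gt0; [exact: mulr_gt0|exact: expR_gt0].
exists (A + B); first exact: addr_gt0.
move=> e y /andP[e0 e1] y0.
have wy := psi2_gt0 gamma0 y0.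
have mw := measurable_psi2 gamma.
have mm z : measurable_fun [set: mR3 R] (fun x => moll e (z - x)).
  by apply: continuous_measurable3; apply: reflect_continuous; exact: moll_continuous.
have mwm : measurable_fun [set: mR3 R] (fun x => (w x * moll e (x - y))%:E).
  apply/measurable_EFinP; apply: measurable_funM => //.
  rewrite (_ : (fun x => _) = (fun x => moll e (y - x))); first exact: mm.
  by apply/funext => x; rewrite moll_even.
(* If [|y| >= 2e], then [|x - y| < e] forces [|y| <= 2 |x|] and [psi2_near] applies. Otherwise the
   support of the mollifier around [y] lies in [box (3 * e)]. *)
have [ye|ye] := leP (2 * e) `|y|.
  apply: (@le_trans _ _ (\int[leb3]_x ((A * w y)%:E * (moll e (y - x))%:E))%E).
    apply: ge0_le_integral => //.
    - by move=> x _; rewrite lee_fin mulr_ge0 ?psi2_ge0// moll_ge0.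
    - by apply: measurable_funeM; exact/measurable_EFinP.
    - move=> x _; rewrite -EFinM lee_fin moll_even.
      have [xy|xy] := leP e `|y - x|; first by rewrite moll_eq0// !mulr0.
      rewrite ler_wpM2r ?moll_ge0//; apply: psi2_near => //.
        have := lerB_dist y x; lra.
      have := enorm3_le (y - x); lra.
  rewrite ge0_integralZl//.
  - rewrite moll_int// mule1 lee_fin ler_wpM2r ?psi2_ge0//; lra.
  - by apply/measurable_EFinP.
  - by move=> x _; rewrite lee_fin moll_ge0.
  - by rewrite lee_fin mulr_ge0 ?ltW.
have e30 : 0 < 3 * e by rewrite mulr_gt0.
have mB := @measurable_box R (3 * e).
apply: (@le_trans _ _ (\int[leb3]_(x in box (3 * e)) ((C * e ^- 3)%:E * (w x)%:E))%E).
  rewrite [leRHS]integral_mkcond; apply: ge0_le_integral => //.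
  - by move=> x _; rewrite lee_fin mulr_ge0 ?psi2_ge0// moll_ge0.
  - apply/(measurable_restrictT _ _).1 => //.
    by apply: measurable_funTS; apply: measurable_funeM; exact/measurable_EFinP.
  - move=> x _; rewrite patchE; case: ifPn => [_|].
      by rewrite -EFinM lee_fin mulrC ler_wpM2r ?psi2_ge0// moll_le.
    rewrite notin_setE /box/= => /negP; rewrite -ltNge => xe.
    by rewrite moll_eq0// ?mulr0//; have := lerB_dist x y; lra.
have Ce : 0 < C * e ^- 3 by rewrite mulr_gt0// invr_gt0 exprn_gt0.
rewrite ge0_integralZl//; last 3 first.
- by apply: measurable_funTS; exact/measurable_EFinP.
- by move=> x _; rewrite lee_fin psi2_ge0.
- by rewrite lee_fin ltW.
apply: (@le_trans _ _ ((C * e ^- 3)%:E * (64 * kappa * (3 * e))%:E)%E).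
  by apply: lee_wpmul2l; [rewrite lee_fin ltW|exact: integral_box_psi2].
rewrite -EFinM lee_fin.
apply: (@le_trans _ _ (B * w y)); last by rewrite ler_pM2r//; lra.
have yN : `|y| <= 2 * e by exact: ltW.
apply: (@le_trans _ _ (B * (kappa * expR (- (8 * gamma)) * (2 * (2 * e)) ^- 2))).
  rewrite [leRHS](_ : _ = (64 * 3 * 16) * C * kappa *
    (expR (8 * gamma) * expR (- (8 * gamma))) * (2 * (2 * e)) ^- 2); last by rewrite /B; ring.
  rewrite -expRD subrr expR0 mulr1 le_eqVlt; apply/orP; left; apply/eqP.
  have E (c k : R) : c * e ^- 3 * (64 * k * (3 * e)) = 64 * 3 * 16 * c * k * (2 * (2 * e)) ^- 2.
    by field; rewrite lt0r_neq0.
  exact: E.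
rewrite ler_pM2l//; apply: le_trans (psi2_ge gamma0 y0 yN).
rewrite ler_pM2r ?invr_gt0 ?exprn_gt0 ?mulr_gt0//.
apply: ler_wpM2l; first exact: ltW.
rewrite ler_expR lerN2 (_ : 8 * gamma = 4 * gamma * (2 * 1)); last by ring.
by rewrite ler_pM2l ?mulr_gt0// ler_pM2l.
Qed.

(** Jensen's inequality for the probability density [moll e (x - y)]. *)
Lemma conv_moll_sqr_le u e x : loc_integrable3 u -> 0 < e ->
  ((conv u (moll e) x ^+ 2)%:E <= \int[leb3]_y (u y ^+ 2 * moll e (x - y))%:E)%E.
Proof.
move=> lu e0; set A := conv _ _ _.
have cm := @moll_continuous R e; have mv := @moll_vanish R _ e0.
have i1 := conv_integrable x lu cm mv.
have i2 : leb3.-integrable setT (EFin \o (fun y => moll e (x - y))).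
  exact: (continuous_vanish_integrable (@reflect_continuous _ _ x cm) (reflect_vanish mv (lexx `|x|))).
have m2 : measurable_fun [set: mR3 R] (fun y => (u y ^+ 2 * moll e (x - y))%:E).
  apply/measurable_EFinP; apply: measurable_funM.
    by apply: measurable_funX; exact: lu.1.
  by case/integrableP : i2 => /measurable_EFinP.
have ge0 y : (0 <= (u y ^+ 2 * moll e (x - y))%:E)%E.
  by rewrite lee_fin mulr_ge0 ?sqr_ge0// moll_ge0.
have [->|fin] := eqVneq (\int[leb3]_y (u y ^+ 2 * moll e (x - y))%:E)%E +oo%E; first by rewrite leey.
have i3 : leb3.-integrable setT (EFin \o (fun y => u y ^+ 2 * moll e (x - y))).
  apply/integrableP; split => //; rewrite ltey; apply/eqP => h; apply: (negP fin); rewrite -h.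
  by apply/eqP/eq_integral => y _; rewrite /= ger0_norm// -lee_fin.
have i4 : leb3.-integrable setT (EFin \o (fun y => 2 * A * (u y * moll e (x - y)))).
  by have := integrableZl measurableT (2 * A) i1; apply: eq_integrable.
have i5 : leb3.-integrable setT (EFin \o (fun y => A ^+ 2 * moll e (x - y))).
  by have := integrableZl measurableT (A ^+ 2) i2; apply: eq_integrable.
rewrite -(fineK (integrable_fin_num measurableT i3)) lee_fin.
rewrite -[leRHS]/(\int[leb3]_y (u y ^+ 2 * moll e (x - y))).
(* The tangent inequality [2 A s - A^2 <= s^2] at [s = u y] is integrated, [A] being the average
   itself. *)
have -> : A ^+ 2 = \int[leb3]_y (2 * A * (u y * moll e (x - y)) - A ^+ 2 * moll e (x - y)).
  rewrite (RintegralB measurableT i4 i5) (RintegralZl _ measurableT i1) (RintegralZl _ measurableT i2).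
  by rewrite moll_Rint// -/(conv u (moll e) x) -/A; ring.
apply: le_Rintegral => //.
  by have := integrableB measurableT i4 i5; apply: eq_integrable.
move=> y _; have := sqr_ge0 (u y - A); have := moll_ge0 (x - y) e0 => h1 h2.
rewrite mulrA -mulrBl ler_wpM2r//; nra.
Qed.

Lemma measurable_moll_sub e :
  measurable_fun [set: mR3 R * mR3 R] (fun xy : mR3 R * mR3 R => moll e (xy.1 - xy.2 : R3 R)).
Proof.
have ms : measurable_fun [set: mR3 R * mR3 R] (fun xy : mR3 R * mR3 R => (xy.1 - xy.2 : R3 R) : mR3 R).
  apply/measurable_fun_pairP; split; first apply/measurable_fun_pairP; first split.
  - apply: (@measurable_funB _ _ R _ (fun xy : mR3 R * mR3 R => xy.1.1.1) (fun xy : mR3 R * mR3 R => xy.2.1.1)).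
      exact: measurableT_comp measurable_fst (measurableT_comp measurable_fst measurable_fst).
    exact: measurableT_comp measurable_fst (measurableT_comp measurable_fst measurable_snd).
  - apply: (@measurable_funB _ _ R _ (fun xy : mR3 R * mR3 R => xy.1.1.2) (fun xy : mR3 R * mR3 R => xy.2.1.2)).
      exact: measurableT_comp measurable_snd (measurableT_comp measurable_fst measurable_fst).
    exact: measurableT_comp measurable_snd (measurableT_comp measurable_fst measurable_snd).
  - apply: (@measurable_funB _ _ R _ (fun xy : mR3 R * mR3 R => xy.1.2) (fun xy : mR3 R * mR3 R => xy.2.2)).
      exact: measurableT_comp measurable_snd measurable_fst.
    exact: measurableT_comp measurable_snd measurable_snd.
apply: measurableT_comp ms; apply: continuous_measurable3; exact: moll_continuous.
Qed.

(** Jensen's inequality followed by Tonelli's theorem moves the averaging from [u^2] to the weight,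
    where [psi2_A1] bounds it with a constant independent of [e]. *)
Lemma conv_moll_L2_bound : exists2 K, 0 < K & forall e u, 0 < e <= 1 -> L2 m u ->
  (sqint m (conv u (moll e)) <= K%:E * sqint m u)%E.
Proof.
have [K K0 KP] := psi2_A1; exists K => // e u e01 Lu.
have e0 : 0 < e by case/andP: e01.
have lu := L2_loc_integrable gamma0 Lu; have mu : measurable_fun [set: mR3 R] u := lu.1.
have mw := measurable_psi2 gamma.
have cc : continuous (conv u (moll e)).
  exact: (conv_continuous lu (@moll_continuous _ e) (moll_vanish e0)).
have mc := continuous_measurable3 cc.
pose F (xy : mR3 R * mR3 R) : \bar R := (u xy.2 ^+ 2 * moll e (xy.1 - xy.2 : R3 R) * w xy.1)%:E.
have F0 xy : (0 <= F xy)%E by rewrite lee_fin mulr_ge0 ?psi2_ge0// mulr_ge0 ?sqr_ge0// moll_ge0.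
have mF : measurable_fun [set: mR3 R * mR3 R] F.
  apply/measurable_EFinP; apply: measurable_funM; last exact: measurableT_comp mw measurable_fst.
  apply: measurable_funM; last exact: measurable_moll_sub.
  by apply: measurable_funX; exact: measurableT_comp mu measurable_snd.
have mFx := @measurable_fun_fubini_tonelli_F _ _ _ _ R leb3s F mF F0.
have mFy := @measurable_fun_fubini_tonelli_G _ _ _ _ R leb3s F mF F0.
rewrite /fubini_F in mFx; rewrite /fubini_G in mFy.
rewrite /sqint integral_psi2dx//; last 2 first.
- exact: measurable_sq.
- by move=> x; rewrite lee_fin sqr_ge0.
apply: (@le_trans _ _ (\int[@leb3s R]_x \int[@leb3s R]_y F (x, y))%E).
  apply: ge0_le_integral => //.
  - by move=> x _; rewrite mule_ge0// lee_fin ?sqr_ge0 ?psi2_ge0.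
  - by apply: emeasurable_funM; [exact: measurable_sq|exact/measurable_EFinP].
  - move=> x _; rewrite /F /=.
    under [leRHS]eq_integral => y _ do rewrite EFinM.
    rewrite ge0_integralZr//=.
    + by apply: lee_wpmul2r; [rewrite lee_fin psi2_ge0|exact: conv_moll_sqr_le].
    + apply/measurable_EFinP; apply: measurable_funM; first exact: measurable_funX.
      by apply: continuous_measurable3; apply: reflect_continuous; exact: moll_continuous.
    + by move=> y _; rewrite lee_fin mulr_ge0 ?sqr_ge0// moll_ge0.
    + by rewrite lee_fin psi2_ge0.
rewrite (@fubini_tonelli _ _ _ _ R leb3s leb3s F mF F0).
rewrite integral_psi2dx//; last 2 first.
- exact: measurable_sq.
- by move=> x; rewrite lee_fin sqr_ge0.
rewrite -ge0_integralZl//; last 3 first.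
- by apply: emeasurable_funM; [exact: measurable_sq|exact/measurable_EFinP].
- by move=> x _; rewrite mule_ge0// lee_fin ?sqr_ge0 ?psi2_ge0.
- by rewrite lee_fin ltW.
(* The comparison holds only almost everywhere: [psi2_A1] excludes the origin. *)
apply: ae_ge0_le_integral => //.
- by move=> y _; apply: integral_ge0.
- by move=> x _; rewrite mule_ge0 ?lee_fin ?(ltW K0)// mulr_ge0 ?sqr_ge0 ?psi2_ge0.
- by apply: measurable_funeM; apply: emeasurable_funM; [exact: measurable_sq|exact/measurable_EFinP].
- apply: filterS (@ae_neq0 R) => y y0 _; rewrite /F /=.
  under eq_integral => x _ do rewrite -mulrA EFinM [moll _ _ * _]mulrC.
  rewrite ge0_integralZl//=.
  + rewrite muleCA; apply: lee_wpmul2l; first by rewrite lee_fin sqr_ge0.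
    by rewrite -EFinM; exact: KP.
  + apply/measurable_EFinP; apply: measurable_funM => //.
    rewrite (_ : (fun x => _) = (fun x => moll e (y - x))); last first.
      by apply/funext => x; rewrite moll_even.
    by apply: continuous_measurable3; apply: reflect_continuous; exact: moll_continuous.
  + by move=> x _; rewrite lee_fin mulr_ge0 ?psi2_ge0// moll_ge0.
  + by rewrite lee_fin sqr_ge0.
Qed.

End mollification_L2.
(** * Density of [C_c] and mollification in [L^2(psi^2 dx)] *)

Section sqint_limits.
Context d (T : measurableType d) (R : realType).
Variable m : {measure set T -> \bar R}.

Lemma sqint_dominated (h : nat -> T -> R) (f g : T -> R) :
  (forall n, measurable_fun setT (h n)) -> measurable_fun setT f -> L2 m g ->
  (forall n x, `|h n x - f x| <= `|g x|) ->
  (forall x, h n x @[n --> \oo] --> f x) ->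
  forall e : R, 0 < e -> exists N, forall n, (N <= n)%N ->
    (sqint m (fun x => h n x - f x)%R < e%:E)%E.
Proof.
move=> mh mf [mg gg] hg hf e e0.
pose F n x := ((h n x - f x) ^+ 2)%:E.
have mF n : measurable_fun setT (F n) by apply: measurable_sq; exact: measurable_funB.
have Fc x : F n x @[n --> \oo] --> 0%E.
  apply: cvg_EFin; first exact: nearW.
  have c : h n x - f x @[n --> \oo] --> 0.
    by rewrite -(subrr (f x)); apply: cvgB => //; exact: cvg_cst.
  have := cvgM c c; rewrite mul0r => cc.
  rewrite (_ : fine \o _ = (fun n => (h n x - f x) * (h n x - f x)))//.
  exact: cc.
have [_ _ FF] : [/\ m.-integrable setT (cst 0%E), [sequence (\int[m]_x `|F n x - cst 0 x|)%E]_n @ \oo --> 0%E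
    & [sequence (\int[m]_x F n x)%E]_n @ \oo --> (\int[m]_x cst 0 x)%E].
  apply: (dominated_convergence measurableT mF _ _ (L2_integrable (conj mg gg)) _) => //.
  - by apply/aeW => x _; exact: Fc.
  - apply/aeW => x n _ /=; rewrite lee_fin ger0_norm ?sqr_ge0//.
    rewrite -[leLHS]real_normK ?num_real// -[leRHS]real_normK ?num_real//.
    by rewrite lerXn2r ?nnegrE.
rewrite integral0 in FF.
have /fine_cvgP[fin /cvgrPdist_lt/(_ _ e0) lt] := FF.
have [N _ NP] : \forall n \near \oo, (sqint m (fun x => h n x - f x)%R < e%:E)%E.
  near=> n.
  have fn : sqint m (fun x => h n x - f x) \is a fin_num by near: n.
  rewrite -(fineK fn) lte_fin.
  have : `|0 - fine (sqint m (fun x => h n x - f x))| < e by near: n.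
  by rewrite sub0r normrN; apply: le_lt_trans; exact: ler_norm.
by exists N.
Unshelve. all: by end_near. Qed.

Lemma lte2D (x y : \bar R) (a b : R) : (x < a%:E)%E -> (y < b%:E)%E ->
  (2%:E * x + 2%:E * y < (2 * a + 2 * b)%:E)%E.
Proof.
move=> xa yb; rewrite [ltRHS](_ : _ = 2%:E * a%:E + 2%:E * b%:E)%E.
  by apply: lteD; rewrite lte_pmul2l.
by rewrite -!EFinM -EFinD.
Qed.

Lemma sqint_split (f g h : T -> R) (a b : R) : measurable_fun setT f ->
  measurable_fun setT g -> measurable_fun setT h ->
  (sqint m (fun x => f x - g x)%R < a%:E)%E -> (sqint m (fun x => g x - h x)%R < b%:E)%E ->
  (sqint m (fun x => f x - h x)%R < (2 * a + 2 * b)%:E)%E.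
Proof.
move=> mf mg mh fa gb.
have -> : (fun x => f x - h x) = (fun x => (f x - g x) + (g x - h x)).
  by apply/funext => x; rewrite addrA subrK.
apply: le_lt_trans (sqintD _ _ _) _; [exact: measurable_funB|exact: measurable_funB|].
exact: lte2D.
Qed.

End sqint_limits.

Section density_Cc.
Import HBNNSimple.
Context {R : realType}.
Variable gamma : R.
Hypothesis gamma0 : 0 < gamma.
Implicit Types (x y z : R3 R) (N e a : R) (u f g h : R3 R -> R).

Local Notation m := (psi2dx gamma).
Local Notation w := (psi2 gamma).

Lemma sqint_bounded_vanish f N M : 0 < N -> measurable_fun [set: mR3 R] f ->
  (forall x, `|f x| <= M) -> vanish N f -> (sqint m f <= (M ^+ 2)%:E * m (box N))%E.
Proof.
move=> N0 mf fM fN; have M0 : 0 <= M by apply: le_trans (fM 0).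
rewrite -integral_cst; last exact: measurable_box.
rewrite [leRHS]integral_mkcond; apply: ge0_le_integral => //.
- by move=> x _; rewrite lee_fin sqr_ge0.
- exact: measurable_sq.
- apply/(measurable_restrictT _ _).1; first exact: measurable_box.
  exact: measurable_cst.
- move=> x _; rewrite patchE; case: ifPn => [_|].
    by rewrite lee_fin -[f x ^+ 2]real_normK ?num_real// lerXn2r ?nnegrE.
  rewrite notin_setE /box/= => /negP; rewrite -ltNge => xN.
  by rewrite fN// expr0n.
Qed.

Lemma vanish_uniform_sqint N d : 0 < N -> 0 < d -> exists2 s, 0 < s & forall f,
  measurable_fun [set: mR3 R] f -> (forall x, `|f x| <= s) -> vanish N f ->
  (sqint m f < d%:E)%E.
Proof.
move=> N0 d0; have Bfin : m (box N) \is a fin_num by rewrite ge0_fin_numE// psi2dx_box_lty.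
set b := fine (m (box N)); have b0 : 0 <= b by rewrite fine_ge0.
have b1 : 0 < b + 1 by rewrite ltr_wpDl.
(* The entry 1 gives [s^2 <= s], and the other entry then bounds [s] times the mass of the box. *)
have s0 : 0 < Num.min 1 (d / (b + 1)) by rewrite lt_min ltr01 divr_gt0.
exists (Num.min 1 (d / (b + 1))) => // f mf fs fN.
apply: le_lt_trans (sqint_bounded_vanish N0 mf fs fN) _.
rewrite -[X in (_ * X)%E](fineK Bfin) -EFinM lte_fin -/b.
apply: (@le_lt_trans _ _ (d / (b + 1) * b)).
  apply: ler_wpM2r => //; apply: (@le_trans _ _ (Num.min 1 (d / (b + 1)))).
    by rewrite expr2 ler_piMr ?(ltW s0)// ge_min lexx.
  by rewrite ge_min lexx orbT.
by rewrite mulrAC ltr_pdivrMr// ltr_pM2l// ltrDl.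
Qed.

Lemma bounded_vanish_L2 f N M : measurable_fun [set: mR3 R] f ->
  (forall x, `|f x| <= M) -> vanish N f -> L2 m f.
Proof.
move=> mf fM fN; split => //.
have N'0 : 0 < `|N| + 1 by rewrite ltr_wpDl.
apply: le_lt_trans (sqint_bounded_vanish N'0 mf fM _) _.
  by move=> x xN; rewrite fN// (le_lt_trans _ xN)// (le_trans (ler_norm N))// lerDl.
by rewrite lte_mul_pinfty ?lee_fin ?sqr_ge0// psi2dx_box_lty.
Qed.

Lemma Cc_L2 f : Cc f -> L2 m f.
Proof.
move=> [cf /compact_vanish[N N0 fN]].
have [M M0 fM] := continuous_vanish_bounded cf fN.
exact: bounded_vanish_L2 (continuous_measurable3 cf) fM fN.
Qed.

Lemma CcD f g : Cc f -> Cc g -> Cc (fun x => f x + g x).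
Proof.
move=> [cf /compact_vanish[N N0 fN]] [cg /compact_vanish[M M0 gM]]; split.
  by move=> x; apply: cvgD; [exact: cf|exact: cg].
apply: (@vanish_compact _ (Num.max N M)) => x; rewrite gt_max => /andP[xN xM].
by rewrite fN// gM// addr0.
Qed.

Lemma CcZ a f : Cc f -> Cc (fun x => a * f x).
Proof.
move=> Cf; rewrite (_ : (fun _ => _) = fun x => f x * a); last by apply/funext => x; rewrite mulrC.
by apply: CcM => // x; exact: cvg_cst.
Qed.

Lemma Cc0 : Cc (fun=> 0 : R).
Proof. by split; [move=> x; exact: cvg_cst|apply: (@vanish_compact _ 0)]. Qed.

(** The closure of [Cc] in [L^2(psi^2 dx)]. Its stability under limits and linear combinations
    carries the passage from indicators to simple functions to all of [L^2]. *)
Definition Cc_approx f := L2 m f /\ forall e, 0 < e ->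
  exists2 g, Cc g & (sqint m (fun x => f x - g x)%R < e%:E)%E.

Lemma Cc_approx_lim f : L2 m f -> (forall e, 0 < e -> exists2 h, Cc_approx h &
   (sqint m (fun x => f x - h x)%R < e%:E)%E) -> Cc_approx f.
Proof.
move=> Lf H; split => // e e0; have e4 : 0 < e / 4 by rewrite divr_gt0.
have [h [Lh /(_ _ e4)[g Cg hg]] fh] := H _ e4; exists g => //.
have := sqint_split Lf.1 Lh.1 (Cc_L2 Cg).1 fh hg.
by congr (_ < _%:E)%E; field.
Qed.

Lemma Cc_approx_lin a f g : Cc_approx f -> Cc_approx g -> Cc_approx (fun x => a * f x + g x).
Proof.
move=> [Lf hf] [Lg hg]; split; first by apply: L2D => //; exact: L2Z.
move=> e e0.
have a1 : 0 < a ^+ 2 + 1 by rewrite ltr_wpDl ?sqr_ge0.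
have e1 : 0 < e / 4 / (a ^+ 2 + 1) by rewrite !divr_gt0.
have e4 : 0 < e / 4 by rewrite divr_gt0.
have [f' Cf ff] := hf _ e1; have [g' Cg gg] := hg _ e4.
exists (fun x => a * f' x + g' x); first by apply: CcD => //; exact: CcZ.
have mf := Lf.1; have mg := Lg.1; have mf' := (Cc_L2 Cf).1; have mg' := (Cc_L2 Cg).1.
have -> : (fun x => a * f x + g x - (a * f' x + g' x)) = (fun x => a * (f x - f' x) + (g x - g' x)).
  by apply/funext => x; ring.
have mff : measurable_fun [set: mR3 R] (fun x => f x - f' x) by exact: measurable_funB.
have mgg : measurable_fun [set: mR3 R] (fun x => g x - g' x) by exact: measurable_funB.
apply: le_lt_trans (sqintD _ (measurable_funM (measurable_cst a) mff) mgg) _.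
rewrite sqintZ//.
have -> : e = 2 * (e / 4) + 2 * (e / 4) by field.
apply: lte2D => //.
apply: (@le_lt_trans _ _ ((a ^+ 2)%:E * (e / 4 / (a ^+ 2 + 1))%:E)%E).
  by apply: lee_wpmul2l; [rewrite lee_fin sqr_ge0|exact: ltW].
by rewrite -!EFinM lte_fin mulrA ltr_pdivrMr// mulrC ltr_pM2l//; lra.
Qed.

Lemma Cc_approx0 : Cc_approx (fun=> 0).
Proof.
split; first exact: L20.
move=> e e0; exists (fun=> 0); first exact: Cc0.
rewrite /sqint; under eq_integral do rewrite subrr expr0n.
by rewrite integral0 lte_fin.
Qed.

Lemma Cc_approx_indic N (A : set (mR3 R)) : 0 < N -> measurable A -> A `<=` box N ->
  Cc_approx \1_A.
Proof.
move=> N0 mA AN.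
have I01 (x : mR3 R) : 0 <= (\1_A x : R) <= 1 by rewrite indicE; case: (_ \in _); rewrite /= lexx ler01.
have mI : measurable_fun [set: mR3 R] (\1_A : mR3 R -> R) by exact: measurable_indic.
have IN : vanish N (\1_A : R3 R -> R).
  move=> x Nx; rewrite indicE memNset// => /AN; rewrite /box/= => xN.
  by move: Nx; rewrite ltNge xN.
split.
  apply: (bounded_vanish_L2 (M := 1) mI _ IN) => x.
  by have /andP[? ?] := I01 x; rewrite ger0_norm.
move=> e e0.
pose chi := @cutoff0 R N; have Cchi : Cc chi := @cutoff0_Cc _ N.
have mchi := continuous_measurable3 Cchi.1.
have chi1 x : chi x <= 1 by rewrite /chi /cutoff0 ge_max ler01 ge_min lexx.
have chi0 x : 0 <= chi x := @cutoff0_ge0 _ N x.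
have mw := measurable_psi2 gamma.
(* The indicator is approximated in [L^1(chi psi^2 dx)]; the same [chi] then gives the approximant
   compact support. *)
have ic : leb3.-integrable setT (EFin \o (fun x => chi x * w x)).
  have [mc fc] := Cc_L2 Cchi.
  have [Nc Nc0 cN] := compact_vanish Cchi.2.
  apply/integrableP; split; first by apply/measurable_EFinP; exact: measurable_funM.
  apply: le_lt_trans (psi2dx_box_lty gamma0 Nc0).
  rewrite -[leRHS]/(\int[leb3]_(x in box Nc) (w x)%:E)%E [leRHS]integral_mkcond.
  apply: ge0_le_integral => //.
  - by apply: measurableT_comp => //; apply/measurable_EFinP; exact: measurable_funM.
  - apply/(measurable_restrictT _ _).1; first exact: measurable_box.
    by apply: measurable_funTS; exact/measurable_EFinP.
  - move=> x _; rewrite patchE /=; case: ifPn => [_|].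
      rewrite lee_fin [leLHS]ger0_norm; last by rewrite mulr_ge0 ?psi2_ge0.
      by rewrite ler_piMl ?psi2_ge0.
    rewrite notin_setE /box/= => /negP; rewrite -ltNge => xN.
    by rewrite cN// mul0r normr0.
have cw0 x : 0 <= chi x * w x by rewrite mulr_ge0 ?psi2_ge0.
have [_ /(_ _ e0)[f [cf f01 fe]]] := measurable_approximable cw0 ic mA.
exists (fun x => chi x * f x); first exact: CcM.
apply: le_lt_trans fe.
have mf := continuous_measurable3 cf.
rewrite /sqint integral_psi2dx//; last 2 first.
- by apply: measurable_sq; apply: measurable_funB => //; exact: measurable_funM.
- by move=> x; rewrite lee_fin sqr_ge0.
apply: ge0_le_integral => //.
- by move=> x _; rewrite -EFinM lee_fin mulr_ge0 ?sqr_ge0 ?psi2_ge0.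
- apply: emeasurable_funM; last exact/measurable_EFinP.
  by apply: measurable_sq; apply: measurable_funB => //; exact: measurable_funM.
- apply/measurable_EFinP; apply: measurable_funM; last exact: measurable_funM.
  by apply: measurableT_comp => //; exact: measurable_funB.
- move=> x _; rewrite -EFinM lee_fin [leRHS]mulrA; apply: ler_wpM2r; first exact: psi2_ge0.
  have /andP[f0 f1] := f01 x; have /andP[i0 i1] := I01 x.
  (* As [chi = 1] on [A], the error is [(\1_A - f) chi]. Both factors are at most 1 in modulus, so
     its square is at most [|\1_A - f| chi]. *)
  have -> : \1_A x - chi x * f x = (\1_A x - f x) * chi x.
    rewrite mulrBl [f x * _]mulrC; congr (_ - _).
    have [xN|xN] := leP `|x : R3 R| N; first by rewrite /chi cutoff0_eq1// mulr1.
    by rewrite IN// mul0r.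
  rewrite exprMn -[_ ^+ 2]real_normK ?num_real//.
  have d1 : `|\1_A x - f x| <= 1 by rewrite ler_norml; apply/andP; split; lra.
  have d0 := normr_ge0 (\1_A x - f x); have := chi0 x; have := chi1 x.
  move: (`|_|) (chi x) d0 d1 => p q p0 p1 q1 q0.
  by apply: ler_pM; rewrite ?sqr_ge0// expr2 ler_piMr.
Qed.

Lemma Cc_dense_L2 f : L2 m f -> Cc_approx f.
Proof.
have ge0_case g : L2 m g -> (forall x, 0 <= g x) -> Cc_approx g.
  move=> Lg g0; have mg : measurable_fun [set: mR3 R] g := Lg.1.
  have meg : measurable_fun [set: mR3 R] (EFin \o g) by exact/measurable_EFinP.
  pose s := nnsfun_approx measurableT meg.
  pose B n : set (mR3 R) := @box R n.+1%:R.
  have mB n : measurable (B n) by exact: measurable_box.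
  (* The factor [\1_(B n)] makes the level sets bounded, as [Cc_approx_indic] requires. *)
  pose h n (x : mR3 R) : R := s n x * \1_(B n) x.
  have mh n : measurable_fun [set: mR3 R] (h n).
    by apply: measurable_funM; [exact: measurable_funTS|exact: measurable_indic].
  have sg n x : s n x <= g x by rewrite -lee_fin; rewrite /s nnsfun_approxE; apply: le_approx => // y _; rewrite lee_fin.
  have h0g n x : 0 <= h n x <= g x.
    rewrite /h indicE; case: (_ \in _); rewrite /= ?mulr1 ?mulr0 ?lexx ?g0// sg andbT.
    exact: fun_ge0.
  apply: Cc_approx_lim => // e e0.
  have [n nP] : exists n, forall k, (n <= k)%N -> (sqint m (fun x => h k x - g x)%R < e%:E)%E.
    apply: (sqint_dominated mh mg Lg) => //.
    - move=> k x; have /andP[? ?] := h0g k x.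
      by rewrite distrC !ger0_norm ?g0// ?subr_ge0// lerBlDr lerDl.
    - move=> x.
      have c : s n x @[n --> \oo] --> g x.
        have /fine_cvgP[_] : (s n x)%:E @[n --> \oo] --> (g x)%:E.
          by apply: (cvg_nnsfun_approx measurableT meg) => // y _; rewrite lee_fin.
        by [].
      apply: cvg_trans c; apply: near_eq_cvg; near=> n.
      rewrite /h indicE mem_set ?mulr1// /B /box/= ltW//.
      apply: (@le_lt_trans _ _ n%:R); last by rewrite ltr_nat.
      by near: n; exact: nbhs_infty_ger.
  exists (h n); last by rewrite sqintBC; exact: nP.
  have -> : h n = (fun x => \sum_(y <- finmap.enum_fset (fset_set (range (s n)))) y * \1_(s n @^-1` [set y] `&` B n) x).
    apply/funext => x; rewrite /h fimfunE fsbig_finite//= mulr_suml.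
    by apply: eq_bigr => y _; rewrite indicI -mulrA.
  elim: (finmap.enum_fset _) => [|y r IH].
    by under eq_fun do rewrite big_nil; exact: Cc_approx0.
  under eq_fun do rewrite big_cons.
  apply: Cc_approx_lin => //; apply: (@Cc_approx_indic n.+1%:R) => //.
  exact: measurableI.
move=> Lf; have mf : measurable_fun [set: mR3 R] f := Lf.1.
have p : Cc_approx (fun x => Num.max (f x) 0).
  apply: ge0_case; last by move=> x; rewrite le_max lexx orbT.
  apply: (L2_dominated _ Lf) => [|x]; first exact: measurable_maxr.
  by case: (leP (f x) 0) => h; rewrite ?normr0 ?normr_ge0 ?lexx.
have q : Cc_approx (fun x => Num.max (- f x) 0).
  apply: ge0_case; last by move=> x; rewrite le_max lexx orbT.
  apply: (L2_dominated _ Lf) => [|x]; first by apply: measurable_maxr => //; exact: measurableT_comp.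
  by case: (leP (- f x) 0) => h; rewrite ?normr0 ?normrN ?normr_ge0 ?lexx.
have := Cc_approx_lin (-1) q p; congr Cc_approx; apply/funext => x.
by rewrite mulN1r; case: (leP (f x) 0) => h1; case: (leP (- f x) 0) => h2; lra.
Unshelve. all: by end_near. Qed.

(* [|phi_e * f - f| <= |phi_e * (f - g)| + |phi_e * g - g| + |g - f|] with [g] continuous
   and compactly supported. *)
Lemma conv_moll_L2_cvg u : L2 m u -> forall d, 0 < d -> exists2 e0, 0 < e0 &
  forall e, 0 < e < e0 -> (sqint m (fun x => conv u (moll e) x - u x)%R < d%:E)%E.
Proof.
move=> Lu d d0.
have [K K0 KP] := conv_moll_L2_bound gamma0.
(* Both [r] and [K r] are then at most [d / 8]. With [d / 16] for the middle term, two uses of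
   [sqint_split] give [2 (2 d/8 + 2 d/16) + 2 d/8 = d]. *)
pose r := d / (8 * (K + 1)).
have r0 : 0 < r by rewrite divr_gt0// mulr_gt0// addr_gt0.
have [_ /(_ _ r0)[g Cg ug]] := Cc_dense_L2 Lu.
have [cg /compact_vanish[N N0 gN]] := Cg.
have d16 : 0 < d / 16 by rewrite divr_gt0.
have [s s0 sP] := vanish_uniform_sqint (addr_gt0 N0 ltr01) d16.
have [e0 e00 eP] := Cc_moll_unif Cg s0.
exists (Num.min e0 1); first by rewrite lt_min e00 ltr01.
move=> e /andP[e_gt0]; rewrite lt_min => /andP[ee0 e1].
have lu := L2_loc_integrable gamma0 Lu; have lg := continuous_loc_integrable cg.
have cm := @moll_continuous R e; have mv := @moll_vanish R _ e_gt0.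
have mu := Lu.1; have mg := continuous_measurable3 cg.
have mcu := continuous_measurable3 (conv_continuous lu cm mv).
have ccg := conv_continuous lg cm mv.
have mcg := continuous_measurable3 ccg.
have Lug := L2B Lu (Cc_L2 Cg).
have h1 : (sqint m (fun x => conv u (moll e) x - conv g (moll e) x)%R < (d / 8)%:E)%E.
  have -> : (fun x => conv u (moll e) x - conv g (moll e) x) = conv (fun x => u x - g x) (moll e).
    apply/funext => x; rewrite /conv -(RintegralB measurableT (conv_integrable x lu cm mv) (conv_integrable x lg cm mv)).
    by apply: eq_Rintegral => y _; rewrite mulrBl.
  have e01 : 0 < e <= 1 by rewrite e_gt0 ltW.
  apply: (le_lt_trans (KP _ _ e01 Lug)).
  apply: (@lt_le_trans _ _ (K%:E * r%:E)%E); first by rewrite lte_pmul2l.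
  rewrite -EFinM lee_fin /r mulrA ler_pdivrMr ?mulr_gt0 ?addr_gt0// mulrA divfK//.
  by rewrite mulrC ler_pM2l//; lra.
have h2 : (sqint m (fun x => conv g (moll e) x - g x)%R < (d / 16)%:E)%E.
  apply: sP; first exact: measurable_funB.
    by apply: eP; rewrite e_gt0.
  move=> x xN; rewrite (gN x); last by lra.
  by rewrite (conv_vanish gN mv) ?subrr//; lra.
have h3 : (sqint m (fun x => g x - u x)%R < (d / 8)%:E)%E.
  rewrite sqintBC; apply: lt_le_trans ug _; rewrite lee_fin.
  rewrite /r ler_pdivrMr ?mulr_gt0 ?addr_gt0// mulrA divfK// ler_peMr ?(ltW d0)//; lra.
have h12 := sqint_split mcu mcg mg h1 h2.
have := sqint_split mcu mg mu h12 h3.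
by congr (_ < _%:E)%E; field.
Qed.

End density_Cc.
(** * Lower semicontinuity of closed forms *)

Section form_lsc.
Context d (T : measurableType d) (R : realType).
Variable m : {measure set T -> \bar R}.
Variables (E : (T -> R) -> (T -> R) -> R) (F : set (T -> R)).
Hypothesis HF : sym_form m E F.
Implicit Types u v w f : T -> R.

Lemma form_L2 u : F u -> L2 m u.
Proof. by move=> /(sf_L2 HF) /Lfun2P. Qed.

Lemma form_lin a b u v : F u -> F v -> F (fun x => a * u x + b * v x).
Proof.
move=> Fu Fv; apply: (sf_lin HF) => //.
have := sf_lin HF b Fv (sf_zero HF); congr F; apply/funext => x; by rewrite addr0.
Qed.

Lemma form_quad a b u v : F u -> F v ->
  E (fun x => a * u x + b * v x) (fun x => a * u x + b * v x) =
  a ^+ 2 * E u u + 2 * (a * b) * E u v + b ^+ 2 * E v v.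
Proof.
move=> Fu Fv.
have Fbv : F (fun x => b * v x).
  by have := form_lin 0 b Fu Fv; congr F; apply/funext => x; rewrite mul0r add0r.
have E0 w : F w -> E (fun=> 0) w = 0.
  move=> Fw; have := sf_bilin HF 1 (sf_zero HF) (sf_zero HF) Fw.
  have -> : (fun x : T => 1 * 0 + 0) = (fun=> 0 : R) by apply/funext => x; rewrite mulr0 addr0.
  by move=> h; lra.
have EZ w : F w -> E (fun x => b * v x) w = b * E v w.
  move=> Fw; have := sf_bilin HF b Fv (sf_zero HF) Fw.
  by rewrite E0// addr0 => <-; congr (E _ w); apply/funext => x; rewrite addr0.
have FS := form_lin a b Fu Fv.
rewrite (sf_bilin HF a Fu Fbv FS) EZ//.
rewrite (sf_sym HF Fu FS) (sf_sym HF Fv FS) !(sf_bilin HF a Fu Fbv)// !EZ//.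
by rewrite (sf_sym HF Fv Fu); ring.
Qed.

Lemma formB u v : F u -> F v -> F (u \- v).
Proof.
move=> Fu Fv; have := form_lin 1 (-1) Fu Fv; congr F; apply/funext => x /=.
by rewrite mul1r mulN1r.
Qed.

Lemma form_quadB u v : F u -> F v -> E (u \- v) (u \- v) = E u u - 2 * E u v + E v v.
Proof.
move=> Fu Fv; have := form_quad 1 (-1) Fu Fv.
have -> : (fun x => 1 * u x + (-1) * v x) = u \- v.
  by apply/funext => x /=; rewrite mul1r mulN1r.
by move=> ->; ring.
Qed.

(** Nonnegativity of [E] at [(1 + t) u - v], divided by [t]. It compares the energies of nearby
    functions with a factor as close to 1 as desired. *)
Lemma form_young (t : R) u v : 0 < t -> F u -> F v ->
  E v v <= (1 + t) * E u u + (1 + t^-1) * E (u \- v) (u \- v).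
Proof.
move=> t0 Fu Fv.
have := sf_ge0 HF (form_lin (1 + t) (-1) Fu Fv).
rewrite form_quad// form_quadB// => h.
have : 0 <= t^-1 * ((1 + t) ^+ 2 * E u u + 2 * ((1 + t) * - 1) * E u v + (- 1) ^+ 2 * E v v).
  by rewrite mulr_ge0// invr_ge0 ltW.
have -> : t^-1 * ((1 + t) ^+ 2 * E u u + 2 * ((1 + t) * - 1) * E u v + (- 1) ^+ 2 * E v v) =
  (1 + t) * E u u + (1 + t^-1) * (E u u - 2 * E u v + E v v) - E v v.
  by field; exact: lt0r_neq0.
by rewrite subr_ge0.
Qed.

Lemma E1norm_sqr u : F u -> E1norm m E u ^+ 2 = E u u + fine (sqint m u).
Proof.
move=> Fu; rewrite /E1norm sqr_sqrtr//.
by apply: addr_ge0; [exact: sf_ge0 HF _ Fu|apply: fine_ge0; exact: sqint_ge0].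
Qed.

Lemma E1norm_lt u (e : R) : F u -> 0 < e -> (E1norm m E u < e) = (E u u + fine (sqint m u) < e ^+ 2).
Proof.
move=> Fu e0; rewrite -E1norm_sqr//.
by rewrite -ltr_sqr ?nnegrE ?sqrtr_ge0// ltW.
Qed.

Hypothesis HC : closed_form m E F.

(* [f] is the limit of a minimising sequence of [E] over shrinking L^2-balls
   around [f], which is [E]-Cauchy by the parallelogram identity. *)
Lemma form_lsc f (C : R) : L2 m f ->
  (forall e : R, 0 < e -> exists w,
    [/\ F w, (sqint m (fun x => w x - f x)%R < e%:E)%E & E w w <= C + e]) ->
  F f /\ E f f <= C.
Proof.
move=> Lf H.
pose r (n : nat) : R := n.+1%:R^-1.
have r0 n : 0 < r n by rewrite invr_gt0.
have rle n k : (n <= k)%N -> r k <= r n by move=> nk; rewrite lef_pV2 ?posrE// ler_nat.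
have rlt (e : R) : 0 < e -> exists N, forall n, (N <= n)%N -> r n < e.
  move=> e0; exists (Num.truncn e^-1) => n Nn.
  rewrite /r invf_plt ?posrE//; apply: (@lt_le_trans _ _ (Num.truncn e^-1).+1%:R).
    exact: truncnS_gt.
  by rewrite ler_nat.
(* [S n] is the part of the [L^2] ball of squared radius [r n] around [f] that lies in [F]. The
   infimum [a n] of the energy over it is nondecreasing in [n] and bounded by [C]. *)
pose S n := [set w | F w /\ (sqint m (fun x => w x - f x)%R < (r n)%:E)%E].
pose A n : set R := [set E w w | w in S n].
have A0 n : A n !=set0.
  by have [w [Fw wf _]] := H _ (r0 n); exists (E w w); exists w.
have Alb n : has_lbound (A n) by exists 0 => _ [w [Fw _] <-]; exact: sf_ge0 HF _ Fw.
pose a n := inf (A n).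
have aS n w : S n w -> a n <= E w w by move=> Sw; apply: ge_inf => //; exists w.
have aC n : a n <= C.
  apply/ler_addgt0Pr => e e0.
  have er0 : 0 < Num.min e (r n) by rewrite lt_min e0 r0.
  have [w [Fw wf Ew]] := H _ er0.
  apply: le_trans (aS n w _) _.
    by split => //; apply: lt_le_trans wf _; rewrite lee_fin ge_min lexx orbT.
  by apply: le_trans Ew _; rewrite lerD2l ge_min lexx.
have Ssub n k : (n <= k)%N -> S k `<=` S n.
  by move=> nk w [Fw wf]; split => //; apply: lt_le_trans wf _; rewrite lee_fin rle.
have anon : {homo a : n k / (n <= k)%N >-> n <= k}.
  move=> n k nk; apply: lb_le_inf => // _ [w Sw <-].
  by apply: aS; exact: Ssub Sw.
have ca : cvgn a by apply: nondecreasing_is_cvgn => //; exists C => _ [n _ <-].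
have al n : a n <= limn a by exact: nondecreasing_cvgn_le.
have zex n : exists w, S n w /\ E w w < a n + r n.
  have [_ [w Sw <-] h] := inf_adherent (r0 n) (conj (A0 n) (Alb n)).
  by exists w.
pose z n := sval (cid (zex n)).
have zS n : S n (z n) by rewrite /z; case: cid => ? [].
have zE n : E (z n) (z n) < a n + r n by rewrite /z; case: cid => ? [].
have Fz n : F (z n) by case: (zS n).
have Lz n : L2 m (z n) := form_L2 (Fz n).
(* Averages stay in the same ball, since [(2 r + 2 r) / 4 = r], so their energy is at least
   [a n]. *)
have avg n k : (n <= k)%N -> S n (fun x => 2^-1 * z n x + 2^-1 * z k x).
  move=> nk; split; first exact: form_lin.
  have mz j : measurable_fun setT (fun x => z j x - f x).
    by apply: measurable_funB; [case: (Lz j)|case: Lf].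
  have -> : (fun x => 2^-1 * z n x + 2^-1 * z k x - f x) = (fun x => 2^-1 * ((z n x - f x) + (z k x - f x))).
    by apply/funext => x; field.
  rewrite sqintZ; last exact: measurable_funD.
  apply: (@le_lt_trans _ _ ((2^-1 ^+ 2)%:E *
      (2%:E * sqint m (fun x => z n x - f x)%R + 2%:E * sqint m (fun x => z k x - f x)%R))%E).
    by apply: lee_wpmul2l; [rewrite lee_fin sqr_ge0|exact: sqintD].
  apply: (@lt_le_trans _ _ ((2^-1 ^+ 2)%:E * (2 * r n + 2 * r n)%:E)%E).
    by rewrite lte_pmul2l ?lte_fin ?exprn_gt0 ?invr_gt0//; apply: lte2D; [case: (zS n)|case: (Ssub _ _ nk _ (zS k))].
  by rewrite -EFinM lee_fin le_eqVlt; apply/orP; left; apply/eqP; field.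
(* [E (z n - z k)] is [2 E (z n) + 2 E (z k)] minus 4 times the energy of the average. The first two
   energies are below [a n + r n] and [limn a + r n], the last is at least [a n]. *)
have par n k : (n <= k)%N -> E (z n \- z k) (z n \- z k) <= 2 * (limn a - a n) + 4 * r n.
  move=> nk; have := aS _ _ (avg n k nk); rewrite form_quad// form_quadB// => h.
  have := zE n; have := zE k; have := rle _ _ nk; have := al k => *; lra.
have zdist n k : (n <= k)%N -> (sqint m (z n \- z k)%R < (4 * r n)%:E)%E.
  move=> nk; have [_ h1] := zS n; have [_ h2] := Ssub _ _ nk _ (zS k).
  rewrite sqintBC in h2.
  have := sqint_split (Lz n).1 Lf.1 (Lz k).1 h1 h2.
  by rewrite (_ : 2 * r n + 2 * r n = 4 * r n)//; ring.
have dist0 (e : R) : 0 < e -> exists N, forall n, (N <= n)%N -> 2 * (limn a - a n) + 8 * r n < e.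
  move=> e0; have e4 : 0 < e / 4 by rewrite divr_gt0.
  have e16 : 0 < e / 16 by rewrite divr_gt0.
  have [N1 h1] := rlt _ e16.
  have /cvgrPdist_lt/(_ _ e4)[N2 _ h2] := ca.
  exists (maxn N1 N2) => n; rewrite geq_max => /andP[n1 n2].
  have := h1 _ n1; have := h2 _ n2 => /=.
  by rewrite ger0_norm ?subr_ge0// => *; lra.
have zz n k (e : R) : (n <= k)%N -> 2 * (limn a - a n) + 8 * r n < e ->
    E (z n \- z k) (z n \- z k) + fine (sqint m (z n \- z k)) < e.
  move=> nk h; have h1 := par _ _ nk; have h2 := zdist _ _ nk.
  have : fine (sqint m (z n \- z k)) < 4 * r n.
    by rewrite -lte_fin fineK//; apply: sqint_fin; exact: L2B.
  by lra.
have [w Fw zw] : exists2 u, F u & E1norm m E (z n \- u) @[n --> \oo] --> 0.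
  apply: HC => // e e0.
  have [N NP] := dist0 _ (exprn_gt0 2 e0); exists N => n k Nn Nk.
  rewrite E1norm_lt//; last exact: formB.
  case/orP: (leq_total n k) => nk; first by apply: zz => //; exact: NP.
  rewrite form_quadB// (sf_sym HF)// [X in fine X]sqintBC.
  have := zz _ _ _ nk (NP _ Nk); rewrite form_quadB//; lra.
have zwe (e : R) : 0 < e -> exists N, forall n, (N <= n)%N ->
    E (z n \- w) (z n \- w) + fine (sqint m (z n \- w)) < e.
  move=> e0.
  have s0 : 0 < Num.sqrt e by rewrite sqrtr_gt0.
  have /cvgrPdist_lt/(_ _ s0)[N _ NP] := zw; exists N => n Nn.
  have := NP n Nn; rewrite /= sub0r normrN ger0_norm ?sqrtr_ge0//.
  by rewrite E1norm_lt// ?sqr_sqrtr ?(ltW e0)//; exact: formB.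
have Lw := form_L2 Fw.
have Lwf : L2 m (fun x => w x - f x) by exact: L2B.
(* The [z n] tend in [L^2] to [f] by the choice of the balls and to [w] by closedness. *)
have wf0 : sqint m (fun x => w x - f x) = 0%E.
  apply/eqP; rewrite eq_le sqint_ge0 andbT; apply/lee_addgt0Pr => e e0; rewrite add0e.
  have e4 : 0 < e / 4 by rewrite divr_gt0.
  have [N1 h1] := rlt _ e4; have [N2 h2] := zwe _ e4.
  set n := maxn N1 N2.
  have {}h1 : (sqint m (fun x => z n x - f x)%R < (e / 4)%:E)%E.
    by have [_ h] := zS n; apply: lt_trans h _; rewrite lte_fin h1// leq_maxl.
  have {}h2 : (sqint m (fun x => w x - z n x)%R < (e / 4)%:E)%E.
    have Lzw : L2 m (z n \- w) by exact: L2B.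
    rewrite sqintBC -[X in (X < _)%E](fineK (sqint_fin Lzw)) lte_fin.
    have := h2 n (leq_maxr _ _); have := sf_ge0 HF (formB (Fz n) Fw); lra.
  have := sqint_split Lw.1 (Lz n).1 Lf.1 h2 h1.
  by move/ltW; congr (_ <= _%:E)%E; field.
have wf : {ae m, forall x, w x = f x}.
  have : (\int[m]_x `|((w x - f x) ^+ 2)%:E| = 0)%E.
    rewrite -[RHS]wf0; apply: eq_integral => x _; by rewrite gee0_abs// lee_fin sqr_ge0.
  move=> /(ae_eq_integral_abs _ measurableT (measurable_sq Lwf.1)).
  apply: filterS => x /(_ I) [] /eqP; rewrite sqrf_eq0 subr_eq0 => /eqP ->.
  by [].
have Ff : F f.
  apply: (sf_ae_dom HF Fw); first exact/Lfun2P.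
  by apply: filterS wf => x -> _.

split => //.
have -> : E f f = E w w.
  have e1 : w = f %[ae m] by apply: filterS wf => x -> _.
  by rewrite (sf_ae HF Fw Ff Fw e1) (sf_sym HF Ff Fw) (sf_ae HF Fw Ff Ff e1).
have C0 : 0 <= C.
  by apply: le_trans (aC 0%N); apply: lb_le_inf => // _ [v [Fv _] <-]; exact: sf_ge0 HF _ Fv.
apply/ler_addgt0Pr => e e0.
(* This gives [t C <= e / 4], with [C + 1] because [C] may be 0. The other two error terms of
   [form_young] are made at most [e / 4] each by taking [n] large. *)
pose t := e / 4 / (C + 1).
have C1 : 0 < C + 1 by rewrite ltr_wpDl.
have t0 : 0 < t by rewrite !divr_gt0.
have s0 : 0 < Num.min (e / 4 / (1 + t)) (e / 4 / (1 + t^-1)).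
  by rewrite lt_min !divr_gt0// ?addr_gt0// ?invr_gt0.
have [N1 h1] := rlt _ s0; have [N2 h2] := zwe _ s0.
set n := maxn N1 N2.
have := h1 n (leq_maxl _ _); have := h2 n (leq_maxr _ _).
rewrite !lt_min => /andP[_ k2] /andP[k1 _].
have t1 : 0 < 1 + t by rewrite addr_gt0.
have t2 : 0 < 1 + t^-1 by rewrite addr_gt0// invr_gt0.
rewrite ltr_pdivlMr// in k1; rewrite ltr_pdivlMr// in k2.
have := form_young t0 (Fz n) Fw.
have q1 := zE n; have q2 := aC n.
have q3 : 0 <= fine (sqint m (z n \- w)) by apply: fine_ge0; exact: sqint_ge0.
have q4 : (1 + t) * E (z n) (z n) <= (1 + t) * (C + r n) by rewrite ler_pM2l//; lra.
have q5 : (1 + t^-1) * E (z n \- w) (z n \- w) <= (1 + t^-1) * (E (z n \- w) (z n \- w) + fine (sqint m (z n \- w))).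
  by rewrite ler_pM2l// lerDl.
have q6 : t * C <= e / 4.
  by rewrite /t mulrAC ler_pdivrMr// ler_pM2l ?divr_gt0// lerDl.
by lra.
Qed.

End form_lsc.
Lemma sum3 (V : nmodType) (f : 'I_3 -> V) :
  \sum_i f i = f ord0 + (f (lift ord0 ord0) + f (lift ord0 (lift ord0 ord0))).
Proof. by rewrite !big_ord_recl big_ord0 addr0. Qed.

Lemma I3_ind (P : 'I_3 -> Prop) :
  P ord0 -> P (lift ord0 ord0) -> P (lift ord0 (lift ord0 ord0)) -> forall i, P i.
Proof.
move=> P0 P1 P2 [[|[|[|//]]] i3].
- by rewrite (_ : Ordinal i3 = ord0)//; exact: val_inj.
- by rewrite (_ : Ordinal i3 = lift ord0 ord0)//; exact: val_inj.
- by rewrite (_ : Ordinal i3 = lift ord0 (lift ord0 ord0))//; exact: val_inj.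
Qed.

Lemma Rintegral_sum d (T : measurableType d) (R : realType)
    (mu : {measure set T -> \bar R}) I (r : seq I) (P : pred I) (f : I -> T -> R) :
  (forall i, mu.-integrable setT (EFin \o f i)) ->
  \int[mu]_x (\sum_(i <- r | P i) f i x) = \sum_(i <- r | P i) \int[mu]_x f i x.
Proof.
move=> fi; rewrite /Rintegral; under eq_integral do rewrite -sumEFin.
rewrite (integral_sum measurableT fi)//= sum_fine// => i Pi.
exact: integrable_fin_num (fi i).
Qed.

(** * The energy form *)

Section energy.
Context {R : realType}.
Variable gamma : R.
Hypothesis gamma0 : 0 < gamma.
Implicit Types (x y z : R3 R) (N e a : R) (u v f g h phi : R3 R -> R) (i : 'I_3).

Local Notation m := (psi2dx gamma).
Local Notation E := (E_psi gamma).
Local Notation F := (F_psi gamma).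

Lemma psi2dx_aeP (f g : R3 R -> R) : f = g %[ae m] <-> {ae leb3, forall x : mR3 R, f x = g x}.
Proof.
split=> h.
  apply/(psi2dx_ae gamma0).
  have : {ae m, forall x : mR3 R, setT x -> f x = g x} := h.
  by apply: filterS => x; apply.
suff : {ae m, forall x : mR3 R, setT x -> f x = g x} by [].
by apply/(psi2dx_ae gamma0); apply: filterS h => x ->.
Qed.

Lemma F_psi_intro u (g : 'I_3 -> R3 R -> R) : L2 m u -> (forall i, weak_partial i u (g i)) ->
  (forall i, L2 m (g i)) -> F u.
Proof.
move=> Lu ug Lg; split; first exact/Lfun2P.
by move=> i; exists (g i); [exact: ug|exact/Lfun2P].
Qed.

Lemma F_psi_L2 u : F u -> L2 m u.
Proof. by move=> [/Lfun2P]. Qed.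

Lemma F_psi_wgrad u i : F u -> weak_partial i u (wgrad i u).
Proof. by move=> [_ /(_ i)[g ug _]]; exact: wgradP ug. Qed.

Lemma F_psi_wgrad_L2 u i : F u -> L2 m (wgrad i u).
Proof.
move=> [_ /(_ i)[g ug /Lfun2P Lg]]; have [_ lw _] := wgradP ug.
split; first exact: lw.1.
have -> : sqint m (wgrad i u) = sqint m g; last exact: Lg.2.
apply: ae_sqint; [exact: lw.1|exact: Lg.1|].
by apply/(psi2dx_ae gamma0); exact: wgrad_ae.
Qed.

Lemma E_psiE u v : F u -> F v ->
  E u v = 2^-1 * \sum_(i < 3) \int[m]_x (wgrad i u x * wgrad i v x).
Proof.
move=> Fu Fv.
have int i := L2M (F_psi_wgrad_L2 i Fu) (F_psi_wgrad_L2 i Fv).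
have mf i : measurable_fun [set: mR3 R] (fun x => wgrad i u x * wgrad i v x).
  by apply: measurable_funM; [exact: (F_psi_wgrad_L2 i Fu).1|exact: (F_psi_wgrad_L2 i Fv).1].
rewrite /E_psi -(Rintegral_sum _ _ int); congr (_ * _).
rewrite /Rintegral; congr fine.
rewrite (@integral_density _ _ _ leb3 m (psi2 gamma))//.
- exact: psi2_ge0.
- exact: measurable_psi2.
- by apply: measurable_sum => i; exact: mf.
Qed.

Lemma E_psi_sqint u : F u -> E u u = 2^-1 * \sum_(i < 3) fine (sqint m (wgrad i u)).
Proof. by move=> Fu; rewrite E_psiE. Qed.

(** By uniqueness almost everywhere, any weak gradient may replace the chosen one. *)
Lemma E_psi_grad u (g : 'I_3 -> R3 R -> R) : F u -> (forall i, weak_partial i u (g i)) ->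
  E u u = 2^-1 * \sum_(i < 3) fine (sqint m (g i)).
Proof.
move=> Fu ug; rewrite E_psi_sqint//; congr (_ * _); apply: eq_bigr => i _; congr fine.
apply: ae_sqint; first exact: (F_psi_wgrad_L2 i Fu).1.
  by have [_ [h _] _] := ug i.
by apply/(psi2dx_ae gamma0); exact: wgrad_ae.
Qed.

Lemma F_psi_lin a u v : F u -> F v -> F (fun x => a * u x + v x).
Proof.
move=> Fu Fv; apply: (@F_psi_intro _ (fun i x => a * wgrad i u x + wgrad i v x)).
- by apply: L2D; [apply: L2Z|]; exact: F_psi_L2.
- by move=> i; apply: weak_partial_lin; exact: F_psi_wgrad.
- by move=> i; apply: L2D; [apply: L2Z|]; exact: F_psi_wgrad_L2.
Qed.

(** Continuity at 0 in [L^2(psi^2 dx)] of the Lebesgue pairing with [phi]; the lower bound on the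
    weight enters through [L2_integral_box]. *)
Lemma L2_test_lim phi e : Cc phi -> 0 < e -> exists2 d, 0 < d & forall u, L2 m u ->
  (sqint m u <= d%:E)%E -> `|\int[leb3]_x (u x * phi x)| <= e.
Proof.
move=> [cp /compact_vanish[N N0 pN]] e0.
have [M M0 pM] := continuous_vanish_bounded cp pN.
have [c c0 h] := L2_integral_box gamma0 N0.
pose V := (2 * N) ^+ 3; have V0 : 0 < V by rewrite exprn_gt0 ?mulr_gt0.
have M1 : 0 < M + 1 by exact: addr_gt0.
(* With this [t] and the radius given next, the two terms of [L2_integral_box] are each at most
   [e / 2 / (M + 1)]. *)
pose t := e / 2 / (M + 1) / V; have t0 : 0 < t by rewrite !divr_gt0.
exists (t * c * (e / 2 / (M + 1))); first by rewrite !mulr_gt0// ?divr_gt0// ?invr_gt0.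
move=> u Lu ud; have lu := L2_loc_integrable gamma0 Lu.
have c00 : continuous (fun _ : R3 R => 0 : R) by move=> x; exact: cvg_cst.
have := @integral_test_dist _ u phi (fun=> 0) N M lu cp c00 pN (fun _ _ => erefl).
have -> : \int[leb3]_y (u y * 0) = 0.
  by under eq_Rintegral do rewrite mulr0; rewrite Rintegral_cst// mul0r.
rewrite subr0 => H; apply: (le_trans (H _)); first by move=> y; rewrite subr0.
have hu := h u t Lu.1 t0.
have I1 : (\int[leb3]_(x in box N) `|(u x)%:E| <= (e / (M + 1))%:E)%E.
  apply: (le_trans hu); apply: (@le_trans _ _ ((t * V)%:E + ((t * c)^-1)%:E * (t * c * (e / 2 / (M + 1)))%:E)%E).
    by apply: leeD => //; apply: lee_wpmul2l => //; rewrite lee_fin invr_ge0 mulr_ge0// ltW.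
  rewrite -EFinM -EFinD lee_fin /t.
  have tc : t * c != 0 by rewrite mulf_neq0// gt_eqF.
  rewrite mulKf//.
  have -> : t * V = e / 2 / (M + 1) by rewrite divfK// gt_eqF.
  by rewrite le_eqVlt; apply/orP; left; apply/eqP; field; rewrite gt_eqF.
have I2 : \int[leb3]_(x in box N) `|u x| <= e / (M + 1).
  rewrite -lee_fin /Rintegral fineK//.
  by rewrite ge0_fin_numE ?integral_ge0// (le_lt_trans I1)// ltry.
apply: (@le_trans _ _ (M * (e / (M + 1)))); first by rewrite ler_wpM2l// ltW.
by rewrite mulrCA ler_piMr ?(ltW e0)// ler_pdivrMr// mul1r lerDl.
Qed.

(** The graph of the weak derivative is closed: both sides of the defining identity pass to the
    limit by [L2_test_lim]. *)
Lemma weak_partial_lim i u g : L2 m u -> L2 m g ->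
  (forall d, 0 < d -> exists v h, [/\ L2 m v, L2 m h, weak_partial i v h,
     (sqint m (fun x => v x - u x)%R <= d%:E)%E & (sqint m (fun x => h x - g x)%R <= d%:E)%E]) ->
  weak_partial i u g.
Proof.
move=> Lu Lg H.
have lu := L2_loc_integrable gamma0 Lu; have lg := L2_loc_integrable gamma0 Lg.
split => // phi Cp.
have Cdp := Ccoo_Cc (Ccoo_derive i Cp); have Ccp := Ccoo_Cc Cp.
have sub f f' p : L2 m f -> L2 m f' -> Cc p ->
    \int[leb3]_x ((f x - f' x) * p x) = \int[leb3]_x (f x * p x) - \int[leb3]_x (f' x * p x).
  move=> Lf Lf' Cpp.
  rewrite -RintegralB//; first by apply: eq_Rintegral => x _; rewrite mulrBl.
    by apply: test_integrable => //; exact: L2_loc_integrable Lf.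
  by apply: test_integrable => //; exact: L2_loc_integrable Lf'.
apply/eqP; rewrite -subr_eq0 opprK -normr_le0; apply/ler_addgt0Pr => e e0; rewrite add0r.
have e2 : 0 < e / 2 by rewrite divr_gt0.
have [d1 d10 h1] := L2_test_lim Cdp e2; have [d2 d20 h2] := L2_test_lim Ccp e2.
have d0 : 0 < Num.min d1 d2 by rewrite lt_min d10.
have [v [h [Lv Lh [_ _ vh] vu hg]]] := H _ d0.
have := h1 _ (L2B Lv Lu) (le_trans vu _); rewrite lee_fin ge_min lexx => /(_ isT).
have := h2 _ (L2B Lh Lg) (le_trans hg _); rewrite lee_fin ge_min lexx orbT => /(_ isT).
rewrite !sub// vh//.
set A := \int[leb3]_x (h x * _); set B := \int[leb3]_x _; set C := \int[leb3]_x _ => AB AC.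
have -> : C + B = - (- A - C) - (A - B) by ring.
by apply: le_trans (ler_normB _ _) _; rewrite normrN (splitr e) lerD.
Qed.

Lemma Ccoo_F_psi : Ccoo `<=` F.
Proof.
move=> v Cv; apply: (@F_psi_intro _ (fun i => 'D_(e3 i) v)).
- exact: Cc_L2 (Ccoo_Cc Cv).
- by move=> i; apply: C1_weak_partial; exact: Cv.1.
- by move=> i; exact: Cc_L2 (Ccoo_Cc (Ccoo_derive i Cv)).
Qed.

(** Functions equal almost everywhere have the same set of weak partials. Since [xget] depends only
    on that set, the chosen representatives are literally equal. *)
Lemma wgrad_ae_eq i u v : measurable_fun [set: mR3 R] u -> measurable_fun [set: mR3 R] v ->
  {ae leb3, forall x : mR3 R, u x = v x} -> wgrad i u = wgrad i v.
Proof.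
move=> mu mv uv; congr xget; apply/seteqP; split => g.
  exact: ae_weak_partial.
by apply: ae_weak_partial => //; apply: filterS uv => x ->.
Qed.

(** A choice of representatives is linear only almost everywhere, so linearity is stated under the
    integral. *)
Lemma Rintegral_wgrad_lin i a u v h : F u -> F v -> F h ->
  \int[m]_x (wgrad i (fun x => a * u x + v x)%R x * wgrad i h x) =
  a * \int[m]_x (wgrad i u x * wgrad i h x) + \int[m]_x (wgrad i v x * wgrad i h x).
Proof.
move=> Fu Fv Fh.
have int k : F k -> m.-integrable setT (fun x => (wgrad i k x * wgrad i h x)%:E).
  by move=> Fk; exact: L2M (F_psi_wgrad_L2 i Fk) (F_psi_wgrad_L2 i Fh).
have Fl := F_psi_lin a Fu Fv.
have mg k : F k -> measurable_fun [set: mR3 R] (wgrad i k).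
  by move=> Fk; exact: (F_psi_wgrad_L2 i Fk).1.
rewrite -RintegralZl//; last exact: int.
rewrite -RintegralD//; last exact: int; last first.
  have := integrableZl measurableT a (int _ Fu).
  by apply: eq_integrable.
rewrite /Rintegral; congr fine; apply: ae_eq_integral => //.
- by apply/measurable_EFinP; apply: measurable_funM; exact: mg.
- apply/measurable_EFinP; apply: measurable_funD; last by apply: measurable_funM; exact: mg.
  by apply: measurable_funM => //; apply: measurable_funM; exact: mg.
- apply/(psi2dx_ae gamma0).
  have := wgrad_ae (weak_partial_lin a (F_psi_wgrad i Fu) (F_psi_wgrad i Fv)).
  by apply: filterS => x -> _; congr EFin; ring.
Qed.

Lemma sym_form_psi : sym_form m E F.
Proof.
split.
- by move=> u [].
- move=> u v Fu Lv /psi2dx_aeP uv.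
  have mv : measurable_fun [set: mR3 R] v by case/Lfun2P: Lv.
  split => // i; have [_ /(_ i)[g ug Lg]] := Fu.
  by exists g => //; exact: ae_weak_partial ug.
- move=> u v w Fu Fv Fw /psi2dx_aeP uv.
  have mu : measurable_fun [set: mR3 R] u := (F_psi_L2 Fu).1.
  have mv : measurable_fun [set: mR3 R] v := (F_psi_L2 Fv).1.
  rewrite (E_psiE Fu Fw) (E_psiE Fv Fw); apply: congr1; apply: eq_bigr => i _.
  by rewrite (wgrad_ae_eq i mu mv uv).
- apply: Ccoo_F_psi; split; first by move=> k; exact: Ck_cst.
  exact: Cc0.2.
- by move=> a u v; exact: F_psi_lin.
- move=> f /Lfun2P Lf e e0.
  (* Approximation in [Cc] and mollification cost [e^2 / 4] each, and [sqint_split] adds them up to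
     [2 (e^2/4) + 2 (e^2/4) = e^2]. *)
  have d0 : 0 < e ^+ 2 / 4 by rewrite divr_gt0// exprn_gt0.
  have [_ /(_ _ d0)[g Cg fg]] := Cc_dense_L2 gamma0 Lf.
  have [e1 e10 h] := conv_moll_L2_cvg gamma0 (Cc_L2 gamma0 Cg) d0.
  have e2 : 0 < e1 / 2 by rewrite divr_gt0.
  have Cc := conv_Ccoo Cg e2.
  exists (conv g (moll (e1 / 2))); first exact: Ccoo_F_psi.
  apply: Lnorm2_lt => //.
  have e21 : 0 < e1 / 2 < e1 by rewrite e2 gtr_pMr// invf_lt1// ltr1n.
  have h2 := h _ e21; rewrite sqintBC in h2.
  have := sqint_split Lf.1 (Cc_L2 gamma0 Cg).1 (Cc_L2 gamma0 (Ccoo_Cc Cc)).1 fg h2.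
  by congr (_ < _%:E)%E; field.
- move=> a u v w Fu Fv Fw; have Fl := F_psi_lin a Fu Fv.
  rewrite (E_psiE Fl Fw) (E_psiE Fu Fw) (E_psiE Fv Fw).
  rewrite [a * _]mulrCA -mulrDr; apply: congr1.
  rewrite mulr_sumr -big_split; apply: eq_bigr => i _.
  exact: Rintegral_wgrad_lin.
- move=> u v Fu Fv; rewrite (E_psiE Fu Fv) (E_psiE Fv Fu); apply: congr1; apply: eq_bigr => i _.
  by apply: eq_Rintegral => x _; rewrite mulrC.
- move=> u Fu; rewrite E_psi_sqint// mulr_ge0// sumr_ge0// => i _.
  by rewrite fine_ge0// sqint_ge0.
Qed.

Lemma wgradB_ae i u v : F u -> F v ->
  {ae leb3, forall x : mR3 R, wgrad i (u \- v) x = wgrad i u x - wgrad i v x}.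
Proof.
move=> Fu Fv.
have := wgrad_ae (weak_partial_lin (-1) (F_psi_wgrad i Fv) (F_psi_wgrad i Fu)).
have -> : (fun x => -1 * v x + u x) = u \- v by apply/funext => x /=; ring.
by apply: filterS => x ->; ring.
Qed.

Lemma sqint_wgradB i u v : F u -> F v ->
  sqint m (wgrad i (u \- v)) = sqint m (fun x => wgrad i u x - wgrad i v x).
Proof.
move=> Fu Fv; apply: ae_sqint.
- exact: (F_psi_wgrad_L2 i (formB sym_form_psi Fu Fv)).1.
- by apply: measurable_funB; [exact: (F_psi_wgrad_L2 i Fu).1|exact: (F_psi_wgrad_L2 i Fv).1].
- by apply/(psi2dx_ae gamma0); exact: wgradB_ae.
Qed.

Lemma sqint_wgrad_le i u : F u -> fine (sqint m (wgrad i u)) <= 2 * E u u.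
Proof.
move=> Fu; rewrite E_psi_sqint// mulrA divff// mul1r (bigD1 i)//= lerDl sumr_ge0// => j _.
by rewrite fine_ge0// sqint_ge0.
Qed.

Lemma E1norm_psi_lt u v (g : 'I_3 -> R3 R -> R) e : F u -> F v ->
  (forall i, weak_partial i v (g i)) -> 0 < e ->
  (sqint m (fun x => u x - v x)%R <= (e ^+ 2 / 5)%:E)%E ->
  (forall i, sqint m (fun x => wgrad i u x - g i x)%R <= (e ^+ 2 / 5)%:E)%E ->
  E1norm m E (u \- v) < e.
Proof.
(* Three gradient terms with the factor 1/2 and one [L^2] term add up to at most
   [(5/2) (q/5) = q/2]. *)
have half (q a b c d : R) : 0 < q -> a <= q / 5 -> b <= q / 5 -> c <= q / 5 -> d <= q / 5 ->
  2^-1 * (b + (c + d)) + a < q by lra.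
move=> Fu Fv vg e0 uv ug; have HF := sym_form_psi; have FB := formB HF Fu Fv.
rewrite (E1norm_lt HF)//.
have wB i : weak_partial i (u \- v) (fun x => wgrad i u x - g i x).
  have := weak_partial_lin (-1) (vg i) (F_psi_wgrad i Fu).
  by congr weak_partial; apply/funext => x /=; ring.
rewrite (E_psi_grad FB wB) sum3.
have fle w : (sqint m w <= (e ^+ 2 / 5)%:E)%E -> fine (sqint m w) <= e ^+ 2 / 5.
  move=> h; rewrite -lee_fin fineK// ge0_fin_numE ?sqint_ge0//.
  exact: le_lt_trans h (ltry _).
exact: half (exprn_gt0 2 e0) (fle _ uv) (fle _ (ug _)) (fle _ (ug _)) (fle _ (ug _)).
Qed.

(** The sequence and its three weak partials are Cauchy in [L^2(psi^2 dx)]; [weak_partial_lim]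
    identifies the limits of the partials as the partials of the limit. *)
Lemma closed_form_psi : closed_form m E F.
Proof.
move=> u Fu uC; have HF := sym_form_psi.
have C1 (d : R) : 0 < d -> exists N : nat, forall n k : nat, (N <= n)%N -> (N <= k)%N ->
    E (u n \- u k) (u n \- u k) + fine (sqint m (u n \- u k)) < d.
  move=> d0; have s0 : 0 < Num.sqrt d by rewrite sqrtr_gt0.
  have [N NP] := uC _ s0; exists N => n k Nn Nk.
  have := NP n k Nn Nk; rewrite (E1norm_lt HF)// ?sqr_sqrtr ?(ltW d0)//.
  exact: (formB HF).
have [f Lf uf] : exists2 f, L2 m f & forall e, 0 < e -> exists N : nat, forall n : nat, (N <= n)%N ->
    (sqint m (fun x => u n x - f x)%R <= e%:E)%E.
  apply: riesz_fischer; first by move=> n; exact: F_psi_L2.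
  move=> e e0; have [N NP] := C1 _ e0; exists N => n k Nn Nk.
  have FB := formB HF (Fu n) (Fu k).
  rewrite -[X in (X < _)%E](fineK (sqint_fin (F_psi_L2 FB))) lte_fin.
  by have := NP _ _ Nn Nk; have := sf_ge0 HF FB; lra.
have ug i : exists g, L2 m g /\ forall e, 0 < e -> exists N : nat, forall n : nat, (N <= n)%N ->
    (sqint m (fun x => wgrad i (u n) x - g x)%R <= e%:E)%E.
  have [|e e0|g Lg gP] := @riesz_fischer _ _ _ m (fun n => wgrad i (u n)).
  - by move=> n; exact: F_psi_wgrad_L2.
  - have e2 : 0 < e / 2 by rewrite divr_gt0.
    have [N NP] := C1 _ e2; exists N => n k Nn Nk.
    have FB := formB HF (Fu n) (Fu k).
    rewrite -sqint_wgradB// -[X in (X < _)%E](fineK (sqint_fin (F_psi_wgrad_L2 i FB))) lte_fin.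
    have := sqint_wgrad_le i FB; have := NP _ _ Nn Nk.
    have : 0 <= fine (sqint m (u n \- u k)) by rewrite fine_ge0// sqint_ge0.
    by lra.
  - by exists g.
pose g i := sval (cid (ug i)).
have Lg i : L2 m (g i) := (svalP (cid (ug i))).1.
have gP i := (svalP (cid (ug i))).2; rewrite -/(g _) in gP.
have wfg i : weak_partial i f (g i).
  apply: weak_partial_lim => // d d0.
  have [N1 h1] := uf _ d0; have [N2 h2] := gP i _ d0.
  exists (u (maxn N1 N2)), (wgrad i (u (maxn N1 N2))); split.
  - exact: F_psi_L2.
  - exact: F_psi_wgrad_L2.
  - exact: F_psi_wgrad.
  - by apply: h1; exact: leq_maxl.
  - by apply: h2; exact: leq_maxr.
have Ff : F f := F_psi_intro Lf wfg Lg.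
exists f => //; apply/cvgrPdist_lt => e e0.
have d0 : 0 < e ^+ 2 / 5 by rewrite divr_gt0// exprn_gt0.
have [N0 h0] := uf _ d0.
have [N1 h1] := gP ord0 _ d0.
have [N2 h2] := gP (lift ord0 ord0) _ d0.
have [N3 h3] := gP (lift ord0 (lift ord0 ord0)) _ d0.
exists (maxn (maxn N0 N1) (maxn N2 N3)) => // n /=; rewrite !geq_max => /andP[/andP[n0 n1] /andP[n2 n3]].
rewrite sub0r normrN ger0_norm ?sqrtr_ge0//.
apply: (E1norm_psi_lt (Fu n) Ff wfg e0 (h0 _ n0)).
by apply: I3_ind; [exact: h1|exact: h2|exact: h3].
Qed.

End energy.

(** * Smooth cutoffs and the core *)

Section smooth_core.
Context {R : realType}.
Implicit Types (x y z : R3 R) (N e a K : R) (u v f g h phi : R3 R -> R) (i : 'I_3) (n : nat).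

Lemma norm_conv_le f phi K N e x : loc_integrable3 f -> continuous phi -> vanish N phi ->
  0 < e -> 0 <= K -> (forall y, `|f y| <= 1) -> (forall z, `|phi z| <= K * moll e z) ->
  `|conv f phi x| <= K.
Proof.
move=> lf cp pN e0 K0 f1 phiK.
have i1 := conv_integrable x lf cp pN.
have i2 : leb3.-integrable setT (EFin \o (fun y => moll e (x - y))).
  exact: (continuous_vanish_integrable (@reflect_continuous _ _ x (@moll_continuous R e))
    (reflect_vanish (moll_vanish e0) (lexx `|x|))).
have i3 : leb3.-integrable setT (EFin \o (fun y => K * moll e (x - y))).
  by have := integrableZl measurableT K i2; apply: eq_integrable.
apply: (le_trans (le_normr_Rintegral measurableT i1)).
have -> : K = \int[leb3]_y (K * moll e (x - y)) by rewrite RintegralZl// moll_Rint// mulr1.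
apply: le_Rintegral => //; first exact: integrable_abse i1.
by move=> y _; rewrite normrM (le_trans _ (phiK _))// ler_piMl.
Qed.

(** The derivative is bounded and vanishes outside [box 1], where [moll 2] has a positive lower
    bound. Domination by a mollifier lets [norm_conv_le] bound convolutions with the derivative. *)
Lemma moll1_derive_le : exists2 K, 0 < K & forall i z, `|'D_(e3 i) (moll 1) z| <= K * moll 2 z.
Proof.
have low z : `|z| <= 1 -> (expR (- 2) ^+ 2) ^+ 3 / bump_int 2 ^+ 3 <= moll 2 z :> R.
  move=> z1; rewrite /moll ler_pM2r ?invr_gt0 ?exprn_gt0 ?bump_int_gt0//.
  have b (t : R) : `|t| <= 1 -> expR (- 2) ^+ 2 <= bump (2^-1 * t).
    by move=> t1; apply: bump_ge; rewrite normrM gtr0_norm ?invr_gt0// ler_piMr.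
  move: z1; rewrite norm3_le => /and3P[h1 h2 h3].
  by rewrite 3!exprS expr0 mulr1 mulrA; apply: ler_pM;
    rewrite ?mulr_ge0 ?exprn_ge0 ?expR_ge0 ?b//; apply: ler_pM; rewrite ?mulr_ge0 ?exprn_ge0 ?expR_ge0 ?b.
set c := _ / _ in low; have c0 : 0 < c by rewrite divr_gt0// !exprn_gt0 ?expR_gt0// bump_int_gt0.
have bound i : exists2 M, 0 < M & forall z, `|'D_(e3 i) (moll 1) z| <= M.
  apply: (@continuous_vanish_bounded _ _ 1).
    by apply: (@Ck_continuous _ 0); apply: CkS_derive; exact: moll_Ck.
  by apply: vanish_derive; exact: moll_vanish.
have [M M0 MP] : exists2 M, 0 < M & forall i z, `|'D_(e3 i) (moll 1) z| <= M.
  have [M h] := choice (fun i => let: ex_intro2 M M0 MP := bound i in ex_intro (fun M => 0 < M /\ _) M (conj M0 MP)).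
  exists (1 + \sum_i M i).
    by rewrite ltr_pwDl// sumr_ge0// => i _; case: (h i) => /ltW.
  move=> i z; apply: le_trans ((h i).2 z) _.
  rewrite (bigD1 i)//= addrCA lerDl addr_ge0// sumr_ge0// => j _; case: (h j) => /ltW//.
exists (M / c); first by rewrite divr_gt0.
move=> i z; have [z1|z1] := leP `|z| 1.
  rewrite mulrAC ler_pdivlMr//; apply: ler_pM => //; [exact: ltW|exact: low].
rewrite (@vanish_derive _ _ _ i (moll_vanish ltr01))// normr0.
by rewrite mulr_ge0 ?moll_ge0// divr_ge0// ltW.
Qed.

(** The Lipschitz cutoff smoothed at the fixed scale 1: its gradient, which falls on the kernel, is
    then bounded uniformly in [n]. *)
Definition cutoff n := conv (cutoff0 n%:R) (@moll R 1).

Lemma cutoff_Ccoo n : Ccoo (cutoff n).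
Proof. by apply: conv_Ccoo => //; exact: cutoff0_Cc. Qed.

Lemma norm_cutoff0_le1 (M : R) x : `|cutoff0 M x| <= 1.
Proof.
by rewrite ger0_norm ?cutoff0_ge0// /cutoff0 ge_max ler01 ge_min lexx.
Qed.

Lemma norm_cutoff_le1 n x : `|cutoff n x| <= 1.
Proof.
have Cc := cutoff0_Cc (n%:R : R).
apply: (@norm_conv_le _ _ 1 1 1) => //.
- exact: continuous_loc_integrable Cc.1.
- exact: moll_continuous.
- exact: moll_vanish.
- exact: norm_cutoff0_le1.
- by move=> z; rewrite mul1r ger0_norm// moll_ge0.
Qed.

Lemma cutoff_eq1 n x : `|x| + 1 <= n%:R -> cutoff n x = 1.
Proof.
move=> xn; have Cc := cutoff0_Cc (n%:R : R).
rewrite -[RHS](@cutoff0_eq1 _ n%:R x); last by lra.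
apply/eqP; rewrite -subr_eq0 -normr_le0; apply: conv_moll_dist => //; first exact: Cc.1.
move=> y xy; have := ler_distD x y 0; rewrite !subr0 distrC => h.
by rewrite !cutoff0_eq1 ?subrr ?normr0//; lra.
Qed.

(** The strict inequality makes the cutoff constant in a neighbourhood of [x]. *)
Lemma derive_cutoff_eq0 n i x : `|x| + 1 < n%:R -> 'D_(e3 i) (cutoff n) x = 0.
Proof.
move=> xn; rewrite (@near_eq_derive _ _ _ (cutoff n) (cst 1)).
  by rewrite derive_val.
near=> y; apply: cutoff_eq1; rewrite -lerBrDr; apply: ltW; near: y.
have : open [set y : R3 R | `|y| < n%:R - 1].
  by apply: (open_comp _ (@open_lt _ (n%:R - 1))) => y _; exact: norm_continuous.
by move=> /(_ x); apply; rewrite /= ltrBrDr.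
Unshelve. all: by end_near. Qed.

Lemma derive_cutoff_le : exists2 K, 0 < K & forall n i x, `|'D_(e3 i) (cutoff n) x| <= K.
Proof.
have [K K0 KP] := moll1_derive_le; exists K => // n i x.
have Cc := cutoff0_Cc (n%:R : R); have lc := continuous_loc_integrable Cc.1.
have mv := moll_vanish (ltr01 : 0 < (1 : R)).
have -> : 'D_(e3 i) (cutoff n) x = conv (cutoff0 n%:R) ('D_(e3 i) (moll 1)) x.
  exact: (congr1 (@^~ x) (derive_conv i lc (moll_Ck 1 1) mv)).
apply: (@norm_conv_le _ _ _ 1 2) => //.
- by apply: (@Ck_continuous _ 0); apply: CkS_derive; exact: moll_Ck.
- exact: vanish_derive.
- exact: ltW.
- exact: norm_cutoff0_le1.
Qed.

Variable gamma : R.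
Hypothesis gamma0 : 0 < gamma.
Local Notation m := (psi2dx gamma).
Local Notation E := (E_psi gamma).
Local Notation F := (F_psi gamma).

(** At a fixed point [V n] and its gradient agree with those of [U] from some [n] on. The
    differences are dominated by [2 |U|] and [2 |DU| + K |U|], with [K] the uniform bound on the
    gradients of the cutoffs. *)
Lemma cutoff_approx U : (forall k, Ck k U) -> L2 m U -> (forall i, L2 m ('D_(e3 i) U)) ->
  forall d : R, 0 < d -> exists V, [/\ Ccoo V, (sqint m (fun x => V x - U x)%R < d%:E)%E &
    forall i, (sqint m (fun x => 'D_(e3 i) V x - 'D_(e3 i) U x)%R < d%:E)%E].
Proof.
have lt12 (a b : R) : a + 2 <= b -> a + 1 < b by lra.
have le2 (b c : R) : `|b| <= 1 -> `|b * c - c| <= 2 * `|c|.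
  move=> b1; apply: le_trans (ler_normB _ _) _; rewrite normrM.
  by have := normr_ge0 c; nra.
move=> CU LU LDU d d0.
pose V n x := cutoff n x * U x.
have CV n : Ccoo (V n).
  split; first by move=> k; apply: CkM; [exact: (cutoff_Ccoo n).1|exact: CU].
  exact: (CcM (Ccoo_Cc (cutoff_Ccoo n)) (CU 0%N)).2.
have DV n i x : 'D_(e3 i) (V n) x = cutoff n x * 'D_(e3 i) U x + U x * 'D_(e3 i) (cutoff n) x.
  rewrite (@deriveM _ _ (cutoff n) U)//.
    by apply: CkS_derivable; exact: (cutoff_Ccoo n).1 1%N.
  by apply: CkS_derivable; exact: (CU 1%N).
have VU n x : `|x| + 2 <= n%:R -> V n x = U x /\ forall i, 'D_(e3 i) (V n) x = 'D_(e3 i) U x.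
  move=> /lt12 xn; split; first by rewrite /V cutoff_eq1 ?mul1r// ltW.
  by move=> i; rewrite DV cutoff_eq1 ?derive_cutoff_eq0 ?mulr0 ?mul1r ?addr0// ltW.
have ev x (P : nat -> Prop) : (forall n, `|x| + 2 <= n%:R -> P n) -> \forall n \near \oo, P n.
  move=> h; exists (Num.truncn (`|x| + 2)).+1 => // n /= Nn; apply: h.
  by apply: ltW; apply: lt_le_trans (truncnS_gt _) _; rewrite ler_nat.
have [K K0 KP] := derive_cutoff_le.
have mV n : measurable_fun [set: mR3 R] (V n).
  by apply: continuous_measurable3; exact: (Ccoo_Cc (CV n)).1.
have mDV i n : measurable_fun [set: mR3 R] ('D_(e3 i) (V n)).
  by apply: continuous_measurable3; exact: (Ccoo_Cc (Ccoo_derive i (CV n))).1.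
have L2N (f : R3 R -> R) : L2 m f -> L2 m (fun x => `|f x|).
  by move=> Lf; apply: (L2_dominated _ Lf) => [|x]; [exact: measurableT_comp Lf.1|rewrite normr_id].
have [N0 N0P] : exists N : nat, forall n : nat, (N <= n)%N -> (sqint m (fun x => V n x - U x)%R < d%:E)%E.
  apply: (sqint_dominated mV LU.1 (L2Z 2 (L2N _ LU))) => //.
  - by move=> n x; rewrite [leRHS]ger0_norm ?mulr_ge0// le2// norm_cutoff_le1.
  - by move=> x; apply: cvg_near_cst; apply: (ev (x : R3 R)) => n h; exact: (VU n x h).1.
have hN i : exists N : nat, forall n : nat, (N <= n)%N ->
    (sqint m (fun x => 'D_(e3 i) (V n) x - 'D_(e3 i) U x)%R < d%:E)%E.
  apply: (sqint_dominated (mDV i) (LDU i).1 (L2D (L2Z 2 (L2N _ (LDU i))) (L2Z K (L2N _ LU)))) => //.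
  - move=> n x; rewrite [leRHS]ger0_norm ?addr_ge0 ?mulr_ge0 ?(ltW K0)// DV addrAC.
    apply: le_trans (ler_normD _ _) _; apply: lerD; first by rewrite le2// norm_cutoff_le1.
    by rewrite normrM mulrC ler_wpM2r.
  - by move=> x; apply: cvg_near_cst; apply: (ev (x : R3 R)) => n h; exact: (VU n x h).2.
have [N1 N1P] := hN ord0; have [N2 N2P] := hN (lift ord0 ord0).
have [N3 N3P] := hN (lift ord0 (lift ord0 ord0)).
pose n := maxn (maxn N0 N1) (maxn N2 N3).
have : (n <= n)%N by [].
rewrite {1}/n !geq_max => /andP[/andP[n0 n1] /andP[n2 n3]].
exists (V n); split; [exact: CV|exact: N0P|].
by apply: I3_ind; [exact: N1P|exact: N2P|exact: N3P].
Qed.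

Lemma Ccoo_dense u : F u -> forall e, 0 < e -> exists2 v, Ccoo v & E1norm m E (u \- v) < e.
Proof.
move=> Fu e e0; have Lu := F_psi_L2 Fu.
have lu := L2_loc_integrable gamma0 Lu.
(* [sqint_split] turns two errors below [d] into [4 d = e^2 / 5], the tolerance of
   [E1norm_psi_lt]. *)
pose d := e ^+ 2 / 5 / 4; have d0 : 0 < d by rewrite !divr_gt0// exprn_gt0.
have [r0 r00 r0P] := conv_moll_L2_cvg gamma0 Lu d0.
have rP i := conv_moll_L2_cvg gamma0 (F_psi_wgrad_L2 gamma0 i Fu) d0.
have [r1 r10 r1P] := rP ord0; have [r2 r20 r2P] := rP (lift ord0 ord0).
have [r3 r30 r3P] := rP (lift ord0 (lift ord0 ord0)).
(* The entry 2 ensures [t <= 1], the range of scales in [conv_moll_L2_bound]. *)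
pose r := Num.min (Num.min r0 r1) (Num.min r2 (Num.min r3 2)).
have rr0 : 0 < r by rewrite !lt_min r00 r10 r20 r30/=.
pose t := r / 2; have t0 : 0 < t by rewrite divr_gt0.
have : t < r by rewrite gtr_pMr// invf_lt1// ltr1n.
rewrite !lt_min => /andP[/andP[t_0 t_1] /andP[t_2 /andP[t_3 t_4]]].
have t1 : 0 < t <= 1.
  by rewrite t0 ler_pdivrMr// mul1r !ge_min lexx !orbT.
have mt := moll_vanish t0.
pose U := conv u (moll t).
have CU k : Ck k U := conv_Ck lu (moll_Ck t k) mt.
have DU i : 'D_(e3 i) U = conv (wgrad i u) (moll t).
  rewrite /U (derive_conv _ lu (moll_Ck t 1) mt).
  exact: conv_weak_partial (F_psi_wgrad i Fu) (moll_Ccoo t0).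
have [B B0 BP] := conv_moll_L2_bound gamma0.
have convL2 f : L2 m f -> L2 m (conv f (moll t)).
  move=> Lf; split; last first.
    apply: le_lt_trans (BP _ _ t1 Lf) _; rewrite lte_mul_pinfty ?lee_fin ?(ltW B0)//.
    exact: Lf.2.
  apply: continuous_measurable3; apply: (conv_continuous _ _ mt); last exact: moll_continuous.
  exact: L2_loc_integrable Lf.
have LU : L2 m U by exact: convL2.
have LDU i : L2 m ('D_(e3 i) U) by rewrite DU; apply: convL2; exact: F_psi_wgrad_L2.
have [V [CV VU DVU]] := cutoff_approx CU LU LDU d0.
exists V => //.
have close (a b c : R3 R -> R) : L2 m a -> L2 m b -> L2 m c ->
    (sqint m (fun x => b x - a x)%R < d%:E)%E -> (sqint m (fun x => c x - b x)%R < d%:E)%E ->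
    (sqint m (fun x => a x - c x)%R <= (e ^+ 2 / 5)%:E)%E.
  move=> La Lb Lc; rewrite sqintBC => ab; rewrite sqintBC => bc.
  have := ltW (sqint_split La.1 Lb.1 Lc.1 ab bc).
  by congr (_ <= _%:E)%E; rewrite /d; field.
have LV : L2 m V := Cc_L2 gamma0 (Ccoo_Cc CV).
have LDV i : L2 m ('D_(e3 i) V) := Cc_L2 gamma0 (Ccoo_Cc (Ccoo_derive i CV)).
apply: (E1norm_psi_lt gamma0 Fu (Ccoo_F_psi gamma0 CV) (fun i => C1_weak_partial i (CV.1 1%N)) e0).
  apply: close LU _ _ _ => //.
  by apply: r0P; rewrite t0.
move=> i; apply: close (LDU i) _ _ _ => //; first exact: F_psi_wgrad_L2.
have -> : (fun x => 'D_(e3 i) U x - wgrad i u x) = (fun x => conv (wgrad i u) (moll t) x - wgrad i u x).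
  by apply/funext => x; rewrite -DU.
have t012 : [/\ 0 < t < r1, 0 < t < r2 & 0 < t < r3] by rewrite t0.
by move: i; apply: I3_ind; [apply: r1P|apply: r2P|apply: r3P]; case: t012.
Qed.

Lemma Ccoo_dense_unif f : Cc f -> forall e, 0 < e -> exists2 v, Ccoo v & forall x, `|f x - v x| <= e.
Proof.
move=> Cf e e0; have [r r0 rP] := Cc_moll_unif Cf e0.
have r2 : 0 < r / 2 by rewrite divr_gt0.
exists (conv f (moll (r / 2))); first exact: conv_Ccoo.
by move=> x; rewrite distrC; apply: rP; rewrite r2 gtr_pMr// invf_lt1// ltr1n.
Qed.

(** Left general in [C] to serve twice: for [F]&[Cc] in the regularity and for [Ccoo] itself. *)
Lemma is_core_psi C : Ccoo `<=` C -> C `<=` F -> C `<=` Cc -> is_core m E F C.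
Proof.
move=> hC CF CC; split => //.
  by move=> u Fu e e0; have [v Cv uv] := Ccoo_dense Fu e0; exists v => //; exact: hC.
by move=> f Cf e e0; have [v Cv uv] := Ccoo_dense_unif Cf e0; exists v => //; exact: hC.
Qed.

End smooth_core.
(** * The Markov property *)

Section soft_unit_contraction.
Context {R : realType}.
Implicit Types (s t h : R).

(** This reduces the smoothing of the contraction to that of the positive part. *)
Lemma unit_contractionE t : Num.min (Num.max 0 t) 1 = Num.max 0 t - Num.max 0 (t - 1).
Proof.
have [t0|t0] := leP 0 t; have [t1|t1] := leP 0 (t - 1).
- by rewrite min_r; lra.
- by rewrite min_l; lra.
- by rewrite min_l; lra.
- by rewrite min_l; lra.
Qed.

Lemma unit_contraction_lip s t :
  `|Num.min (Num.max 0 s) 1 - Num.min (Num.max 0 t) 1| <= `|s - t|.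
Proof.
have P (a b : R) : a <= b ->
    0 <= Num.min (Num.max 0 b) 1 - Num.min (Num.max 0 a) 1 <= b - a.
  move=> ab; rewrite !unit_contractionE.
  have [a0|a0] := leP 0 a; have [b0|b0] := leP 0 b;
  have [a1|a1] := leP 0 (a - 1); have [b1|b1] := leP 0 (b - 1); apply/andP; split; lra.
have [st|/ltW st] := leP s t.
  rewrite distrC [leRHS]distrC; have /andP[? h] := P _ _ st.
  by rewrite !ger0_norm// subr_ge0.
by have /andP[? h] := P _ _ st; rewrite !ger0_norm// subr_ge0.
Qed.

Definition sqpos t : R := Num.max 0 t ^+ 2.

Lemma is_derive_affine (a b t : R) : is_derive t 1 (fun s : R => a * s + b) a.
Proof.
have H : is_derive t 1 (a \*: (@id R) + cst b) (a *: 1 + 0) by exact: is_deriveD.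
by apply: (is_derive_eq H); rewrite addr0 -[_ *: 1]/(_ * 1) mulr1.
Qed.

Lemma sqpos_taylor t h : `|sqpos (t + h) - sqpos t - 2 * Num.max 0 t * h| <= 1 * h ^+ 2.
Proof.
rewrite /sqpos mul1r ler_norml.
by have [t0|t0] := leP 0 t; have [th|th] := leP 0 (t + h); apply/andP; split; nra.
Qed.

Lemma is_derive_sqpos t : is_derive t (1 : R) sqpos (2 * Num.max 0 t).
Proof.
(* The Taylor remainder is [O(h^2)] even at the kink, hence has derivative 0 at [h = 0]; [sqpos] is
   this remainder plus an affine function. *)
pose f h := sqpos (t + h) - sqpos t - 2 * Num.max 0 t * h.
have df := is_derive0_sq (sqpos_taylor t); rewrite -/f in df.
have ds : is_derive t (1 : R) (fun s : R => 1 * s + - t) 1 := is_derive_affine 1 (- t) t.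
have df' : is_derive (1 * t + - t) (1 : R) f 0 by rewrite mul1r subrr.
have D1 := @is_derive1_comp R f _ t 0 1 df' ds.
have D2 := is_derive_affine (2 * Num.max 0 t) (sqpos t - 2 * Num.max 0 t * t) t.
have D := @is_deriveD _ _ _ _ _ _ _ _ _ D1 D2.
have -> : sqpos = (f \o (fun s : R => 1 * s + - t)) +
    (fun s : R => 2 * Num.max 0 t * s + (sqpos t - 2 * Num.max 0 t * t)).
  apply/funext => s; rewrite -[RHS]/(f (1 * s - t) + (2 * Num.max 0 t * s + (sqpos t - 2 * Num.max 0 t * t))).
  by rewrite /f mul1r subrKC; ring.
by apply: (is_derive_eq D); rewrite mulr1 add0r.
Qed.

Variable e : R.
Hypothesis e0 : 0 < e.

(** The mean of the positive part over the interval from [t - e] to [t], hence of class [C^1] and at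
    most [e / 2] below the positive part. Its derivative [soft_step] is the ramp from 0 to 1 over
    the interval from 0 to [e]. *)
Definition soft_pos t := (2 * e)^-1 * (sqpos t - sqpos (t - e)).
Definition soft_step t := e^-1 * (Num.max 0 t - Num.max 0 (t - e)).

Lemma is_derive_soft_pos t : is_derive t (1 : R) soft_pos (soft_step t).
Proof.
have ds : is_derive t (1 : R) (fun s : R => 1 * s + - e) 1 := is_derive_affine 1 (- e) t.
have D1 := @is_derive1_comp R sqpos _ t _ 1 (is_derive_sqpos _) ds.
have D2 := @is_deriveB _ _ _ _ _ _ _ _ _ (is_derive_sqpos t) D1.
have D := @is_deriveZ _ _ _ _ (2 * e)^-1 _ _ _ D2.
have -> : soft_pos = (2 * e)^-1 \*: (sqpos - (sqpos \o (fun s : R => 1 * s + - e))).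
  apply/funext => s; rewrite -[RHS]/((2 * e)^-1 * (sqpos s - sqpos (1 * s - e))).
  by rewrite mul1r.
apply: (is_derive_eq D); rewrite -[_ *: _]/(_ * _) mul1r /soft_step.
by field; rewrite gt_eqF.
Qed.

Lemma soft_pos_dist t : Num.max 0 t - e / 2 <= soft_pos t <= Num.max 0 t.
Proof.
have h0 := e0; have e2 : 0 < 2 * e by rewrite mulr_gt0.
rewrite /soft_pos [_^-1 * _]mulrC ler_pdivlMr// ler_pdivrMr// /sqpos.
by have [t0|t0] := leP 0 t; have [te|te] := leP 0 (t - e); apply/andP; split; nra.
Qed.

Lemma soft_step_bounds t : 0 <= soft_step t <= 1.
Proof.
have h0 := e0; rewrite /soft_step [_^-1 * _]mulrC ler_pdivlMr// ler_pdivrMr//.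
by have [t0|t0] := leP 0 t; have [te|te] := leP 0 (t - e); apply/andP; split; nra.
Qed.

Lemma soft_step_homo : {homo soft_step : s t / s <= t}.
Proof.
have h0 := e0; move=> s t st; rewrite /soft_step ler_pM2l ?invr_gt0//.
have [s0|s0] := leP 0 s; have [se|se] := leP 0 (s - e);
have [t0|t0] := leP 0 t; have [te|te] := leP 0 (t - e); lra.
Qed.

Definition soft_unit t := soft_pos t - soft_pos (t - 1).
Definition dsoft_unit t := soft_step t - soft_step (t - 1).

Lemma is_derive_soft_unit t : is_derive t (1 : R) soft_unit (dsoft_unit t).
Proof.
have ds : is_derive t (1 : R) (fun s : R => 1 * s + - 1) 1 := is_derive_affine 1 (- 1) t.
have D1 := @is_derive1_comp R soft_pos _ t _ 1 (is_derive_soft_pos _) ds.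
have D := @is_deriveB _ _ _ _ _ _ _ _ _ (is_derive_soft_pos t) D1.
have -> : soft_unit = soft_pos - (soft_pos \o (fun s : R => 1 * s + - 1)).
  apply/funext => s; rewrite -[RHS]/(soft_pos s - soft_pos (1 * s - 1)).
  by rewrite mul1r.
by apply: (is_derive_eq D); rewrite mul1r mulr1.
Qed.

(** [soft_step] is nondecreasing with values between 0 and 1, so its difference over a unit step
    lies between 0 and 1. *)
Lemma dsoft_unit_bounds t : `|dsoft_unit t| <= 1.
Proof.
have /andP[h1 h2] := soft_step_bounds t; have /andP[h3 h4] := soft_step_bounds (t - 1).
have := @soft_step_homo (t - 1) t; rewrite gerBl ler01 => /(_ isT) h5.
by rewrite /dsoft_unit ler_norml; apply/andP; split; lra.
Qed.

Lemma soft_unit0 : soft_unit 0 = 0.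
Proof.
have neg s : s <= 0 -> Num.max 0 s = 0 by move=> s0; rewrite max_l.
have e1 := ltW e0.
by rewrite /soft_unit /soft_pos /sqpos !neg ?subrr ?mulr0 ?subrr//; lra.
Qed.

Lemma soft_unit_dist t : `|soft_unit t - Num.min (Num.max 0 t) 1| <= e.
Proof.
rewrite unit_contractionE; have /andP[h1 h2] := soft_pos_dist t; have /andP[h3 h4] := soft_pos_dist (t - 1).
by rewrite /soft_unit ler_norml; apply/andP; split; lra.
Qed.

Lemma dsoft_unit_continuous : continuous dsoft_unit.
Proof.
have cm (a : R) : continuous (fun t : R => Num.max 0 (t - a)).
  move=> t; apply: (@continuous_max _ _ (fun=> 0) (fun t => t - a)); first exact: cvg_cst.
  by apply: cvgB; [exact: cvg_id|exact: cvg_cst].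
have -> : dsoft_unit = fun t => e^-1 * (Num.max 0 (t - 0) - Num.max 0 (t - e)) -
    e^-1 * (Num.max 0 (t - 1) - Num.max 0 (t - (1 + e))).
  by apply/funext => t; rewrite /dsoft_unit /soft_step subr0 opprD addrA.
move=> t; apply: cvgB; apply: cvgMr; apply: cvgB; exact: cm.
Qed.

End soft_unit_contraction.

Section markov.
Context {R : realType}.
Variable gamma : R.
Hypothesis gamma0 : 0 < gamma.
Implicit Types (x y z : R3 R) (u v f g : R3 R -> R) (i : 'I_3).
Local Notation m := (psi2dx gamma).
Local Notation E := (E_psi gamma).
Local Notation F := (F_psi gamma).

Lemma is_derive_comp3 (g : R -> R) v x i l dv : is_derive (v x) (1 : R) g l ->
  is_derive x (e3 i) v dv -> is_derive x (e3 i) (fun y => g (v y)) (l * dv).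
Proof.
move=> dg; rewrite -[x in is_derive x]add0r -[X in is_derive (X + _)](scale0r (e3 i)).
move=> /is_derive_line dv'; apply/is_derive_line.
have dg' : is_derive (v ((0 : R) *: e3 i + x)) (1 : R) g l by rewrite scale0r add0r.
exact: (@is_derive1_comp R g _ 0 _ _ dg' dv').
Qed.

(** The composite is [C^1], and has compact support because [soft_unit e] vanishes at 0. The
    classical chain rule gives its weak gradient, dominated pointwise by that of [v]. *)
Lemma soft_unit_F_psi (e : R) v : 0 < e -> Ccoo v ->
  F (fun x => soft_unit e (v x)) /\
  E (fun x => soft_unit e (v x)) (fun x => soft_unit e (v x)) <= E v v.
Proof.
move=> e0 Cv; set w := fun x => _.
have [cv /compact_vanish[N N0 vN]] := Ccoo_Cc Cv.
pose dw i x := dsoft_unit e (v x) * 'D_(e3 i) v x.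
have dwP i x : is_derive x (e3 i) w (dw i x).
  apply: is_derive_comp3; first exact: is_derive_soft_unit.
  apply: derivableP; exact: CkS_derivable (Cv.1 1%N) _.
have cD i : continuous ('D_(e3 i) v) := (Ccoo_Cc (Ccoo_derive i Cv)).1.
have cdw i : continuous (dw i).
  move=> x; apply: cvgM; last exact: cD.
  exact: (continuous_comp (cv x) (@dsoft_unit_continuous _ e (v x))).
have cw : continuous w.
  move=> x; apply: (continuous_comp (cv x)).
  exact: is_derive1_continuous (is_derive_soft_unit e0 (v x)).
have C1w : Ck 1 w by exact: (Ck_is_derive cw dwP).
have wN : vanish N w by move=> x xN; rewrite /w vN// soft_unit0.
have Dw i : 'D_(e3 i) w = dw i by apply/funext => x; case: (dwP i x).
have wp i : weak_partial i w (dw i) by rewrite -Dw; exact: C1_weak_partial.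
have LDv i : L2 m ('D_(e3 i) v) := Cc_L2 gamma0 (Ccoo_Cc (Ccoo_derive i Cv)).
have le i x : `|dw i x| <= `|'D_(e3 i) v x|.
  by rewrite normrM ler_piMl// dsoft_unit_bounds.
have mdw i : measurable_fun [set: mR3 R] (dw i) by exact: continuous_measurable3.
have Ldw i : L2 m (dw i) := L2_dominated (mdw i) (LDv i) (le i).
have Fw : F w.
  apply: (F_psi_intro _ wp Ldw); apply: Cc_L2 => //; split => //.
  exact: vanish_compact wN.
split; first exact: Fw.
rewrite (E_psi_grad gamma0 Fw wp).
rewrite (E_psi_grad gamma0 (Ccoo_F_psi gamma0 Cv) (fun i => C1_weak_partial i (Cv.1 1%N))).
rewrite ler_pM2l ?invr_gt0//; apply: ler_sum => i _.
apply: fine_le; [exact: sqint_fin|exact: sqint_fin|].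
by apply: le_sqint; [exact: mdw|exact: (LDv i).1|exact: le].
Qed.

Lemma sqint_soft_unit_dist v : Ccoo v -> forall d : R, 0 < d -> exists2 e : R, 0 < e &
  (sqint m (fun x => soft_unit e (v x) - Num.min (Num.max 0 (v x)) 1)%R < d%:E)%E.
Proof.
move=> Cv d d0; have [cv /compact_vanish[N N0 vN]] := Ccoo_Cc Cv.
have [e e0 eP] := vanish_uniform_sqint gamma0 N0 d0; exists e => //.
have mv : measurable_fun [set: mR3 R] v by exact: continuous_measurable3.
apply: eP.
- apply: measurable_funB; last by apply: measurable_minr => //; apply: measurable_maxr.
  apply: continuous_measurable3 => x; apply: (continuous_comp (cv x)).
  exact: is_derive1_continuous (is_derive_soft_unit e0 (v x)).
- by move=> x; exact: soft_unit_dist.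
- by move=> x xN; rewrite vN// soft_unit0// maxxx min_l// subrr.
Qed.

Lemma markovian_form_psi : markovian_form E F.
Proof.
have lt_of_add (p q r : R) : 0 <= p -> 0 <= q -> p + q < r -> p < r /\ q < r.
  by move=> *; split; lra.
have HF := sym_form_psi gamma0; have HC := closed_form_psi gamma0.
move=> u Fu; set Tu := fun x => _.
pose T (t : R) := Num.min (Num.max 0 t) 1.
have mT f : measurable_fun [set: mR3 R] f -> measurable_fun [set: mR3 R] (fun x => T (f x)).
  by move=> mf; apply: measurable_minr => //; apply: measurable_maxr.
have T_lip (s t : R) : `|T s - T t| <= `|s - t| := unit_contraction_lip s t.
have T0 : T 0 = 0 by rewrite /T maxxx min_l.
have Lu := F_psi_L2 Fu.
have LTu : L2 m Tu.
  apply: (L2_dominated (mT _ Lu.1) Lu) => x.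
  by have := T_lip (u x) 0; rewrite T0 !subr0.
(* With [C = E u u] in the semicontinuity, it remains to approximate [Tu] in [L^2] by functions of
   energy at most [E u u + e]. *)
apply: (form_lsc HF HC LTu) => e e0.
have Eu := sf_ge0 HF Fu.
(* This makes [t * E u u] at most [e / 2] in [form_young]. *)
pose t := e / 2 / (E u u + 1).
have Eu1 : 0 < E u u + 1 by rewrite ltr_wpDl.
have t0 : 0 < t by rewrite !divr_gt0.
have t1 : 0 < 1 + t^-1 by rewrite addr_gt0// invr_gt0.
(* The first entry bounds the [L^2] distance of [T v] and [T u], as [T] is 1-Lipschitz; the second
   makes the term in [E (u - v)] of [form_young] at most [e / 2]. *)
pose d := Num.min (e / 4) (e / 2 / (1 + t^-1)).
have d0 : 0 < d by rewrite lt_min !divr_gt0.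
have s0 : 0 < Num.sqrt d by rewrite sqrtr_gt0.
have [v Cv uv] := Ccoo_dense gamma0 Fu s0.
have Fv := Ccoo_F_psi gamma0 Cv; have Lv := F_psi_L2 Fv.
rewrite (E1norm_lt HF (formB HF Fu Fv) s0) sqr_sqrtr ?(ltW d0)// in uv.
have EB := sf_ge0 HF (formB HF Fu Fv).
have SB : 0 <= fine (sqint m (u \- v)) by rewrite fine_ge0// sqint_ge0.
have [uvE uvS] := lt_of_add _ _ _ EB SB uv.
have e4 : 0 < e / 4 by rewrite divr_gt0.
have [a a0 aP] := sqint_soft_unit_dist Cv e4.
have [Fw Ew] := soft_unit_F_psi a0 Cv.
exists (fun x => soft_unit a (v x)); split => //.
  have vu : (sqint m (fun x => T (v x) - T (u x))%R < (e / 4)%:E)%E.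
    apply: (@le_lt_trans _ _ (sqint m (fun x => v x - u x)%R)).
      apply: le_sqint; first by apply: measurable_funB; apply: mT; [exact: Lv.1|exact: Lu.1].
        by apply: measurable_funB; [exact: Lv.1|exact: Lu.1].
      by move=> x; exact: T_lip.
    rewrite sqintBC -[X in (X < _)%E](fineK (sqint_fin (L2B Lu Lv))) lte_fin.
    by apply: (lt_le_trans uvS); rewrite ge_min lexx.
  have := sqint_split (F_psi_L2 Fw).1 (mT _ Lv.1) (mT _ Lu.1) aP vu.
  by congr (_ < _%:E)%E; field.
apply: (le_trans Ew); have := form_young HF t0 Fu Fv.
have : (1 + t^-1) * E (u \- v) (u \- v) <= e / 2.
  have : E (u \- v) (u \- v) <= e / 2 / (1 + t^-1).
    by apply: (le_trans (ltW uvE)); rewrite ge_min lexx orbT.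
  by rewrite ler_pdivlMr// mulrC.
have : t * E u u <= e / 2.
  by rewrite /t mulrAC ler_pdivrMr// ler_pM2l ?divr_gt0// lerDl.
rewrite [(1 + t) * _]mulrDl mul1r -addrA => h1 h2 h3; apply: (le_trans h3).
apply: lerD; first exact: lexx.
by apply: (le_trans (lerD h1 h2)); rewrite -splitr.
Qed.

End markov.

Theorem theorem2p1 (R : realType) (gamma : R) (hgamma : 0 < gamma) :
  regular_dirichlet_form (psi2dx gamma) (E_psi gamma) (F_psi gamma) /\
  is_core (psi2dx gamma) (E_psi gamma) (F_psi gamma) Ccoo.
Proof.
have CF := Ccoo_F_psi hgamma.
have CC : Ccoo `<=` @Cc R by move=> f; exact: Ccoo_Cc.
split; last exact: is_core_psi.
split.
- exact: psi2dx_radon.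
- split; [exact: sym_form_psi|exact: closed_form_psi|exact: markovian_form_psi].
- apply: is_core_psi => [//|f Cf|f []//|f []//].
  by split; [exact: CF|exact: CC].
Qed.
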